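(* Let $n\ge2$, $v\in\mathsf H_+$ and $m=(m_1,\dots,m_n)\in\{\pm1\}^n$ with $\prod_{i=1}^nm_i=1$. Then $\overline{\mathsf E}_{\mathrm{SL}_n(\mathbb Z)}(v,m)=\underline{\mathsf E}_{\mathrm{SL}_n(\mathbb Z)}(v,m)$, and the common value satisfies $$\mathsf E_{\mathrm{SL}_n(\mathbb Z)}(v,m)=\rho_{\mathrm{SL}_n}(v).$$ Moreover $$\rho_{\mathrm{SL}_n}(v)\le\underline{\mathsf E}^{\star}_{\mathrm{SL}_n(\mathbb Z)}(v,m)\le\overline{\mathsf E}^{\star}_{\mathrm{SL}_n(\mathbb Z)}(v,m)\le2\rho_{\mathrm{SL}_n}(v).$$
   Context: $\mathsf H_+=\{v\in\mathbb R^n:\ \sum_iv_i=0,\ v_1>\dots>v_n\}$ and $\rho_{\mathrm{SL}_n}(v)=\tfrac12\sum_{i<j}(v_i-v_j)=\sum_{i=1}^{n-1}(n-i)v_i$. For $g\in\mathrm{SL}_n(\mathbb R)$ the Jordan projection $\lambda(g)=(\lambda_1(g)\ge\dots\ge\lambda_n(g))$ is the vector of logarithms of the moduli of the eigenvalues of $g$, with multiplicity, in non-increasing order. $g$ is loxodromic if its eigenvalues have pairwise distinct moduli; then its eigenvalues are real, written $m_i(g)e^{\lambda_i(g)}$ with $m_i(g)\in\{\pm1\}$, and $m(g)=(m_1(g),\dots,m_n(g))$. The condition $m(\gamma)=m$ below includes that $\gamma$ is loxodromic. Fix a norm $\|\cdot\|$ on $\mathbb R^n$; $\|x-\mathbb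 R_+v\|$ is the distance from $x$ to the ray $\mathbb R_+v$. Let $[\mathrm{SL}_n(\mathbb Z)]$ be the set of $\mathrm{SL}_n(\mathbb Z)$-conjugacy classes. Put $$N_\varepsilon(T,v,m)=\#\{\lambda(\gamma):\gamma\in\mathrm{SL}_n(\mathbb Z),\ \|\lambda(\gamma)-\mathbb R_+v\|\le\varepsilon,\ \|\lambda(\gamma)\|\le T,\ m(\gamma)=m\},$$ $$M_\varepsilon(T,v,m)=\#\{[\gamma]\in[\mathrm{SL}_n(\mathbb Z)]:\ \|\lambda(\gamma)-\mathbb R_+v\|\le\varepsilon,\ \|\lambda(\gamma)\|\le T,\ m(\gamma)=m\}.$$ Define $$\overline{\mathsf E}_{\mathrm{SL}_n(\mathbb Z)}(v,m)=\|v\|\lim_{\varepsilon\to0}\limsup_{T\to\infty}\tfrac1T\log N_\varepsilon(T,v,m),\quad \underline{\mathsf E}_{\mathrm{SL}_n(\mathbb Z)}(v,m)=\|v\|\lim_{\varepsilon\to0}\liminf_{T\to\infty}\tfrac1T\log N_\varepsilon(T,v,m),$$ and define $\overline{\mathsf E}^\star_{\mathrm{SL}_n(\mathbb Z)}(v,m)$, $\underline{\mathsf E}^\star_{\mathrm{SL}_n(\mathbb Z)}(v,m)$ by the same formulas with $M_\varepsilon$ in place of $N_\varepsilon$. These are norm-independent. When the upper and lower values (without $\star$) agree, the common value is $\mathsf E_{\mathrm{SL}_n(\mathbb Z)}(v,m)$. *)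

(* Defs.v *)
From HB Require Import structures.
From mathcomp Require Import all_boot all_order all_algebra.
From mathcomp Require Import complex.
From mathcomp Require Import all_classical all_reals all_analysis.
Set Implicit Arguments.
Unset Strict Implicit.
Unset Printing Implicit Defensive.
Import Order.TTheory GRing.Theory Num.Theory.
Import numFieldNormedType.Exports.
Local Open Scope classical_set_scope.
Local Open Scope ring_scope.

Section VectorsAndNorms.
Variables (R : realType) (n : nat).
Implicit Types (nrm : 'rV[R]_n -> R) (v x : 'rV[R]_n).

(* An arbitrary norm on R^n, not the canonical (sup) norm of 'rV[R]_n. *)
Definition is_norm nrm : Prop :=
  [/\ forall x y, nrm (x + y) <= nrm x + nrm y,
      forall (a : R) x, nrm (a *: x) = `|a| * nrm x
    & forall x, nrm x = 0 -> x = 0].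

Definition dist_ray nrm v x : R :=
  inf [set nrm (x - t *: v) | t in [set t : R | 0 <= t]].

Definition Hplus : set 'rV[R]_n :=
  [set v | \sum_i v 0 i = 0 /\
           forall i j : 'I_n, (i < j)%N -> v 0 j < v 0 i].

Definition rho v : R :=
  2^-1 * \sum_(i < n) \sum_(j < n | (i < j)%N) (v 0 i - v 0 j).

End VectorsAndNorms.

Section JordanProjection.
Variables (R : realType) (n : nat).
Implicit Type g : 'M[R]_n.

(* Complex roots of the characteristic polynomial, with multiplicity, in no
   particular order. *)
Definition eigenvalues g : seq R[i] :=
  sval (closed_field_poly_normal (char_poly (map_mx (real_complex R) g))).

Definition sorted_eigenvalues g : seq R[i] :=
  sort (fun z w => ComplexField.Normc.normc w <= ComplexField.Normc.normc z)
    (eigenvalues g).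

Definition jordan_proj g : 'rV[R]_n :=
  \row_(i < n) ln (ComplexField.Normc.normc (sorted_eigenvalues g)`_i).

Definition loxodromic g : Prop :=
  uniq [seq ComplexField.Normc.normc z | z <- eigenvalues g].

(* m(g) = m: the matrix g is loxodromic and its eigenvalue of i-th largest
   modulus is m_i e^(lambda_i(g)). *)
Definition has_signs g (m : 'I_n -> int) : Prop :=
  loxodromic g /\
  forall i : 'I_n,
    (sorted_eigenvalues g)`_i
    = real_complex R ((m i)%:~R * expR (jordan_proj g 0 i)).

End JordanProjection.

Section Counting.
Variables (R : realType) (n : nat).
Implicit Types (nrm : 'rV[R]_n -> R) (v : 'rV[R]_n) (m : 'I_n -> int).

Definition SLZ : set 'M[int]_n := [set g | \det g = 1].

Definition conj_class (g : 'M[int]_n) : set 'M[int]_n :=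
  [set p *m g *m invmx p | p in SLZ].

Definition realmx (g : 'M[int]_n) : 'M[R]_n := map_mx intr g.

Definition admissible nrm v m (eps T : R) : set 'M[int]_n :=
  [set g | [/\ SLZ g,
      dist_ray nrm v (jordan_proj (realmx g)) <= eps,
      nrm (jordan_proj (realmx g)) <= T
    & has_signs (realmx g) m]].

Definition count_jordan nrm v m (eps T : R) : \bar R :=
  counting [set jordan_proj (realmx g) | g in admissible nrm v m eps T].

Definition count_classes nrm v m (eps T : R) : \bar R :=
  counting [set conj_class g | g in admissible nrm v m eps T].

End Counting.

Section GrowthIndicators.
Variables (R : realType) (n : nat).
Implicit Types (nrm : 'rV[R]_n -> R) (v : 'rV[R]_n) (m : 'I_n -> int).
Local Open Scope ereal_scope.

(* Values in \bar R, with log 0 = -oo. *)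
Definition upper_rate (N : R -> R -> \bar R) : \bar R :=
  lim (limf_esup (fun T : R => T^-1%:E * lne (N eps T)) (pinfty_nbhs R)
       @[eps --> (0 : R)^'+]).

Definition lower_rate (N : R -> R -> \bar R) : \bar R :=
  lim (limf_einf (fun T : R => T^-1%:E * lne (N eps T)) (pinfty_nbhs R)
       @[eps --> (0 : R)^'+]).

Definition upperE nrm v m : \bar R :=
  (nrm v)%:E * upper_rate (count_jordan nrm v m).

Definition lowerE nrm v m : \bar R :=
  (nrm v)%:E * lower_rate (count_jordan nrm v m).

Definition upperE_star nrm v m : \bar R :=
  (nrm v)%:E * upper_rate (count_classes nrm v m).

Definition lowerE_star nrm v m : \bar R :=
  (nrm v)%:E * lower_rate (count_classes nrm v m).

End GrowthIndicators.

(* Main.v *)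
Require Import Defs.
From HB Require Import structures.
From mathcomp Require Import all_boot all_order all_algebra.
From mathcomp Require finmap.
From mathcomp Require Import complex.
From mathcomp Require Import all_classical all_reals all_analysis.
From mathcomp Require Import zify ring lra.
Set Implicit Arguments.
Unset Strict Implicit.
Unset Printing Implicit Defensive.
Import Order.TTheory GRing.Theory Num.Theory.
Import numFieldNormedType.Exports.
Import Defs.
Local Open Scope ring_scope.

(** Why the theorem holds.

    Write s_k = v_1 + ... + v_k, so that s_1 + ... + s_(n-1) = rho(v), and let t
    grow.  If lambda(g) stays at bounded distance from t v, then the coefficient
    of degree n - k of the characteristic polynomial of g is O(e^(t s_k)); since
    lambda(g) depends only on that polynomial, at most O(e^(t rho(v))) Jordan
    projections occur (count_jordan_le).  Conversely, choose integers b_k in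
    [e^(t s_k), e^(t s_k + d)].  Because v lies in the open chamber, the polynomial
    with coefficients +- b_k has, at the points of modulus e^(t v_i +- 3d), a single
    dominant term, and its sign changes force a real root of each prescribed sign
    and approximate size (signed_poly_root).  Its companion matrix lies in SL_n(Z)
    (prescribed_spectrum), and there are of the order of e^(t rho(v)) choices of the
    b_k (count_jordan_ge).  Hence both growth rates of Jordan projections are rho(v),
    and conjugacy classes are at least as numerous as Jordan projections.

    For the upper bound on classes, fix the characteristic polynomial f, with real
    simple roots mu_i.  Choose an integer row vector l for which the determinant of
    the Krylov matrix with rows l g^k is nonzero and of least absolute value.  By
    Minkowski's theorem on linear forms, applied in eigencoordinates, this value is
    at most a constant times the Vandermonde determinant of the mu_i, that is
    O(e^(t rho(v))): a shorter lattice vector x would make the value at l + x or at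
    l - x smaller, because the product of (1 + y)(1 - y) over coordinates y of
    absolute value at most 1/2 is less than 1 (small_cyclic_vector).  Making the
    Krylov matrix triangular by unimodular column operations conjugates g to a lower
    Hessenberg matrix B whose superdiagonal entries r_j have a weighted product
    bounded by that determinant (hessenberg_reduction).  Unipotent conjugation
    reduces the entries below r_j in its column modulo r_j (normal_form), so the
    number of choices of these entries is O(e^(t rho(v))) up to a power of t.
    The r_j themselves are almost free: modulo r_j the matrix is block triangular,
    so by the Cayley-Hamilton theorem r_j divides an entry of f(A_j), where A_j is
    the trailing block from index j on (superdiag_dvd); the reduction is arranged so
    that this entry is nonzero, and the divisor bound leaves e^(o(t)) possibilities
    (code_columns).  The first column is then determined by f (hess_determined).
    Together with the O(e^(t rho(v))) choices of f this gives e^((2 rho(v) + o(1)) t)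
    classes (count_classes_le). *)

(** * Divisors, and tuples with bounded product *)

Section NaturalNumbers.
Local Open Scope nat_scope.

(** With q the quotient of e by k, e + 1 <= k (q + 1) <= k 2^q; then raise to the power k. *)
Lemma exp_succ_le_pow2 k e : e.+1 ^ k <= k ^ k * 2 ^ e.
Proof.
case: k => [|k]; first by rewrite !expn0 mul1n expn_gt0.
have le_e : e.+1 <= k.+1 * 2 ^ (e %/ k.+1).
  apply: (@leq_trans (k.+1 * (e %/ k.+1).+1)).
    by rewrite mulnC; apply: ltn_ceil.
  by rewrite leq_mul2l /= ltn_expl.
apply: (@leq_trans ((k.+1 * 2 ^ (e %/ k.+1)) ^ k.+1)); first by rewrite leq_exp2r.
rewrite expnMn leq_mul2l; apply/orP; right.
by rewrite -expnM leq_exp2l // leq_divM.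
Qed.

Lemma size_divisors_pfactor p e m : prime p -> 0 < m ->
  size (divisors (p ^ e * m)) <= e.+1 * size (divisors m).
Proof.
move=> pr_p m_gt0; have p_gt0 := prime_gt0 pr_p.
have pe_gt0 : 0 < p ^ e by rewrite expn_gt0 p_gt0.
have -> : e.+1 * size (divisors m) =
    size [seq p ^ i * d | i <- iota 0 e.+1, d <- divisors m].
  by rewrite size_allpairs size_iota.
apply: uniq_leq_size => [|d]; first exact: divisors_uniq.
rewrite -dvdn_divisors ?muln_gt0 ?pe_gt0 // => d_dvd.
have d_gt0 : 0 < d by apply: dvdn_gt0 d_dvd; rewrite muln_gt0 pe_gt0.
have g1_dvd : gcdn d (p ^ e) %| p ^ e by rewrite dvdn_gcdr.
have /(dvdn_pfactor _ _ pr_p)[i le_ie gE] := g1_dvd.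
apply/allpairsP; exists (i, d %/ p ^ i); split.
- by rewrite mem_iota /= add0n ltnS.
- rewrite /= -dvdn_divisors // -gE.
  have g_gt0 : 0 < gcdn d (p ^ e) by rewrite gcdn_gt0 d_gt0.
  rewrite -(@Gauss_dvdr _ (p ^ e %/ gcdn d (p ^ e))).
    rewrite -(@dvdn_pmul2l (gcdn d (p ^ e))) // mulnA (mulnC _ (d %/ _)).
    by rewrite (divnK (dvdn_gcdl _ _)) (mulnC _ (p ^ e %/ _)) (divnK g1_dvd).
  rewrite /coprime -(eqn_pmul2r g_gt0) muln_gcdl mul1n.
  by rewrite (divnK (dvdn_gcdl _ _)) (divnK g1_dvd).
- by rewrite /= mulnC divnK // -gE dvdn_gcdl.
Qed.

(** Removing from n its least prime p, of exponent e, divides the number of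
    divisors by at most e + 1.  If p >= 2^k then (e + 1)^k <= 2^(k e) <= p^e, so that
    only the primes below 2^k cost a constant factor k^k. *)
Lemma small_prime_weight k n : 0 < n ->
  size (divisors n) ^ k
    <= (k ^ k) ^ (\sum_(q < 2 ^ k) (prime q && (q %| n))) * n.
Proof.
have A_gt0 : 0 < k ^ k by case: k => // k; rewrite expn_gt0.
elim/ltn_ind: n => n IHn n_gt0.
have [->|n_neq1] := eqVneq n 1.
  by rewrite (_ : size (divisors 1) = 1) // exp1n muln1 expn_gt0 A_gt0.
have n_gt1 : 1 < n by lia.
have pr_p := pdiv_prime n_gt1; set p := pdiv n in pr_p.
have [m cop_pm nE] := pfactor_coprime pr_p n_gt0; set e := logn p n in nE.
have m_gt0 : 0 < m by move: n_gt0; rewrite {1}nE muln_gt0 => /andP[].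
have e_gt0 : 0 < e by rewrite logn_gt0 mem_primes pr_p n_gt0 pdiv_dvd.
have m_lt : m < n.
  rewrite {1}nE -{1}[m]muln1 ltn_pmul2l //.
  by apply: leq_trans (prime_gt1 pr_p) _; rewrite -{1}[p]expn1 leq_exp2l ?prime_gt1.
have := IHn m m_lt m_gt0; set nat_sign := \sum_(_ < _) _; set wn := \sum_(_ < _) _.
move=> IHm.
have div_le : size (divisors n) ^ k <= e.+1 ^ k * size (divisors m) ^ k.
  rewrite -expnMn; case: (posnP k) => [-> //|k_gt0]; rewrite leq_exp2r //.
  by rewrite nE mulnC size_divisors_pfactor.
apply: leq_trans div_le _; apply: leq_trans (leq_mul (leqnn _) IHm) _.
have m_dvd q : q %| m -> q %| n by rewrite nE; apply: dvdn_mulr.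
have [lt_p|le_p] := ltnP p (2 ^ k).
  have wS : nat_sign.+1 <= wn.
    rewrite /nat_sign /wn (bigD1 (Ordinal lt_p)) //= [leqRHS](bigD1 (Ordinal lt_p)) //=.
    have -> : p %| m = false by apply/negP => pm; move: cop_pm; rewrite prime_coprime // pm.
    rewrite pr_p pdiv_dvd /= add0n add1n ltnS; apply: leq_sum => q _.
    by case: prime => //=; case: (boolP (_ %| m)) => // /m_dvd->.
  apply: (@leq_trans ((k ^ k * p ^ e) * ((k ^ k) ^ nat_sign * m))).
    rewrite leq_mul2r; apply/orP; right; apply: leq_trans (exp_succ_le_pow2 _ _) _.
    by rewrite leq_mul2l leq_exp2r ?prime_gt1 // orbT.
  rewrite [in leqRHS]nE mulnACA -expnS [p ^ e * m]mulnC.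
  rewrite leq_mul2r; apply/orP; right.
  by rewrite leq_pexp2l.
have w_le : nat_sign <= wn.
  apply: leq_sum => q _.
  by case: prime => //=; case: (boolP (_ %| m)) => // /m_dvd->.
apply: (@leq_trans (p ^ e * ((k ^ k) ^ nat_sign * m))).
  rewrite leq_mul2r; apply/orP; right.
  case: (posnP k) => [->|k_gt0]; first by rewrite expn0 expn_gt0 (prime_gt0 pr_p).
  apply: (@leq_trans ((2 ^ e) ^ k)); first by rewrite leq_exp2r // ltn_expl.
  by rewrite -expnM mulnC expnM leq_exp2r.
rewrite [in leqRHS]nE mulnCA [p ^ e * m]mulnC leq_mul2r; apply/orP; right.
by rewrite leq_pexp2l.
Qed.

(** The divisor bound d(n) = O(n^(1/k)) for every k, stated without roots. *)
Lemma divisor_bound k : exists C, forall n, 0 < n ->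
  size (divisors n) ^ k <= C * n.
Proof.
exists ((k ^ k) ^ (2 ^ k)) => n n_gt0.
apply: leq_trans (small_prime_weight k n_gt0) _.
rewrite leq_mul2r; apply/orP; right; apply: leq_pexp2l.
  by case: k => // k; rewrite expn_gt0.
rewrite -[leqRHS]muln1 -[in leqRHS](card_ord (2 ^ k)) -sum_nat_const.
by apply: leq_sum => i _; apply: leq_b1.
Qed.

(** Sort the tuples by the dyadic interval of each coordinate.  A box of
    exponents k_i contains the product of the 2^(k_i) tuples, and this is at most Y
    as soon as the box meets the set. *)
Lemma card_prod_le (I : finType) (Y : nat) : 0 < Y ->
  #|[set a : {ffun I -> 'I_Y.+1} | [forall i, 0 < a i] && (\prod_i a i <= Y)]|
    <= (trunc_log 2 Y).+1 ^ #|I| * Y.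
Proof.
move=> Y_gt0; set A := [set _ | _]; set L := (trunc_log 2 Y).+1.
pose box (k : {ffun I -> 'I_L}) : pred {ffun I -> 'I_Y.+1} :=
  [pred a : {ffun I -> 'I_Y.+1} | [forall i, 2 ^ k i <= a i < 2 ^ (k i).+1]].
have covA : A \subset \bigcup_(k : {ffun I -> 'I_L})
    [set a in A | box k a].
  apply/fintype.subsetP => a aA; pose k := [ffun i => inord (trunc_log 2 (a i)) : 'I_L].
  apply/finset.bigcupP; exists k => //; rewrite inE aA /=; apply/forallP => i.
  move: aA; rewrite inE => /andP[/forallP a_gt0 _].
  rewrite ffunE inordK; first by apply: trunc_log_bounds.
  by rewrite ltnS leq_trunc_log // -ltnS.
apply: leq_trans (subset_leq_card covA) _.
apply: leq_trans (_ : \sum_(k : {ffun I -> 'I_L}) #|[set a in A | box k a]| <= _).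
  apply: (big_ind2 (fun (X : {set _}) s => #|X| <= s)) => [|X s Y' s' hX hY|//].
    by rewrite cards0.
  by apply: leq_trans (leq_card_setU _ _) _; apply: leq_add.
have card_box (k : {ffun I -> 'I_L}) : #|[set a in A | box k a]| <= Y.
  have [->|[a]] := set_0Vmem [set a in A | box k a]; first by rewrite cards0.
  rewrite !inE => /andP[/andP[_ le_aY] /forallP box_a].
  apply: leq_trans le_aY; apply: (@leq_trans (\prod_i 2 ^ k i)); last first.
    by apply: leq_prod => i _; case/andP: (box_a i).
  apply: leq_trans (_ : #|family (fun i => [pred x : 'I_Y.+1 |
     2 ^ k i <= x < 2 ^ (k i).+1])| <= _).
    apply: subset_leq_card; apply/fintype.subsetP => b; rewrite inE => /andP[_ /forallP hb].
    by apply/familyP => i; have := hb i.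
  rewrite card_family foldrE big_map big_enum /=; apply: leq_prod => i _.
  rewrite -[leqRHS]card_ord.
  pose g (x : 'I_Y.+1) : 'I_(2 ^ k i).-1.+1 := inord (x - 2 ^ k i).
  have e2 : (2 ^ k i).-1.+1 = 2 ^ k i by rewrite prednK // expn_gt0.
  rewrite -[in leqRHS]e2; rewrite -(@card_in_imset _ _ g).
    by apply: leq_trans (max_card _) _; rewrite !card_ord.
  move=> x y; rewrite -!topredE /= => /andP[x1 x2] /andP[y1 y2] /(congr1 val) /=.
  rewrite expnS in x2 y2; have t_gt0 : 0 < 2 ^ k i by rewrite expn_gt0.
  move: (2 ^ k i) t_gt0 e2 @g x1 x2 y1 y2 => t t_gt0 e2 g x1 x2 y1 y2.
  have x_lt : x - t < t.-1.+1 by lia.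
  have y_lt : y - t < t.-1.+1 by lia.
  by rewrite (inordK x_lt) (inordK y_lt) => exy; apply: ord_inj; lia.
apply: (@leq_trans (\sum_(k : {ffun I -> 'I_L}) Y)).
  by apply: leq_sum => k _; apply: card_box.
by rewrite sum_nat_const card_ffun card_ord.
Qed.

End NaturalNumbers.

(** * Short lattice vectors *)

Section GeometryOfNumbers.
Local Open Scope classical_set_scope.

(** Used to replace a real matrix by a rational approximation in Minkowski's theorem. *)
Lemma det_cvg (R : realType) n (A : nat -> 'M[R]_n) (F : 'M[R]_n) :
  (forall i j, A N i j @[N --> \oo] --> F i j) ->
  \det (A N) @[N --> \oo] --> \det F.
Proof.
move=> AF; rewrite /determinant; apply: cvg_big => [|s _]; first exact: add_continuous.
apply: cvgM; first exact: cvg_cst.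
by apply: cvg_big => [|i _]; [exact: mul_continuous | exact: AF].
Qed.

(** Pigeonhole: the cube [0, N]^n has more integer points than the row lattice
    of G has cosets, a number which the Smith form shows to be |det G|. *)
Lemma short_lattice_vector_int n (G : 'M[int]_n) (N : nat) :
  \det G != 0 -> (`|\det G| < N.+1 ^ n)%N ->
  exists2 x : 'rV[int]_n, x != 0 & forall j, `|(x *m G) 0 j| <= N%:Z.
Proof.
have [L L_unit [Q Q_unit [ds _ GE]]] := int_Smith_normal_form G.
move=> detG_neq0 detG_lt; set D := \matrix_(i, j) _ in GE; pose d (k : nat) : int := ds`_k.
have DE : D = diag_mx (\row_i d i).
  by apply/matrixP => i j; rewrite !mxE -[i == j :> nat]/(i == j).
have absU (U : 'M[int]_n) : U \in unitmx -> `|\det U|%N = 1%N.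
  move=> U_unit; have := congr1 (fun V => `|\det V|%N) (mulmxV U_unit).
  by rewrite det_mulmx det1 abszM => /eqP; rewrite muln_eq1 => /andP[/eqP].
have detGE : `|\det G|%N = (\prod_(i < n) `|d i|)%N.
  rewrite GE !det_mulmx !abszM (absU _ L_unit) (absU _ Q_unit) mul1n muln1.
  rewrite DE det_diag; elim/big_rec2: _ => // i a b _.
  by rewrite mxE abszM => ->.
have d_gt0 (i : 'I_n) : (0 < `|d i|)%N.
  rewrite lt0n; apply: contraNneq detG_neq0 => di0.
  by rewrite -absz_eq0 detGE (bigD1 i) //= di0 mul0n.
pose tovec (z : {ffun 'I_n -> 'I_N.+1}) : 'rV[int]_n := \row_j (z j : nat)%:Z.
pose cd z i := (tovec z *m invmx Q) 0 i.
pose red z : {dffun forall i : 'I_n, 'I_(`|d i|.-1.+1)} :=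
  [ffun i : 'I_n => inord `|(cd z i %% d i)%Z|].
have : ~~ injectiveb red.
  apply/negP => /injectiveP /leq_card.
  rewrite card_ffun card_dep_ffun !card_ord foldrE big_map big_enum /= leqNgt.
  rewrite (eq_bigr (fun i : 'I_n => `|d i|)%N) -?detGE ?detG_lt // => i _.
  by rewrite card_ord prednK.
case/injectivePn => z [z' neq_zz' eq_red].
pose w := tovec z - tovec z'; pose q : 'rV[int]_n :=
  \row_i ((w *m invmx Q) 0%R i %/ d i)%Z.
have wE : w *m invmx Q = q *m D.
  apply/rowP => i; rewrite DE mul_mx_diag [RHS]mxE [q 0 i]mxE.
  rewrite [(\row_i0 d i0) 0 i]mxE.
  suff /dvdzP[c ->] : (d i %| (w *m invmx Q) 0%R i)%Z.
    by rewrite mulzK // -absz_eq0 -lt0n.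
  rewrite /w mulmxBl mxE [X in _ + X]mxE -/(cd z i) -/(cd z' i) -eqz_mod_dvd.
  apply/eqP.
  have di_neq0 : d i != 0 by rewrite -absz_eq0 -lt0n.
  have mod_lt (a : int) : (`|(a %% d i)%Z| < `|d i|.-1.+1)%N.
    rewrite prednK //; have := ltz_mod a di_neq0; have := modz_ge0 a di_neq0; lia.
  have := congr1 (fun f : {dffun forall i : 'I_n, 'I_(`|d i|.-1.+1)} => val (f i)) eq_red.
  rewrite /= !ffunE /= (inordK (mod_lt _)) (inordK (mod_lt _)).
  move: (modz_ge0 (cd z i) di_neq0).
  move: (modz_ge0 (cd z' i) di_neq0).
  move: (cd z i %% d i)%Z (cd z' i %% d i)%Z => a b b0 a0 eq_ab.
  by rewrite -(gez0_abs a0) eq_ab gez0_abs.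
have wE' : w = (q *m invmx L) *m G.
  rewrite GE -!mulmxA (mulmxA (invmx L)) mulVmx // mul1mx mulmxA -wE.
  by rewrite -mulmxA mulVmx // mulmx1.
exists (q *m invmx L); last first.
  move=> j; rewrite -wE' !mxE; have := ltn_ord (z j); have := ltn_ord (z' j).
  move: (z j : nat) (z' j : nat) => a b b_lt a_lt.
  rewrite ler_norml; apply/andP; split; lia.
apply: contraNneq neq_zz' => x0.
move: wE'; rewrite x0 mul0mx => /eqP; rewrite subr_eq0 => /eqP eqzz'.
apply/eqP/ffunP => i; apply: val_inj.
by have := congr1 (fun m : 'rV_n => m 0 i) eqzz'; rewrite !mxE => -[].
Qed.

Definition round_mx (R : realType) n (F : 'M[R]_n) (N : nat) : 'M[int]_n :=
  \matrix_(i, j) Num.floor (N%:R * F i j).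

(** Minkowski's theorem on linear forms with a weak constant.  The pigeonhole
    statement applies to an integer rounding of (N + 1) F; the vector x it provides
    is bounded independently of N because F is invertible, so that the rounding
    error is negligible for large N. *)
Lemma short_lattice_vector (R : realType) n (F : 'M[R]_n) :
  F \in unitmx -> `|\det F| < 1 ->
  exists2 x : 'rV[int]_n, x != 0 & forall j, `|(map_mx intr x *m F) 0 j| <= 2.
Proof.
move=> F_unit detF_lt1.
have detF_neq0 : \det F != 0 by rewrite -unitfE -unitmxE.
pose G N := round_mx F N.+1.
pose A N : 'M[R]_n := N.+1%:R^-1 *: map_mx intr (G N).
have N0 N : 0 < N.+1%:R :> R by rewrite ltr0n.
have err N i j : `|F i j - A N i j| <= N.+1%:R^-1.
  rewrite !mxE; have /andP[f1 f2] := floor_itv (N.+1%:R * F i j).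
  rewrite -[X in `|X - _|](mulKf (lt0r_neq0 (N0 N))) -mulrBr normrM.
  rewrite gtr0_norm ?invr_gt0 // -[leRHS]mulr1 ler_pM2l ?invr_gt0 //.
  by rewrite ger0_norm ?subr_ge0 // lerBlDl; move: f2; rewrite intrD => /ltW.
have AF i j : A N i j @[N --> \oo] --> F i j.
  apply/cvgrPdist_le => e e_gt0; near=> N.
  apply: le_trans (err N i j) _; apply: ltW; near: N.
  exact: (near_infty_natSinv_lt (PosNum e_gt0)).
have detAF := det_cvg AF.
pose M := \sum_i \sum_j `|invmx F i j|.
have [N [N_detlt N_det0 N_ge]] : exists N, [/\ `|\det (A N)| < 1,
    \det (A N) != 0 & 2 * M <= N%:R].
  apply: (@filter_ex _ \oo); near=> N; split.
  - by near: N; apply: cvgr_lt detF_lt1; apply: cvg_norm.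
  - near: N; exact: (cvgr_neq0 (\det F) detAF detF_neq0).
  - near: N; exact: nbhs_infty_ger.
have detAE : \det (A N) = N.+1%:R ^- n * (\det (G N))%:~R.
  by rewrite detZ det_map_mx -exprVn.
have detG_neq0 : \det (G N) != 0.
  by move: N_det0; rewrite detAE mulf_eq0 intr_eq0 => /norP[].
have [||x x_neq0 xG_le] := @short_lattice_vector_int n (G N) N.+1 => //.
  rewrite -(ltr_nat R) natr_absz intr_norm.
  apply: (@lt_le_trans _ _ (N.+1%:R ^+ n)); last first.
    by rewrite natrX lerXn2r ?nnegrE ?ler0n // ler_nat.
  move: N_detlt; rewrite detAE normrM gtr0_norm ?invr_gt0 ?exprn_gt0 //.
  by rewrite mulrC ltr_pdivrMr ?exprn_gt0 // mul1r.
exists x => // j; set X : 'rV[R]_n := map_mx intr x.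
pose S := \sum_i `|X 0 i|.
have XA_le k : `|(X *m A N) 0 k| <= 1.
  rewrite -scalemxAr mxE -map_mxM mxE normrM gtr0_norm ?invr_gt0 //.
  by rewrite mulrC ler_pdivrMr // mul1r -intr_norm -[N.+1%:R]/((N.+1%:Z)%:~R) ler_int.
have XF_le k : `|(X *m F) 0 k| <= 1 + S / N.+1%:R.
  have -> : (X *m F) 0 k = (X *m A N) 0 k + (X *m (F - A N)) 0 k.
    by rewrite mulmxBr [X in _ = _ + X]mxE [X in _ + (_ + X)]mxE addrC subrK.
  apply: le_trans (ler_normD _ _) (lerD (XA_le k) _).
  rewrite mxE mulr_suml; apply: le_trans (ler_norm_sum _ _ _) _.
  apply: ler_sum => i _; rewrite normrM ler_wpM2l //.
  by rewrite mxE [X in _ + X]mxE; apply: err.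
have S_le : S <= (1 + S / N.+1%:R) * M.
  rewrite /S /M exchange_big /= mulr_sumr; apply: ler_sum => i _.
  rewrite -{1}(mulmxK F_unit X) mxE mulr_sumr.
  apply: le_trans (ler_norm_sum _ _ _) _; apply: ler_sum => k _.
  by rewrite normrM ler_wpM2r.
have S_ge0 : 0 <= S by apply: sumr_ge0.
have N1 : 2 * M <= N.+1%:R by apply: le_trans N_ge _; rewrite ler_nat.
apply: le_trans (XF_le j) _.
suff S_N : S / N.+1%:R <= 1 by rewrite -[2]/(1 + 1) lerD2l.
rewrite ler_pdivrMr // mul1r; apply: le_trans N1.
have t_le : S / N.+1%:R * M <= S / 2.
  rewrite -mulrA ler_wpM2l // mulrC ler_pdivrMr //; lra.
move: S_le; rewrite mulrDl mul1r; move: t_le; set u := S / _ * M; lra.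
Unshelve. all: by end_near.
Qed.

End GeometryOfNumbers.

(** * Cyclic vectors of small discriminant *)

Lemma nat_nonroot (R : numDomainType) (p : {poly R}) :
  p != 0 -> exists s : nat, p.[s%:R] != 0.
Proof.
move=> p_neq0; apply: contrapT => no_s.
have /(max_poly_roots p_neq0) : all (root p) [seq s%:R | s <- iota 0 (size p)].
  apply/allP => _ /mapP[s _ ->]; apply/rootP/eqP/negP => /negP ps.
  by apply: no_s; exists s.
rewrite map_inj_uniq ?iota_uniq // ?size_map ?size_iota ?ltnn; first by move/(_ isT).
by move=> a b /eqP; rewrite eqr_nat => /eqP.
Qed.

Lemma Vandermonde_unit (F : fieldType) n (mu : 'I_n -> F) :
  injective mu -> Vandermonde n (\row_i mu i) \in unitmx.
Proof.
move=> mu_inj; rewrite unitmxE det_Vandermonde unitfE.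
apply/prodf_neq0 => i _; apply/prodf_neq0 => j lt_ij; rewrite !mxE subr_eq0.
by apply: contraTneq lt_ij => /mu_inj ->; rewrite ltnn.
Qed.

(** If a combination u of the eigenvectors vanishes, so do its images under all
    powers of A; entrywise this is a Vandermonde system. *)
Lemma left_eigenbasis (F : fieldType) n (A : 'M[F]_n.+1) (mu : 'I_n.+1 -> F) :
  injective mu -> char_poly A = \prod_i ('X - (mu i)%:P) ->
  exists2 Y : 'M[F]_n.+1, Y \in unitmx & Y *m A = diag_mx (\row_i mu i) *m Y.
Proof.
move=> mu_inj chA.
have ev i : exists v : 'rV[F]_n.+1, v *m A = mu i *: v /\ v != 0.
  have /eigenvalueP[v vA v0] : eigenvalue A (mu i).
    rewrite eigenvalue_root_char chA rootE horner_prod (bigD1 i) //=.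
    by rewrite hornerXsubC subrr mul0r.
  by exists v.
have [v /all_and2 [vA v_neq0]] := choice ev.
pose Y := \matrix_i v i; have rowY i : row i Y = v i by apply: rowK.
have YA : Y *m A = diag_mx (\row_i mu i) *m Y.
  apply/row_matrixP => i; rewrite row_mul rowY vA.
  by apply/rowP => j; rewrite mul_diag_mx !mxE.
exists Y => //; rewrite -row_free_unit; apply: inj_row_free => u uY.
have uYk k : u *m diag_mx (\row_i (mu i ^+ k)) *m Y = 0.
  elim: k => [|k IHk].
    rewrite (_ : diag_mx _ = 1%:M) ?mulmx1 //.
    by apply/matrixP => i j; rewrite !mxE expr0.
  have -> : diag_mx (\row_i (mu i ^+ k.+1)) =
      diag_mx (\row_i mu i ^+ k) *m diag_mx (\row_i mu i).
    by rewrite mulmx_diag; congr diag_mx; apply/rowP => i; rewrite !mxE exprSr.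
  by rewrite mulmxA -(mulmxA _ _ Y) -YA mulmxA IHk mul0mx.
have uY0 i j : u 0 i * Y i j = 0.
  pose w : 'cV[F]_n.+1 := \col_i (u 0 i * Y i j).
  suff w0 : w = 0 by have := congr1 (fun m : 'cV_n.+1 => m i 0) w0; rewrite !mxE.
  rewrite -[w](mulKmx (Vandermonde_unit mu_inj)) (_ : _ *m w = 0) ?mulmx0 //.
  apply/colP => k; have := congr1 (fun m : 'rV_n.+1 => m 0 j) (uYk k).
  rewrite /= mxE [RHS]mxE => uk; rewrite mxE [RHS]mxE -[RHS]uk.
  apply: eq_bigr => i' _; rewrite mul_mx_diag !mxE; ring.
apply/rowP => i; rewrite mxE; apply/eqP; apply: contraNT (v_neq0 i) => ui.
apply/eqP/rowP => j; have /eqP := uY0 i j; rewrite mulf_eq0 (negPf ui) /=.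
by rewrite !mxE => /eqP.
Qed.

Definition krylov (R : pzRingType) n (A : 'M[R]_n.+1) (l : 'rV[R]_n.+1) :
  'M[R]_n.+1 := \matrix_(k, j) (l *m A ^+ k) 0 j.

Lemma row_krylov (R : pzRingType) n (A : 'M[R]_n.+1) l k :
  row k (krylov A l) = l *m A ^+ k.
Proof. by apply/rowP => j; rewrite !mxE. Qed.

(** Minkowski's bound on the least norm in an order.  In eigencoordinates
    y the Krylov determinant of l is det V (product of the y_i) / det E.  Take l with
    the least nonzero absolute value.  A lattice vector x with |x_i| <= |y_i| / 2 in
    these coordinates would give l + x and l - x, both with nonzero determinant,
    whose product relative to that of l is the product of the 1 - (x_i / y_i)^2 < 1. *)
Lemma small_cyclic_vector (R : realType) n (g : 'M[int]_n.+1)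
    (mu : 'I_n.+1 -> R) : injective mu ->
  char_poly (map_mx intr g : 'M[R]_n.+1) = \prod_i ('X - (mu i)%:P) ->
  exists2 l : 'rV[int]_n.+1, \det (krylov g l) != 0 &
    `|\det (krylov g l)|%:~R <= 4 ^+ n.+1 * `|\det (Vandermonde n.+1 (\row_i mu i))|.
Proof.
move=> mu_inj chg; set A : 'M[R]_n.+1 := map_mx intr g.
have [Yt Yt_unit YtA] : exists2 Y : 'M[R]_n.+1, Y \in unitmx &
    Y *m A^T = diag_mx (\row_i mu i) *m Y.
  apply: left_eigenbasis; rewrite // -chg /char_poly -[RHS]det_tr.
  by congr (\det _); apply/matrixP => i j; rewrite !mxE eq_sym.
pose E := Yt^T; have E_unit : E \in unitmx by rewrite unitmx_tr.
have AE : A *m E = E *m diag_mx (\row_i mu i).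
  by rewrite -[A]trmxK -trmx_mul YtA trmx_mul tr_diag_mx.
have AkE k : A ^+ k *m E = E *m diag_mx (\row_i (mu i ^+ k)).
  elim: k => [|k IHk].
    rewrite expr0 mul1mx (_ : diag_mx _ = 1%:M) ?mulmx1 //.
    by apply/matrixP => i j; rewrite !mxE expr0.
  rewrite exprS -mulmxE -mulmxA IHk mulmxA AE -mulmxA mulmx_diag.
  by congr (_ *m diag_mx _); apply/rowP => i; rewrite !mxE exprS.
pose V := Vandermonde n.+1 (\row_i mu i).
have V_unit : V \in unitmx by apply: Vandermonde_unit.
pose y (l : 'rV[int]_n.+1) : 'rV[R]_n.+1 := map_mx intr l *m E.
have detK l : (\det (krylov g l))%:~R * \det E = \det V * \prod_i y l 0 i.
  rewrite -det_map_mx -det_mulmx.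
  rewrite (_ : _ *m E = V *m diag_mx (y l)) ?det_mulmx ?det_diag //.
  apply/row_matrixP => k; rewrite !row_mul.
  rewrite -map_row row_krylov map_mxM rmorphXn /= -mulmxA AkE mulmxA -/(y l).
  by apply/rowP => i; rewrite !mul_mx_diag !mxE mulrC.
have detE0 : \det E != 0 by rewrite -unitfE -unitmxE.
have detV0 : \det V != 0 by rewrite -unitfE -unitmxE.
have detK0 l : (\det (krylov g l) != 0) = (\prod_i y l 0 i != 0).
  have := congr1 (fun z => z == 0) (detK l).
  by rewrite !mulf_eq0 intr_eq0 (negPf detE0) (negPf detV0) orbF /= => ->.
have [l0 l0P] : exists l, \det (krylov g l) != 0.
  (* Along the moment curve (1, s, s^2, ...) every eigencoordinate is a nonzero
     polynomial in s, so that some integer s avoids all zeros. *)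
  pose p i : {poly R} := \poly_(j < n.+1) E (inord j) i.
  have [|s] := @nat_nonroot R (\prod_i p i).
    apply/prodf_neq0 => i _; apply: contraTneq E_unit => pi0.
    rewrite -unitmx_tr -row_free_unit; apply/negP => /row_freeP[B EB].
    have Ei0 : row i E^T = 0.
      apply/rowP => j; have := congr1 (fun q : {poly R} => q`_j) pi0.
      by rewrite coef_poly ltn_ord inord_val coef0 => Eji; rewrite 2!mxE Eji mxE.
    have := congr1 (fun m : 'M[R]_n.+1 => m i i) EB.
    rewrite mxE big1 => [|j _]; first by rewrite mxE eqxx => /esym /eqP; rewrite oner_eq0.
    have := congr1 (fun m : 'rV[R]_n.+1 => m 0 j) Ei0.
    by rewrite [LHS]mxE => ->; rewrite mxE mul0r.
  rewrite horner_prod => ps; exists (\row_j (s ^ j)%N%:Z).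
  rewrite detK0; move: ps; rewrite (eq_bigr (fun i => y (\row_j (s ^ j)%N%:Z) 0 i)) //.
  move=> i _; rewrite horner_poly mxE; apply: eq_bigr => j _.
  by rewrite !mxE inord_val mulrC -natrX.
pose P d := `[< exists2 l, (0 < d)%N & `|\det (krylov g l)|%N = d >].
have exP : exists d, P d.
  exists `|\det (krylov g l0)|%N; apply/asboolP; exists l0 => //.
  by rewrite lt0n absz_eq0.
have [d /asboolP[l d_gt0 dE] d_min] := ex_minnP exP.
have l_neq0 : \det (krylov g l) != 0 by rewrite -absz_eq0 dE -lt0n.
exists l => //.
have y_neq0 i : y l 0 i != 0.
  by move: l_neq0; rewrite detK0 => /prodf_neq0; apply.
have key : `|\prod_i y l 0 i| <= 4 ^+ n.+1 * `|\det E|.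
  rewrite leNgt; apply/negP => big_y.
  (* The factor 4 turns the bound 2 on the forms into |x_i| <= |y_i| / 2. *)
  pose F := E *m diag_mx (\row_i (4 / y l 0 i)).
  have detF : \det F = \det E * (4 ^+ n.+1 / \prod_i y l 0 i).
    rewrite det_mulmx det_diag; congr (_ * _).
    under eq_bigr do rewrite mxE.
    by rewrite big_split /= prodr_const card_ord prodfV.
  have [|| x x_neq0 xF] := @short_lattice_vector R n.+1 F.
  - rewrite unitmxE detF unitfE !mulf_neq0 ?invr_eq0 ?expf_neq0 ?pnatr_eq0 //.
    exact/prodf_neq0.
  - rewrite detF mulrA normrM normfV ltr_pdivrMr ?mul1r.
      by rewrite normrM mulrC normrX ger0_norm.
    by rewrite normr_gt0; apply/prodf_neq0.
  pose th i := y x 0 i / y l 0 i.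
  have th_le i : `|th i| <= 2^-1.
    have := xF i; rewrite mulmxA -/(y x) mul_mx_diag mxE [X in _ * X]mxE.
    rewrite mulrCA normrM (ger0_norm (ler0n _ 4)) -/(th i); lra.
  have ylx (s : int) i : y (l + s *: x) 0 i = y l 0 i * (1 + s%:~R * th i).
    rewrite /y map_mxD map_mxZ mulmxDl -scalemxAl mxE [X in _ + X]mxE -/(y x) -/(y l).
    by rewrite mulrDr mulr1 mulrCA /th [y l 0 i * _]mulrC divfK.
  have prod_pos (s : int) : `|s| = 1 -> 0 < \prod_i (1 + s%:~R * th i).
    move=> s1; apply: prodr_gt0 => i _.
    have : `|s%:~R * th i| <= 2^-1 by rewrite normrM -intr_norm s1 mul1r.
    by rewrite ler_norml => /andP[]; lra.
  have d_le (s : int) : `|s| = 1 -> 1 <= \prod_i (1 + s%:~R * th i).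
    move=> s1; have pos := prod_pos s s1.
    have yls : \prod_i y (l + s *: x) 0 i
        = \prod_i y l 0 i * \prod_i (1 + s%:~R * th i).
      by rewrite -big_split; apply: eq_bigr => i _; rewrite ylx.
    have ls_neq0 : \det (krylov g (l + s *: x)) != 0.
      rewrite detK0 yls; apply: mulf_neq0; last exact: lt0r_neq0.
      by apply/prodf_neq0 => i _.
    have : (d <= `|\det (krylov g (l + s *: x))|)%N.
      apply: d_min; apply/asboolP; exists (l + s *: x) => //.
      by rewrite lt0n absz_eq0.
    rewrite -dE -(ler_nat R) !natr_absz !intr_norm.
    rewrite -(ler_pM2r (_ : 0 < `|\det E|)) ?normr_gt0 // -!normrM !detK yls.
    have : 0 < `|\det V * \prod_i y l 0 i|.
      by rewrite normr_gt0; apply: mulf_neq0 => //; apply/prodf_neq0.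
    rewrite mulrA; move: (\det V * \prod_i y l 0 i) => c c_gt0.
    by rewrite normrM (gtr0_norm pos) -{1}[`|c|]mulr1 ler_pM2l.
  have : 1 * 1 <= \prod_i (1 + (1:int)%:~R * th i) * \prod_i (1 + (-1)%:~R * th i).
    by apply: ler_pM => //; apply: d_le.
  rewrite mulr1 -big_split /= leNgt => /negP; apply.
  have [i xi] : exists i, y x 0 i != 0.
    apply: contrapT => no_i; move/eqP: x_neq0; apply.
    have yx0 : y x = 0.
      apply/rowP => i; rewrite [RHS]mxE; apply/eqP/negP => /negP yi.
      by apply: no_i; exists i.
    have := mulmxK E_unit (map_mx intr x); rewrite -/(y x) yx0 mul0mx => /esym x0.
    apply/rowP => j; have := congr1 (fun m : 'rV[R]_n.+1 => m 0 j) x0.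
    by rewrite !mxE => /eqP; rewrite intr_eq0 => /eqP.
  have fac j : (1 + (1:int)%:~R * th j) * (1 + (-1)%:~R * th j) = 1 - th j ^+ 2.
    by rewrite mulr1z mulrN1z; ring.
  have th2 j : th j ^+ 2 <= 4^-1.
    have := th_le j; rewrite -real_normK ?num_real // => h.
    have := normr_ge0 (th j); nra.
  rewrite (eq_bigr (fun j => 1 - th j ^+ 2)) => [|j _]; last exact: fac.
  have q_ge0 j : 0 <= 1 - th j ^+ 2.
    by rewrite subr_ge0; apply: le_trans (th2 j) _; lra.
  rewrite (bigD1 i) //=; apply: (@le_lt_trans _ _ (1 - th i ^+ 2)).
    apply: ler_piMr => //; apply: prodr_ile1 => j _.
    by rewrite q_ge0 gerBl sqr_ge0.
  by rewrite ltrBlDr ltrDl exprn_even_gt0 //= mulf_neq0 ?invr_eq0.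
rewrite intr_norm -(ler_pM2r (_ : 0 < `|\det E|)) ?normr_gt0 // -normrM detK normrM.
by rewrite -mulrA mulrCA mulrC [leRHS]mulrC ler_wpM2r.
Qed.

(** * Hessenberg form over the integers *)

(** The Smith form of a one-row matrix, corrected to determinant 1 by a sign in the first column. *)
Lemma row_gcd_reduction n (l : 'rV[int]_n.+1) :
  exists2 Q : 'M[int]_n.+1, \det Q = 1 & forall j, j != 0 -> (l *m Q) 0 j = 0.
Proof.
have [L _ [Q Q_unit [ds _ lE]]] := int_Smith_normal_form l.
pose s := \det (invmx Q).
have s2 : s * s = 1.
  have : (`|s| == 1)%N.
    have := congr1 (fun V => `|\det V|%N) (mulVmx Q_unit).
    by rewrite det_mulmx det1 abszM => /eqP; rewrite muln_eq1 => /andP[].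
  by move/eqP => s1; rewrite -[s * s]/(s ^+ 2) -real_normK ?num_real // -abszE s1.
exists (invmx Q *m diag_mx (\row_i (if i == 0 then s else 1))).
  rewrite det_mulmx det_diag big_ord_recl mxE eqxx big1 ?mulr1 //.
  by move=> i _; rewrite mxE.
move=> j j_neq0; rewrite mulmxA mul_mx_diag mxE {1}lE -mulmxA mulmxV // mulmx1.
rewrite mxE big_ord1 [X in _ * X * _]mxE.
have -> : (nat_of_ord (ord0 : 'I_1) == nat_of_ord j) = false.
  by apply: contraNF j_neq0 => /eqP j0; apply/eqP/val_inj.
by rewrite mulr0n mulr0 mul0r.
Qed.

Lemma lower_triangularize n (K : 'M[int]_n) :
  exists2 Q : 'M[int]_n, \det Q = 1 &
    forall i j : 'I_n, (i < j)%N -> (K *m Q) i j = 0.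
Proof.
elim: n K => [|n IHn] K; first by exists 1%:M; [rewrite det1 | case].
have [Q1 detQ1 Q1P] := row_gcd_reduction (row 0 K).
pose K1 : 'M[int]_(1 + n) := K *m Q1.
have [Q2 detQ2 Q2P] := IHn (drsubmx K1).
pose P : 'M[int]_(1 + n) := block_mx 1%:M 0 0 Q2.
exists (Q1 *m P); first by rewrite det_mulmx detQ1 (@det_ublock _ 1 n) det1 detQ2 !mulr1.
move=> i j lt_ij; rewrite mulmxA -/K1.
have -> : K1 *m P = block_mx (ulsubmx K1) 0 (dlsubmx K1) (drsubmx K1 *m Q2).
  rewrite -{1}(submxK K1) mulmx_block !mulmx0 !mulmx1 !addr0 !add0r.
  congr block_mx; rewrite (_ : ursubmx K1 = 0) ?mul0mx //.
  apply/matrixP => a b; rewrite !mxE -[RHS](Q1P (rshift 1 b)) // ?mxE.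
  by apply: eq_bigr => k _; rewrite !mxE; congr (K _ _ * _); apply: val_inj; case: a => [[]].
case: (@fintype.split_ordP 1 n j) lt_ij => [j' ->|j' -> ]; first by case: j' => [[]].
case: (@fintype.split_ordP 1 n i) => [i' ->|i' -> lt_ij].
  by rewrite (@block_mxEur _ 1 n 1 n) mxE.
by rewrite (@block_mxEdr _ 1 n 1 n); apply: Q2P.
Qed.

Definition lower_hessenberg n (B : 'M[int]_n.+1) :=
  forall i j : 'I_n.+1, (i.+1 < j)%N -> B i j = 0.

(** The entry just above the diagonal in column j, with the convention 1 for the
    first column, so that products may run over all columns. *)
Definition superdiag n (B : 'M[int]_n.+1) (j : 'I_n.+1) : int :=
  if (j : nat) is j'.+1 then B (inord j') j else 1.

(** If T = K Q is lower triangular, K being the Krylov matrix, then the rows of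
    T B are the next rows of T.  Comparing supports shows that B = Q^-1 g Q is lower
    Hessenberg and that T_(k+1,k+1) = T_kk r_(k+1), whence the product formula for
    det T = det K. *)
Lemma hessenberg_reduction n (g : 'M[int]_n.+1) (l : 'rV[int]_n.+1) :
  \det (krylov g l) != 0 ->
  exists Q B : 'M[int]_n.+1, [/\ \det Q = 1, g *m Q = Q *m B,
    lower_hessenberg B, forall j, superdiag B j != 0 &
    (\prod_(i < n.+1) \prod_(j < n.+1 | j <= i) `|superdiag B j|
       <= `|\det (krylov g l)|)%N].
Proof.
move=> detK_neq0; have [Q detQ QP] := lower_triangularize (krylov g l).
have Q_unit : Q \in unitmx by rewrite unitmxE detQ unitr1.
set T := krylov g l *m Q in QP; pose B := invmx Q *m g *m Q.
have detT : \det T = \det (krylov g l) by rewrite det_mulmx detQ mulr1.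
have prodT : \det (krylov g l) = \prod_k T k k.
  by rewrite -detT det_trig //; apply/is_trig_mxP => i j; apply: QP.
have Tkk k : T k k != 0.
  by move: detK_neq0; rewrite prodT => /prodf_neq0; apply.
have gQ : g *m Q = Q *m B by rewrite /B !mulmxA mulmxV // mul1mx.
have TB (k k' : 'I_n.+1) j : k' = k.+1 :> nat -> (T *m B) k j = T k' j.
  move=> kk'; suff: row k (T *m B) = row k' T.
    by move/(congr1 (fun m : 'rV_n.+1 => m 0 j)); rewrite !mxE.
  rewrite /T !row_mul !row_krylov -!mulmxA -gQ kk' exprSr -mulmxE.
  by rewrite -!mulmxA.
have TBd (k : 'I_n.+1) j : (forall i : 'I_n.+1, (i < k)%N -> B i j = 0) ->
    (T *m B) k j = T k k * B k j.
  move=> B0; rewrite mxE (bigD1 k) //= big1 ?addr0 // => i neq_ik.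
  have [lt_ik|le_ki] := ltnP i k; first by rewrite B0 ?mulr0.
  by rewrite QP ?mul0r // ltn_neqAle eq_sym neq_ik.
have hessB : lower_hessenberg B.
  move=> i; have [k] := ubnP (i : nat); elim: k i => // k IHk i; rewrite ltnS => le_ik j lt_ij.
  have lt_i : (i.+1 < n.+1)%N by apply: ltn_trans lt_ij _.
  have := TB i (Ordinal lt_i) j erefl; rewrite TBd => [|i' lt_i'].
    by rewrite (QP (Ordinal lt_i) j lt_ij) => /eqP; rewrite mulf_eq0 (negPf (Tkk i)) /= => /eqP.
  by apply: IHk; [apply: leq_trans lt_i' le_ik | apply: leq_ltn_trans lt_ij; apply: ltnW].
have step (k k' : 'I_n.+1) : k' = k.+1 :> nat -> T k k * superdiag B k' = T k' k'.
  move=> kk'; rewrite -(TB k k' k' kk') TBd => [|i lt_ik]; last first.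
    by apply: hessB; rewrite kk' ltnS.
  rewrite /superdiag kk'; congr (_ * B _ _); by apply: val_inj; rewrite /= inordK.
have supP (k : nat) (hk : (k < n.+1)%N) : T (Ordinal hk) (Ordinal hk) =
    T 0 0 * \prod_(j < n.+1 | (j <= k)%N) superdiag B j.
  elim: k hk => [|k IHk] hk.
    rewrite (bigD1 0) //= big1 => [|j /andP[j0 /negP[]]]; last first.
      by apply/eqP/val_inj => /=; apply/eqP; rewrite -leqn0.
    by rewrite /superdiag /= !mulr1; congr (T _ _); apply: val_inj.
  rewrite -(step (Ordinal (ltnW hk)) (Ordinal hk) erefl) IHk -mulrA; congr (_ * _).
  rewrite [RHS](bigD1 (Ordinal hk)) //= mulrC; congr (_ * _).
  by apply: eq_bigl => j; rewrite -ltnS ltn_neqAle andbC -val_eqE.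
exists Q, B; split => // [j|].
  case: j => -[|j] hj; first by [].
  have := Tkk (Ordinal hj).
  rewrite -(step (Ordinal (ltnW hj)) (Ordinal hj) erefl) mulf_eq0.
  by case/norP.
rewrite prodT (big_morph absz abszM (erefl : `|1|%N = 1%N)).
apply: leq_prod => -[k hk] _; rewrite supP abszM.
rewrite (big_morph absz abszM (erefl : `|1|%N = 1%N)) leq_pmull //.
by rewrite lt0n absz_eq0.
Qed.

(** * Normalizing the columns of a Hessenberg matrix *)

Definition horner_entry n (f : {poly int}) (A : 'M[int]_n.+1) j : int :=
  \sum_(k < size f) f`_k * (A ^+ k) j j.

(** The trailing block from index j on, padded with zeros to keep the ambient
    dimension. *)
Definition trailing n (B : 'M[int]_n.+1) (j : 'I_n.+1) : 'M[int]_n.+1 :=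
  \matrix_(i, l) (if (j <= i)%N && (j <= l)%N then B i l else 0).

Lemma size_polyM_le (p q : {poly int}) a b c :
  (size p <= a)%N -> (size q <= b)%N -> (a + b <= c.+1)%N ->
  (size (p * q)%R <= c)%N.
Proof.
move=> pa qb abc; apply: leq_trans (size_polyMleq _ _) _.
rewrite -subn1 leq_subLR add1n; exact: leq_trans (leq_add pa qb) abc.
Qed.

Section DiagonalShift.
Variables (n : nat) (A : 'M[int]_n.+1) (j : 'I_n.+1) (r : int).

Let Ap : 'M[{poly int}]_n.+1 :=
  map_mx polyC A + (r *: 'X) *: delta_mx j j.

Let Ap_entry i l : l != j -> Ap i l = (A i l)%:P.
Proof. by move=> lj; rewrite !mxE (negPf lj) andbF mulr0 addr0. Qed.

Let size_Ap_pow k :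
  [/\ (size ((Ap ^+ k) j j) <= k.+1)%N, ((Ap ^+ k) j j)`_k = r ^+ k
    & forall l, l != j -> (size ((Ap ^+ k) j l) <= k)%N].
Proof.
elim: k => [|k [IH1 IH2 IH3]].
  by rewrite expr0 !mxE eqxx size_poly1 coef1; split => // l lj; rewrite mxE eq_sym (negPf lj) size_poly0.
have off i : i != j -> (size ((Ap ^+ k) j i * Ap i j)%R <= k.+1)%N.
  move=> ij; rewrite !mxE (negPf ij) mulr0 addr0.
  apply: size_polyM_le (IH3 i ij) (size_polyC_leq1 _) _.
  by rewrite addn1 leqW.
have rec : (Ap ^+ k.+1) j j = (Ap ^+ k) j j * ((A j j)%:P + r *: 'X)
    + \sum_(i | i != j) (Ap ^+ k) j i * Ap i j.
  by rewrite exprSr mxE (bigD1 j) //= !mxE !eqxx mulr1.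
split.
- rewrite rec; apply: leq_trans (size_polyD _ _) _; rewrite geq_max; apply/andP; split.
    have X_le : (size ((A j j)%:P + r *: 'X)%R <= 2)%N.
      apply: leq_trans (size_polyD _ _) _; rewrite geq_max; apply/andP; split.
        exact: leq_trans (size_polyC_leq1 _) _.
      by apply: leq_trans (size_scale_leq _ _) _; rewrite size_polyX.
    by apply: size_polyM_le IH1 X_le _; rewrite addn2.
  by apply: leq_trans (size_sum _ _ _) _; apply/bigmax_leqP => i ij; apply: leqW; apply: off.
- rewrite rec coefD mulrDr coefD coefMC nth_default // mul0r add0r -scalerAr coefZ coefMX /= IH2.
  by rewrite -exprS coef_sum big1 ?addr0 // => i ij; rewrite nth_default // off.
- move=> l lj; rewrite exprSr mxE; apply: leq_trans (size_sum _ _ _) _.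
  apply/bigmax_leqP => i _; rewrite Ap_entry //.
  apply: size_polyM_le (_ : _ <= k.+1)%N (size_polyC_leq1 _) _; last by rewrite addn1.
  by have [->|ij] := eqVneq i j; last by apply: leqW; apply: IH3.
Qed.

(** As a polynomial in X, the entry (j, j) of (A + r X E_jj)^k has degree k and
    leading coefficient r^k, while the other entries of row j have smaller degree.
    Hence the entry of f(A + r X E_jj) is a nonzero polynomial of degree at most
    deg f, and one of deg f + 1 consecutive integers is not a root. *)
Lemma horner_entry_shift (f : {poly int}) : f != 0 -> r != 0 ->
  exists2 m : nat, (m < size f)%N &
    horner_entry f (A + (m%:Z * r) *: delta_mx j j) j != 0.
Proof.
move=> f_neq0 r_neq0; pose q := \sum_(k < size f) f`_k *: (Ap ^+ k) j j.
have f_size : (0 < size f)%N by rewrite size_poly_gt0.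
have q_neq0 : q != 0.
  apply: contraTneq f_neq0 => q0; have := congr1 (fun p : {poly int} => p`_(size f).-1) q0.
  have lt_last : ((size f).-1 < size f)%N by rewrite prednK.
  rewrite coef0 coef_sum (bigD1 (Ordinal lt_last)) //= big1 ?addr0 => [|k neq_k].
    have [_ coefk _] := size_Ap_pow (size f).-1.
    rewrite coefZ coefk => /eqP; rewrite mulf_eq0 expf_eq0 (negPf r_neq0) andbF orbF.
    by rewrite -lead_coefE lead_coef_eq0 negbK.
  have k_lt : (k.+1 <= (size f).-1)%N.
    by rewrite ltn_neqAle -ltnS prednK // ltn_ord andbT; move: neq_k; rewrite -val_eqE.
  have [sz _ _] := size_Ap_pow k.
  by rewrite coefZ (nth_default 0 (leq_trans sz k_lt)) mulr0.
have q_size : (size q <= size f)%N.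
  apply: leq_trans (size_sum _ _ _) _; apply/bigmax_leqP => k _.
  apply: leq_trans (size_scale_leq _ _) _; have [sz _ _] := size_Ap_pow k.
  by apply: leq_trans sz _; apply: ltn_ord.
have qE m : q.[m%:Z] = horner_entry f (A + (m%:Z * r) *: delta_mx j j) j.
  rewrite horner_sum; apply: eq_bigr => k _; rewrite hornerZ; congr (_ * _).
  have -> : A + (m%:Z * r) *: delta_mx j j = map_mx (horner_eval m%:Z) Ap.
    apply/matrixP => a b; rewrite !mxE /= /horner_eval hornerD hornerC; congr (_ + _).
    by rewrite -polyC_natr hornerM hornerZ hornerX hornerC [r * _]mulrC.
  by rewrite -rmorphXn /= mxE.
have /allPn[_ /mapP[m m_lt ->] qm] :
    ~~ all (root q) [seq m%:Z | m <- iota 0 (size f)].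
  apply/negP => /(max_poly_roots q_neq0).
  rewrite map_inj_uniq ?iota_uniq => [|a b []//]; move/(_ isT).
  by rewrite size_map size_iota ltnNge q_size.
exists m; first by move: m_lt; rewrite mem_iota.
by rewrite -qE -rootE.
Qed.

End DiagonalShift.

Section Normalization.
Variable n : nat.
Implicit Types (B : 'M[int]_n.+1) (i j l p : 'I_n.+1).

(** Conjugation by 1 + u e_p, where u is supported at and below j = p + 1.  Besides
    column p it changes B only by subtracting u_i times row p from row i.  Row p of a
    lower Hessenberg matrix ends with the superdiagonal entry in column j, so that the
    columns after j stay fixed. *)
Lemma column_step B p j (u : 'cV[int]_n.+1) : j = p.+1 :> nat ->
  (forall i, (i < j)%N -> u i 0 = 0) -> lower_hessenberg B ->
  exists P B', [/\ \det P = 1, B *m P = P *m B', lower_hessenberg B',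
    forall j', superdiag B' j' = superdiag B j' &
    forall i l, (j <= l)%N -> B' i l = B i l - u i 0 * B p l].
Proof.
move=> jp u0 hessB; pose E := u *m delta_mx 0 p : 'M[int]_n.+1.
have Eij i l : E i l = u i 0 * (l == p)%:R by rewrite mxE big_ord1 [X in _ * X]mxE eqxx.
have EE : E *m E = 0.
  rewrite /E -!mulmxA (mulmxA (delta_mx 0 p)) (_ : delta_mx 0 p *m u = 0) ?mul0mx ?mulmx0 //.
  by rewrite -rowE; apply/matrixP => a b; rewrite !mxE !ord1 u0 // jp.
pose B' := (1%:M - E) *m B *m (1%:M + E).
have invP : (1%:M + E) *m (1%:M - E) = 1%:M.
  by rewrite mulmxDl !mulmxBr !mul1mx !mulmx1 EE subr0 subrK.
have B'E i l : B' i l = B i l - u i 0 * B p l + (B *m E - E *m B *m E) i l.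
  have -> : B' = B - E *m B + (B *m E - E *m B *m E).
    by rewrite /B' mulmxBl mul1mx mulmxDr mulmx1 mulmxBl.
  have EB : (E *m B) i l = u i 0 * B p l by rewrite /E -mulmxA -rowE mxE big_ord1 mxE.
  by rewrite [LHS]mxE -EB; congr (_ + _); rewrite [LHS]mxE; congr (_ + _); rewrite [LHS]mxE.
have col_p i l : l != p -> (B *m E - E *m B *m E) i l = 0.
  move=> lp; rewrite /E !mulmxA -mulmxBl mxE big_ord1 [X in _ * X]mxE eqxx (negPf lp).
  by rewrite mulr0.
have row_small i : (i < j)%N -> (B *m E - E *m B *m E) i p = (B *m u) i 0.
  move=> lt_ij; rewrite /E !mulmxA -mulmxBl mxE big_ord1 [X in _ * X]mxE !eqxx mulr1.
  have uX : (u *m (delta_mx 0 p *m (B *m u))) i 0 = 0 by rewrite mxE big_ord1 u0 ?mul0r.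
  by rewrite -!mulmxA mxE [X in _ + X]mxE uX subr0.
have Bu0 i : (i.+1 < j)%N -> (B *m u) i 0 = 0.
  move=> lt_ij; rewrite mxE big1 // => k _; have [lt_kj|le_jk] := ltnP k j.
    by rewrite u0 ?mulr0.
  by rewrite hessB ?mul0r //; apply: leq_trans le_jk.
have B'small i l : (i.+1 < j)%N -> B' i l = B i l.
  move=> lt_ij; rewrite B'E u0 ?mul0r ?subr0 1?ltnW //.
  have [->|lp] := eqVneq l p; last by rewrite col_p ?addr0.
  by rewrite row_small ?Bu0 ?addr0 // ltnW.
have B'big i l : l != p -> B' i l = B i l - u i 0 * B p l.
  by move=> lp; rewrite B'E col_p // addr0.
exists (1%:M + E), B'; split.
- have trigP : is_trig_mx (1%:M + E).
    apply/is_trig_mxP => i l lt_il; rewrite !mxE -/E; move: (Eij i l); rewrite mxE => ->.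
    rewrite (_ : i == l = false) ?add0r; last by apply/negP => /eqP il; rewrite il ltnn in lt_il.
    case: eqP => [lp|]; last by rewrite mulr0.
    by rewrite u0 ?mul0r // jp ltnW // -lp.
  rewrite det_trig // big1 // => i _; rewrite mxE Eij mxE eqxx.
  by case: eqP => [->|]; rewrite ?mulr0 ?addr0 // u0 ?mul0r ?addr0 // jp.
- by rewrite /B' !mulmxA invP mul1mx.
- move=> i l lt_il; have [lt_ij|le_ji] := ltnP i.+1 j; first by rewrite B'small ?hessB.
  have lp : l != p.
    by apply: contraTneq lt_il => ->; rewrite -leqNgt; apply: leq_trans le_ji; rewrite jp.
  rewrite B'big // (hessB i l lt_il) sub0r.
  have [lt_ij|le_ji'] := ltnP i j; first by rewrite u0 ?mul0r ?oppr0.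
  rewrite (hessB p l) ?mulr0 ?oppr0 // -jp.
  by apply: leq_ltn_trans le_ji' _; apply: ltnW.
- move=> j'; rewrite /superdiag; case qE: (nat_of_ord j') => [|q] //.
  have lt_q : (q < n.+1)%N by rewrite -qE ltnW.
  have iq : nat_of_ord (inord q : 'I_n.+1) = q by rewrite inordK.
  have [lt_qj|le_jq] := ltnP q.+1 j; first by rewrite B'small ?iq.
  rewrite B'big; last by apply: contraTneq le_jq => j'p; rewrite -ltnNge -qE j'p jp.
  have [q_j|ne_qj] := eqVneq (q : nat) p; first by rewrite u0 ?mul0r ?subr0 // iq q_j jp.
  by rewrite (hessB p) ?mulr0 ?subr0 // qE; move: ne_qj; rewrite jp in le_jq; lia.
- move=> i l le_jl; apply: B'big; apply: contraTneq le_jl => ->.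
  by rewrite jp ltnn.
Qed.

(** The first condition makes column j range over a box of volume comparable to
    a power of its superdiagonal entry; the second one is what allows that entry to be
    recovered, up to the choice of a divisor. *)
Definition normalized_column (f : {poly int}) B j :=
  (forall i, (j <= i)%N -> 0 <= B i j < (size f)%:Z * `|superdiag B j|) /\
  horner_entry f (trailing B j) j != 0.

Lemma superdiagE B p j : j = p.+1 :> nat -> superdiag B j = B p j.
Proof.
move=> jp; rewrite /superdiag jp; congr (B _ j).
by apply: val_inj; rewrite /= inordK.
Qed.

(** Reduce the entries modulo r and then add to the diagonal one of the multiples
    0, |r|, ..., (deg f) |r| for which the entry of f(A) does not vanish. *)
Lemma normalize_column (f : {poly int}) B p j : f != 0 -> j = p.+1 :> nat ->
  lower_hessenberg B -> superdiag B j != 0 ->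
  exists P B', [/\ \det P = 1, B *m P = P *m B', lower_hessenberg B',
    forall j', superdiag B' j' = superdiag B j' &
    normalized_column f B' j /\
    forall i l, (j < l)%N -> B' i l = B i l].
Proof.
move=> f_neq0 jp hessB r_neq0; set r := superdiag B j in r_neq0.
have rE : B p j = r by rewrite /r (superdiagE _ jp).
have Bp0 l : (j < l)%N -> B p l = 0 by move=> lt_jl; rewrite hessB // -jp.
pose u0 i := if (i < j)%N then 0 else (B i j %/ r)%Z.
(* The trailing block after reduction modulo r, before the diagonal correction. *)
pose A0 : 'M[int]_n.+1 := \matrix_(i, l)
  (if (j <= i)%N && (j <= l)%N then B i l - u0 i * B p l else 0).
have normr_neq0 : `|r| != 0 by rewrite normr_eq0.
have [m m_lt hm] := horner_entry_shift A0 j f_neq0 normr_neq0.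
pose u : 'cV[int]_n.+1 := \col_i (u0 i - (i == j)%:R * (m%:Z * Num.sg r)).
have u_small i : (i < j)%N -> u i 0 = 0.
  move=> lt_ij; rewrite mxE /u0 lt_ij (_ : i == j = false) ?mul0r ?subr0 //.
  by apply: contraTF lt_ij => /eqP ->; rewrite ltnn.
have [P [B' [detP BP hessB' supB' B'E]]] := column_step jp u_small hessB.
have B'j i : (j <= i)%N -> B' i j = (B i j %% r)%Z + (i == j)%:R * (m%:Z * `|r|).
  move=> le_ji; rewrite B'E // rE mxE /u0 ltnNge le_ji /= /modz.
  by rewrite [in RHS]normrEsg; ring.
exists P, B'; split => //; split; last first.
  by move=> i l lt_jl; rewrite B'E 1?ltnW // Bp0 // mulr0 subr0.
split=> [i le_ji|].
  rewrite supB' -/r B'j //; have := modz_ge0 (B i j) r_neq0.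
  have := ltz_mod (B i j) r_neq0; move: (B i j %% r)%Z => a a_lt a_ge.
  have f1 : 1 <= (size f)%:Z by rewrite lez_nat size_poly_gt0.
  have m1 : m%:Z + 1 <= (size f)%:Z by rewrite -addn1 in m_lt; move: m_lt; lia.
  have r_ge := normr_ge0 r.
  by move: `|r| a_lt r_ge (size f)%:Z f1 m1 => R a_lt R_ge s f1 m1; case: (i == j) => /=; nia.
rewrite (_ : trailing B' j = A0 + (m%:Z * `|r|) *: delta_mx j j) //.
apply/matrixP => i l; rewrite !mxE; case: ifP => [/andP[ji jl]|nij]; last first.
  case: (i =P j) => [ij|]; last by rewrite /= mulr0 addr0.
  case: (l =P j) => [lj|]; last by rewrite /= mulr0 addr0.
  by rewrite ij lj leqnn in nij.
have [->|neq_lj] := eqVneq l j.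
  rewrite B'j // rE /u0 ltnNge ji /= andbT /modz; ring.
rewrite B'E // Bp0 ?mulr0 ?subr0 ?andbF ?mulr0 ?addr0 //.
by rewrite ltn_neqAle eq_sym neq_lj.
Qed.

(** Columns are treated from the last to the second one: a step at column j does
    not disturb the later ones. *)
Lemma normal_form (f : {poly int}) B : f != 0 ->
  lower_hessenberg B -> (forall j, superdiag B j != 0) ->
  exists P B', [/\ \det P = 1, B *m P = P *m B', lower_hessenberg B',
    forall j, superdiag B' j = superdiag B j &
    forall j, (0 < j)%N -> normalized_column f B' j].
Proof.
move=> f_neq0 hessB supB.
suff H m : (m <= n)%N -> exists P B', [/\ \det P = 1, B *m P = P *m B',
    lower_hessenberg B', forall j, superdiag B' j = superdiag B j &
    forall j, (n < j + m)%N -> normalized_column f B' j].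
  have [P [B' [detP BP hB' sB' cB']]] := H n (leqnn n).
  by exists P, B'; split => // j j_gt0; apply: cB'; rewrite -{1}[n]add0n ltn_add2r.
elim: m => [|m IHm] le_mn.
  exists 1%:M, B; split => //; rewrite ?det1 ?mulmx1 ?mul1mx // => j.
  by rewrite addn0 ltnNge -ltnS ltn_ord.
have [P [B' [detP BP hB' sB' cB']]] := IHm (ltnW le_mn).
have lt_j : (n - m < n.+1)%N by rewrite ltnS leq_subr.
have lt_p : (n - m.+1 < n.+1)%N by rewrite ltnS leq_subr.
pose j : 'I_n.+1 := Ordinal lt_j; pose p : 'I_n.+1 := Ordinal lt_p.
have jp : j = p.+1 :> nat by rewrite /= subnSK.
have r_neq0 : superdiag B' j != 0 by rewrite sB'.
have [P2 [B2 [detP2 BP2 hB2 sB2 [cj B2E]]]] := normalize_column f_neq0 jp hB' r_neq0.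
exists (P *m P2), B2; split => //.
- by rewrite det_mulmx detP detP2 mulr1.
- by rewrite mulmxA BP -(mulmxA P B' P2) BP2 mulmxA.
- by move=> j'; rewrite sB2 sB'.
move=> j'; rewrite addnS ltnS leq_eqVlt => /orP[/eqP j'E|lt_j'].
  by rewrite (_ : j' = j) //; apply: val_inj => /=; move: (nat_of_ord j') j'E => k kE; rewrite kE addnK.
have [cj1 cj2] := cB' j' lt_j'; have lt_jj' : (j < j')%N.
  by rewrite /= -(ltn_add2r m) subnK // ltnW.
split; first by move=> i le_i; rewrite sB2 B2E // -?sB'; apply: cj1.
rewrite (_ : trailing B2 j' = trailing B' j') //; apply/matrixP => i l; rewrite !mxE.
by case: ifP => // /andP[_ le_l]; rewrite B2E //; apply: leq_trans lt_jj' le_l.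
Qed.

End Normalization.

(** * A Hessenberg matrix is determined by few entries *)

Lemma horner_mx_sum (R : comNzRingType) n (A : 'M[R]_n.+1) (f : {poly R}) :
  horner_mx A f = \sum_(k < size f) f`_k *: A ^+ k.
Proof.
rewrite -{1}[f]coefK poly_def rmorph_sum; apply: eq_bigr => k _ /=.
by rewrite horner_mxZ rmorphXn /= horner_mx_X.
Qed.

(** Modulo r, the superdiagonal entry of column j, the coordinates before j span
    an invariant subspace, so that powers of B and of its trailing block agree at
    indices >= j; and f(B) = 0. *)
Lemma superdiag_dvd n (f : {poly int}) (B : 'M[int]_n.+1) (j : 'I_n.+1) :
  lower_hessenberg B -> horner_mx B f = 0 -> (0 < j)%N ->
  (superdiag B j %| horner_entry f (trailing B j) j)%Z.
Proof.
move=> hessB fB j_gt0; set A := trailing B j.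
have lt_p : (j.-1 < n.+1)%N by rewrite (leq_ltn_trans (leq_pred _)).
have jp : j = (Ordinal lt_p).+1 :> nat by rewrite /= prednK.
set r := superdiag B j; have rE : B (Ordinal lt_p) j = r by rewrite /r (superdiagE _ jp).
have pow k : forall i l : 'I_n.+1, (j <= i)%N -> (j <= l)%N ->
    (r %| (B ^+ k) i l - (A ^+ k) i l)%Z.
  elim: k => [|k IHk] i l le_i le_l; first by rewrite !expr0 subrr dvdz0.
  rewrite !exprSr !mxE -sumrB; apply: (big_ind (fun x => (r %| x)%Z)).
  - exact: dvdz0.
  - by move=> x y; apply: rpredD.
  move=> m _; have [lt_mj|le_jm] := ltnP m j.
    rewrite [A m l]mxE (leqNgt j m) lt_mj /= mulr0 subr0.
    have [lt_ml|le_lm] := ltnP m.+1 l; first by rewrite hessB // mulr0 dvdz0.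
    have lj : l = j by apply: val_inj => /=; lia.
    have mp : m = Ordinal lt_p by apply: val_inj => /=; move: le_lm; rewrite lj; lia.
    by rewrite mp lj rE dvdz_mull.
  by rewrite [A m l]mxE le_jm le_l -mulrBl dvdz_mulr // IHk.
have := congr1 (fun M : 'M[int]_n.+1 => M j j) fB; rewrite horner_mx_sum.
rewrite summxE [RHS]mxE => fBjj.
rewrite -[X in (_ %| X)%Z]subr0 -fBjj -rpredN opprB -sumrB.
apply: (big_ind (fun x => (r %| x)%Z)) => [|x y|k _]; first exact: dvdz0.
  exact: rpredD.
by rewrite mxE -mulrBr dvdz_mull // pow.
Qed.

(** Column j of the eigenvector equation expresses the coordinate j - 1 in terms
    of the later ones, so that a left eigenvector is determined by its last coordinate
    and by the columns of B other than the first. *)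
Lemma hess_left_eigenvector0 (F : numFieldType) n (B : 'M[int]_n.+1) (mu : F)
    (z : 'rV[F]_n.+1) : lower_hessenberg B -> (forall j, superdiag B j != 0) ->
  (forall j : 'I_n.+1, (0 < j)%N -> (z *m map_mx intr B) 0 j = mu * z 0 j) ->
  z 0 ord_max = 0 -> z = 0.
Proof.
move=> hessB supB zB zn.
suff H m (k : 'I_n.+1) : (n <= k + m)%N -> z 0 k = 0.
  by apply/rowP => k; rewrite (H n) ?mxE // leq_addl.
elim: m k => [|m IHm] k le_n.
  rewrite -zn; congr (z 0 _); apply: val_inj => /=; have := ltn_ord k; lia.
have [le_n'|lt_n] := leqP n (k + m); first exact: IHm.
have lt_j : (k.+1 < n.+1)%N by lia.
have := zB (Ordinal lt_j) isT; rewrite IHm ?mulr0 /=; last by lia.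
rewrite mxE (bigD1 k) //= big1 ?addr0 => [/eqP|i neq_ik].
  rewrite mulf_eq0 mxE intr_eq0 -(superdiagE B (p := k) (j := Ordinal lt_j)) //.
  by rewrite (negPf (supB _)) orbF => /eqP.
have [lt_ik|le_ki] := ltnP i k; first by rewrite mxE hessB ?mulr0.
have lt_ki : (k < i)%N by rewrite ltn_neqAle eq_sym val_eqE neq_ik.
by rewrite IHm ?mul0r //; lia.
Qed.

(** By the preceding recursion B and B' have the same left eigenvectors; these
    form a basis because the eigenvalues are distinct. *)
Lemma hess_determined (F : numFieldType) n (B B' : 'M[int]_n.+1)
    (mu : 'I_n.+1 -> F) : injective mu ->
  lower_hessenberg B -> (forall j, superdiag B j != 0) ->
  (forall i j : 'I_n.+1, (0 < j)%N -> B' i j = B i j) ->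
  char_poly (map_mx intr B) = \prod_i ('X - (mu i)%:P) ->
  char_poly (map_mx intr B') = \prod_i ('X - (mu i)%:P) -> B' = B.
Proof.
move=> mu_inj hessB supB eqB chB chB'; pose toF (M : 'M[int]_n.+1) : 'M[F]_n.+1 := map_mx intr M.
have [Y Y_unit YB] := left_eigenbasis mu_inj chB.
have [Z Z_unit ZB] := left_eigenbasis mu_inj chB'.
rewrite -/(toF B) in YB; rewrite -/(toF B') in ZB.
have colB (x : 'rV[F]_n.+1) (j : 'I_n.+1) : (0 < j)%N ->
    (x *m toF B') 0 j = (x *m toF B) 0 j.
  by move=> j_gt0; rewrite !mxE; apply: eq_bigr => i _; rewrite !mxE eqB.
have rowE (X : 'M[F]_n.+1) C i : X *m C = diag_mx (\row_i mu i) *m X ->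
    row i X *m C = mu i *: row i X.
  by move=> XC; rewrite -row_mul XC; apply/rowP => j; rewrite mxE mul_diag_mx !mxE.
have row_neq0 (X : 'M[F]_n.+1) i : X \in unitmx -> row i X != 0.
  move=> X_unit; apply: contraTneq X_unit => X0; rewrite -row_free_unit.
  apply/negP => /row_freeP[V XV]; have := congr1 (fun M : 'M[F]_n.+1 => row i M) XV.
  rewrite row_mul X0 mul0mx => /(congr1 (fun M : 'rV[F]_n.+1 => M 0 i)).
  by rewrite !mxE eqxx => /esym/eqP; rewrite oner_eq0.
have YB' : Y *m toF B' = diag_mx (\row_i mu i) *m Y.
  apply/row_matrixP => i; rewrite row_mul.
  set y := row i Y; set z := row i Z.
  have yB : y *m toF B = mu i *: y by apply: rowE.
  have zB : z *m toF B' = mu i *: z by apply: rowE.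
  have zBj (j : 'I_n.+1) : (0 < j)%N -> (z *m toF B) 0 j = mu i * z 0 j.
    by move=> j_gt0; rewrite -colB // zB mxE.
  have z_neq0 : z 0 ord_max != 0.
    apply: contra_neq (row_neq0 _ i Z_unit) => z0.
    exact: hess_left_eigenvector0 hessB supB zBj z0.
  have yz : z 0 ord_max *: y - y 0 ord_max *: z = 0.
    apply: (hess_left_eigenvector0 (mu := mu i)) hessB supB _ _ => [j j_gt0|].
      rewrite mulmxBl -!scalemxAl yB mxE [X in _ + X]mxE [X in _ - X]mxE zBj //.
      by rewrite !mxE; ring.
    by rewrite !mxE; ring.
  have yE : y = (z 0 ord_max)^-1 *: (y 0 ord_max *: z).
    by move/eqP: yz; rewrite subr_eq0 => /eqP <-; rewrite scalerA mulVf ?scale1r.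
  rewrite {1}yE -!scalemxAl zB; apply/rowP => j.
  have yj := congr1 (fun M : 'rV_n.+1 => M 0 j) yE; rewrite /= !mxE in yj.
  by rewrite [RHS]mxE mul_diag_mx !mxE yj; ring.
have /(can_inj (mulKmx Y_unit)) toFB : Y *m toF B' = Y *m toF B by rewrite YB' YB.
apply/matrixP => i j; have := congr1 (fun M : 'M[F]_n.+1 => M i j) toFB.
by rewrite !mxE => /intr_inj.
Qed.

(** * Counting normalized Hessenberg matrices *)

Lemma norm_expmx_le n (A : 'M[int]_n.+1) (W : int) :
  1 <= W -> (forall i j, `|A i j| <= W) ->
  forall k i j, `|(A ^+ k) i j| <= (n.+1%:Z * W) ^+ k.
Proof.
move=> W_ge1 A_le; have W_ge0 : 0 <= W by lia.
elim=> [|k IHk] i j; first by rewrite !expr0 mxE; case: (_ == _).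
rewrite exprSr mxE; apply: le_trans (ler_norm_sum _ _ _) _.
apply: le_trans (_ : \sum_(l < n.+1) (n.+1%:Z * W) ^+ k * W <= _).
  by apply: ler_sum => l _; rewrite normrM ler_pM.
by rewrite sumr_const card_ord exprSr -mulr_natl natz mulrCA.
Qed.

Definition max_divisors M := \max_(N < M.+1) size (divisors N).

Lemma max_divisors_bound k : exists C, forall M, (0 < M)%N ->
  (max_divisors M ^ k <= C * M)%N.
Proof.
have [C CP] := divisor_bound k; exists C.+1 => M M_gt0; rewrite /max_divisors.
case: (posnP k) => [->|k_gt0]; first by rewrite expn0 muln_gt0 M_gt0.
apply: (big_ind (fun x => (x ^ k <= C.+1 * M)%N)) => [|x y hx hy|N _].
- by rewrite exp0n.
- by rewrite /maxn; case: ifP.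
have [->|N_gt0] := posnP N.
  by rewrite (_ : size (divisors 0) = 1%N) // exp1n muln_gt0 M_gt0.
apply: leq_trans (CP N N_gt0) _; apply: leq_mul => //.
by rewrite -ltnS.
Qed.

Section NormalHessenberg.
Variables (n : nat) (f : {poly int}) (D : nat).
Implicit Type B : 'M[int]_n.+1.

(** In the last condition the entry r_j is counted once for every row i >= j, that
    is once for each entry of column j that is reduced modulo r_j. *)
Definition normal_hessenberg B :=
  [/\ lower_hessenberg B, forall j, superdiag B j != 0,
      forall j : 'I_n.+1, (0 < j)%N -> normalized_column f B j &
      (\prod_(i < n.+1) \prod_(j < n.+1 | j <= i) `|superdiag B j| <= D)%N].

Lemma superdiag_le B j : normal_hessenberg B -> (`|superdiag B j| <= D)%N.
Proof.
case=> _ sup_neq0 _; apply: leq_trans.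
have gt0 l : (0 < `|superdiag B l|)%N by rewrite lt0n absz_eq0.
rewrite (bigD1 j) //= (bigD1 j) //= -mulnA leq_pmulr // muln_gt0.
by rewrite !prodn_gt0 // => i; rewrite prodn_gt0.
Qed.

Lemma entry_lt B (i j : 'I_n.+1) : normal_hessenberg B -> (0 < j)%N -> (j <= i)%N ->
  0 <= B i j < (size f * `|superdiag B j|)%N%:Z.
Proof.
case=> _ _ normB _ j_gt0 le_ji; have [/(_ i le_ji)] := normB j j_gt0.
by rewrite PoszM abszE.
Qed.

Definition height_bound (s H : nat) : nat := s * (H * (n.+1 * (s * D)) ^ s).

Lemma horner_entry_le B (H : nat) (j : 'I_n.+1) : f != 0 -> normal_hessenberg B ->
  (forall k, `|f`_k| <= H%:Z) -> (0 < j)%N ->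
  (`|horner_entry f (trailing B j) j| <= height_bound (size f) H)%N.
Proof.
move=> f_neq0 normB f_le j_gt0; set W := (size f * D)%N.
have [hessB sup_neq0 _ _] := normB.
have s_gt0 : (0 < size f)%N by rewrite size_poly_gt0.
have D_gt0 : (0 < D)%N.
  by apply: leq_trans (superdiag_le ord0 normB); rewrite lt0n absz_eq0.
have W_gt0 : (0 < W)%N by rewrite muln_gt0 s_gt0.
have A_le i l : `|trailing B j i l| <= W%:Z.
  rewrite mxE; case: ifP => [/andP[le_i le_l]|_]; last by rewrite normr0.
  have l_gt0 : (0 < l)%N by apply: leq_trans le_l.
  have [le_li|lt_il] := leqP l i.
    have /andP[B_ge0 B_lt] := entry_lt normB l_gt0 le_li.
    rewrite ger0_norm //; apply: le_trans (ltW B_lt) _.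
    by rewrite lez_nat leq_mul2l superdiag_le ?orbT.
  have [lt_il'|le_li] := ltnP i.+1 l; first by rewrite hessB // normr0.
  have li : l = i.+1 :> nat by apply/eqP; rewrite eqn_leq le_li lt_il.
  rewrite -(superdiagE _ li) -abszE lez_nat.
  by apply: leq_trans (superdiag_le l normB) _; rewrite leq_pmull.
have pow := norm_expmx_le (_ : 1 <= W%:Z) A_le.
rewrite -lez_nat abszE; apply: le_trans (ler_norm_sum _ _ _) _.
apply: le_trans (_ : \sum_(k < size f)
    (H * (n.+1 * W) ^ size f)%N%:Z <= _); last first.
  by rewrite sumr_const card_ord -mulr_natl natz -PoszM.
apply: ler_sum => k _; rewrite normrM PoszM ler_pM //.
apply: le_trans (pow _ _ _ _) _; first by rewrite lez_nat.
rewrite -!natz -natrM -natrX ler_nat leq_pexp2l ?muln_gt0 //.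
  by rewrite s_gt0 D_gt0.
by apply: ltnW; apply: ltn_ord.
Qed.

Definition tuple_bound (s : nat) : nat := s ^ (n.+1 * n.+1) * D.

(** Absolute values shifted by one, so that the entries form a tuple of positive
    integers whose product is bounded; unused positions carry 1. *)
Definition entry_code s B : {ffun 'I_n.+1 * 'I_n.+1 -> 'I_(tuple_bound s).+1} :=
  [ffun ij : 'I_n.+1 * 'I_n.+1 => inord (if (0 < ij.2)%N && (ij.2 <= ij.1)%N
                     then `|B ij.1 ij.2|.+1 else 1%N)].

(** The sign of the superdiagonal entry and the position of its absolute value
    among the divisors of the entry of f(A_j) that it divides. *)
Definition divisor_code M B : {ffun 'I_n.+1 -> bool * 'I_M.+1} :=
  [ffun j => (0 < superdiag B j,
    inord (index `|superdiag B j|%N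
      (divisors `|horner_entry f (trailing B j) j|)))].

Let entry_val B (ij : 'I_n.+1 * 'I_n.+1) : nat :=
  if (0 < ij.2)%N && (ij.2 <= ij.1)%N then `|B ij.1 ij.2|.+1 else 1%N.

Let prod_entry_val B : f != 0 -> normal_hessenberg B ->
  (\prod_ij entry_val B ij <= tuple_bound (size f))%N.
Proof.
move=> f_neq0 normB; have [_ sup_neq0 _ D_ge] := normB.
have s_gt0 : (0 < size f)%N by rewrite size_poly_gt0.
rewrite -(pair_bigA _ (fun i j => entry_val B (i, j))) /=.
apply: leq_trans (_ : \prod_(i < n.+1) (\prod_(j < n.+1) size f *
    \prod_(j < n.+1 | j <= i) `|superdiag B j|) <= _)%N.
  apply: leq_prod => i _; rewrite [X in (_ <= _ * X)%N]big_mkcond -big_split /=.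
  apply: leq_prod => j _; rewrite /entry_val /=.
  have [le_ji|lt_ij] := leqP j i; last by rewrite andbF muln1.
  case: (posnP j) => [j0|j_gt0] /=; first by rewrite muln_gt0 s_gt0 lt0n absz_eq0 sup_neq0.
  have /andP[B_ge0] := entry_lt normB j_gt0 le_ji.
  by rewrite -{1}(gez0_abs B_ge0) ltz_nat.
rewrite big_split /= leq_mul //.
by rewrite !prod_nat_const !card_ord -expnM.
Qed.

Let entry_val_lt B ij : f != 0 -> normal_hessenberg B ->
  (entry_val B ij < (tuple_bound (size f)).+1)%N.
Proof.
move=> f_neq0 normB; rewrite ltnS; apply: leq_trans (prod_entry_val f_neq0 normB).
rewrite (bigD1 ij) //= leq_pmulr // prodn_gt0 // => kl.
by rewrite /entry_val; case: ifP.
Qed.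

Lemma entry_code_mem s B : size f = s -> f != 0 -> normal_hessenberg B ->
  entry_code s B \in
    [set a : {ffun 'I_n.+1 * 'I_n.+1 -> 'I_(tuple_bound s).+1} |
      [forall i, 0 < a i]%N && (\prod_i a i <= tuple_bound s)%N].
Proof.
move=> <- f_neq0 normB.
have codeE ij : entry_code (size f) B ij = entry_val B ij :> nat.
  by rewrite ffunE inordK //; apply: entry_val_lt.
rewrite inE; apply/andP; split.
  by apply/forallP => ij; rewrite codeE /entry_val; case: ifP.
by under eq_bigr do rewrite codeE; apply: prod_entry_val.
Qed.

(** Downward induction on the column: the reduced entries of columns >= j and the
    superdiagonal entries of the columns > j determine the trailing block A_j, hence the list of
    divisors in which the superdiagonal entry of column j is located. *)
Lemma code_columns s M B B' : size f = s -> f != 0 ->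
  normal_hessenberg B -> normal_hessenberg B' ->
  horner_mx B f = 0 -> horner_mx B' f = 0 ->
  (forall j : 'I_n.+1, (0 < j)%N -> (`|horner_entry f (trailing B j) j| <= M)%N) ->
  entry_code s B = entry_code s B' ->
  divisor_code (max_divisors M) B = divisor_code (max_divisors M) B' ->
  forall i j : 'I_n.+1, (0 < j)%N -> B' i j = B i j.
Proof.
move=> sE f_neq0 normB normB' fB fB' h_le eqE eqD.
have {s sE} eqE : entry_code (size f) B = entry_code (size f) B' by rewrite sE.
have [hessB supB colB _] := normB; have [hessB' supB' colB' _] := normB'.
have low (i j : 'I_n.+1) : (0 < j)%N -> (j <= i)%N -> B' i j = B i j.
  move=> j_gt0 le_ji; have := congr1 (fun a : {ffun _} => nat_of_ord (a (i, j))) eqE.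
  rewrite /= !ffunE !inordK; try exact: (entry_val_lt (i, j)).
  rewrite /= j_gt0 le_ji => -[].
  have /andP[B_ge0 _] := entry_lt normB j_gt0 le_ji.
  have /andP[B'_ge0 _] := entry_lt normB' j_gt0 le_ji.
  by move=> eq_abs; rewrite -(gez0_abs B_ge0) -(gez0_abs B'_ge0) eq_abs.
suff H m (j : 'I_n.+1) : (n < j + m)%N -> (0 < j)%N -> forall i, B' i j = B i j.
  by move=> i j j_gt0; apply: (H n.+1) => //; rewrite addnS ltnS leq_addl.
elim: m j => [|m IHm] j lt_n j_gt0 i.
  by move: lt_n; rewrite addn0 ltnNge -ltnS ltn_ord.
have tr : trailing B' j = trailing B j.
  apply/matrixP => k l; rewrite !mxE; case: ifP => // /andP[le_k le_l].
  have [lt_jl|le_lj] := ltnP j l; last first.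
    by apply: low; [apply: leq_trans le_l | apply: leq_trans le_k].
  by apply: IHm; [lia | apply: leq_trans le_l].
have [lt_ij|le_ji] := ltnP i j; last exact: low.
have [lt_ij'|le_ji] := ltnP i.+1 j; first by rewrite hessB // hessB'.
have ji : j = i.+1 :> nat by apply/eqP; rewrite eqn_leq le_ji lt_ij.
rewrite -!(superdiagE _ ji).
have [_ h_neq0] := colB j j_gt0.
set ds := divisors `|horner_entry f (trailing B j) j|.
have inds C : superdiag C j != 0 -> (superdiag C j %| horner_entry f (trailing B j) j)%Z ->
    `|superdiag C j|%N \in ds.
  by move=> _; rewrite dvdzE /ds -dvdn_divisors // lt0n absz_eq0.
have dB : `|superdiag B j|%N \in ds by apply: inds (superdiag_dvd hessB fB j_gt0).
have dB' : `|superdiag B' j|%N \in ds.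
  by apply: inds; rewrite // -tr; apply: superdiag_dvd.
have sz_ds : (size ds <= max_divisors M)%N.
  have h_lt : (`|horner_entry f (trailing B j) j| < M.+1)%N by rewrite ltnS h_le.
  exact: (@leq_bigmax _ (fun N : 'I_M.+1 => size (divisors N)) (Ordinal h_lt)).
have idx_lt d : d \in ds -> (index d ds < (max_divisors M).+1)%N.
  by move=> d_in; rewrite ltnS; apply: leq_trans sz_ds; rewrite ltnW // index_mem.
have /(congr1 (fun c : {ffun _} => c j)) := eqD.
rewrite !ffunE tr -/ds => -[eq_sg /(congr1 (@nat_of_ord _))].
rewrite !inordK; try exact: idx_lt.
move=> /(congr1 (nth 0%N ds)); rewrite !nth_index // => eq_abs.
move: (supB j) (supB' j) eq_sg eq_abs; move: (superdiag B j) (superdiag B' j).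
move=> x y x0 y0 eq_sg eq_abs.
have sgE (z : int) : z != 0 -> z = if 0 < z then `|z|%N%:Z else - `|z|%N%:Z.
  by rewrite abszE; case: ltrgt0P => // _ _; rewrite opprK.
by rewrite (sgE x) // (sgE y) // eq_sg eq_abs.
Qed.

End NormalHessenberg.

Lemma char_poly_conj n (A B Q : 'M[int]_n) : \det Q = 1 -> A *m Q = Q *m B ->
  char_poly B = char_poly A.
Proof.
move=> detQ AQ; have Q_unit : Q \in unitmx by rewrite unitmxE detQ unitr1.
have pQ : char_poly_mx A *m map_mx polyC Q = map_mx polyC Q *m char_poly_mx B.
  rewrite /char_poly_mx mulmxBl mulmxBr -!map_mxM AQ; congr (_ - _).
  by rewrite scalar_mxC.
have := congr1 determinant pQ; rewrite !det_mulmx det_map_mx detQ /=.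
by rewrite mulr1 mul1r.
Qed.

(** Every integer matrix with real simple spectrum is conjugate in SL_n(Z) to a
    normalized Hessenberg matrix of controlled size. *)
Lemma conjugate_to_normal (R : realType) n (g : 'M[int]_n.+1)
    (mu : 'I_n.+1 -> R) (D : nat) : injective mu ->
  char_poly (map_mx intr g : 'M[R]_n.+1) = \prod_i ('X - (mu i)%:P) ->
  4 ^+ n.+1 * `|\det (Vandermonde n.+1 (\row_i mu i))| <= D%:R ->
  exists Q B, [/\ \det Q = 1, g *m Q = Q *m B,
    char_poly B = char_poly g & normal_hessenberg (char_poly g) D B].
Proof.
move=> mu_inj chg D_ge; have [l detl l_le] := small_cyclic_vector mu_inj chg.
have [Q [B [detQ gQ hessB supB B_le]]] := hessenberg_reduction detl.
have f_neq0 : char_poly g != 0 by rewrite -size_poly_eq0 size_char_poly.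
have [P [B' [detP BP hessB' supB' colB']]] := normal_form f_neq0 hessB supB.
have gQP : g *m (Q *m P) = (Q *m P) *m B'.
  by rewrite mulmxA gQ -(mulmxA Q B P) BP mulmxA.
have detQP : \det (Q *m P) = 1 by rewrite det_mulmx detQ detP mulr1.
exists (Q *m P), B'; split => //; first exact: char_poly_conj gQP.
split=> // [j|]; first by rewrite supB'.
under eq_bigr do under eq_bigr do rewrite supB'.
apply: leq_trans B_le _; rewrite -(ler_nat R) natr_absz.
exact: le_trans l_le D_ge.
Qed.

(** Determines the characteristic polynomial of a matrix of determinant 1, whose
    outer coefficients are fixed. *)
Definition coef_code n (X : 'I_n -> nat) (B : 'M[int]_n.+1) :
    {dffun forall k : 'I_n, 'I_(2 * X k).+1} :=
  [ffun k : 'I_n => inord (absz ((char_poly B)`_k.+1 + (X k)%:Z))].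

Lemma card_coef_code n (X : 'I_n -> nat) :
  #|{: {dffun forall k : 'I_n, 'I_(2 * X k).+1}}| = (\prod_k (2 * X k).+1)%N.
Proof.
rewrite card_dep_ffun foldrE big_map big_enum /=.
by under eq_bigr do rewrite card_ord.
Qed.

Lemma char_poly_coef0 n (B : 'M[int]_n.+1) :
  \det B = 1 -> (char_poly B)`_0 = (-1) ^+ n.+1.
Proof. by move=> detB; rewrite char_poly_det detB mulr1. Qed.

Lemma char_poly_coefn n (B : 'M[int]_n.+1) : (char_poly B)`_n.+1 = 1.
Proof.
by have := char_poly_monic B; rewrite monicE lead_coefE size_char_poly => /eqP.
Qed.

Lemma coef_code_inj n (X : 'I_n -> nat) (B B' : 'M[int]_n.+1) :
  \det B = 1 -> \det B' = 1 ->
  (forall k : 'I_n, `|(char_poly B)`_k.+1| <= (X k)%:Z) ->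
  (forall k : 'I_n, `|(char_poly B')`_k.+1| <= (X k)%:Z) ->
  coef_code X B = coef_code X B' -> char_poly B' = char_poly B.
Proof.
move=> detB detB' X_B X_B' eqF.
apply/polyP => -[|k]; first by rewrite !char_poly_coef0.
have [lt_kn|le_nk] := ltnP k n; last first.
  move: le_nk; rewrite leq_eqVlt => /orP[/eqP <-|lt_nk]; first by rewrite !char_poly_coefn.
  by rewrite !nth_default ?size_char_poly.
have := congr1 (fun c : {dffun forall k : 'I_n, 'I_(2 * X k).+1} =>
  nat_of_ord (c (Ordinal lt_kn))) eqF.
have := X_B (Ordinal lt_kn); have := X_B' (Ordinal lt_kn); rewrite /= !ffunE /=.
move: (_`_k.+1) (_`_k.+1) => x y; move: (X _) => b.
rewrite !ler_norml => x_b y_b; rewrite !inordK; lia.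
Qed.

Definition simple_spectrum (R : realType) n (g : 'M[int]_n.+1) : Prop :=
  exists2 mu : 'I_n.+1 -> R, injective mu &
    char_poly (map_mx intr g : 'M[R]_n.+1) = \prod_i ('X - (mu i)%:P).

(** Number of polynomials, times number of tuples of reduced entries, times number
    of choices of divisors. *)
Definition class_bound n (D : nat) (X : 'I_n -> nat) : nat :=
  let Y := tuple_bound n D n.+2 in
  let M := height_bound n D n.+2 (\sum_k X k).+1 in
  (\prod_k (2 * X k).+1) *
  ((trunc_log 2 Y).+1 ^ (n.+1 * n.+1) * Y * (2 * (max_divisors M).+1) ^ n.+1).

(** The first component of the code fixes the characteristic polynomial, the
    other two then fix all columns but the first, and the first column follows from
    the spectrum. *)
Lemma card_normal_hessenberg (R : realType) n (D : nat) (X : 'I_n -> nat) :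
  (0 < D)%N ->
  exists (F : finType) (A : {set F}) (code : 'M[int]_n.+1 -> F),
  (#|A| <= class_bound D X)%N /\
  forall B, [/\ \det B = 1, forall k : 'I_n, `|(char_poly B)`_k.+1| <= (X k)%:Z,
      simple_spectrum R B & normal_hessenberg (char_poly B) D B] ->
    code B \in A /\
    forall B', [/\ \det B' = 1, forall k : 'I_n, `|(char_poly B')`_k.+1| <= (X k)%:Z,
        simple_spectrum R B' & normal_hessenberg (char_poly B') D B'] ->
      code B = code B' -> B' = B.
Proof.
have X_le k : (X k <= \sum_j X j)%N by rewrite (bigD1 k) //= leq_addr.
move=> D_gt0; set Y := tuple_bound n D n.+2.
set H := (\sum_k X k).+1; set M := height_bound n D n.+2 H.
pose cF := {dffun forall k : 'I_n, 'I_(2 * X k).+1}.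
pose cE := {ffun 'I_n.+1 * 'I_n.+1 -> 'I_Y.+1}.
pose cD := {ffun 'I_n.+1 -> bool * 'I_(max_divisors M).+1}.
pose AE := [set a : cE | [forall i, 0 < a i]%N && (\prod_i a i <= Y)%N].
pose code (B : 'M[int]_n.+1) : cF * (cE * cD) :=
  (coef_code X B, (entry_code D n.+2 B, divisor_code (char_poly B) (max_divisors M) B)).
have Y_gt0 : (0 < Y)%N by rewrite muln_gt0 expn_gt0.
exists (cF * (cE * cD))%type,
  (finset.setX (finset.setTfor cF) (finset.setX AE (finset.setTfor cD))), code; split.
  rewrite !cardsX !cardsT leq_mul //.
    by rewrite card_coef_code.
  rewrite leq_mul //.
    by apply: leq_trans (card_prod_le _ Y_gt0) _; rewrite card_prod !card_ord.
  by rewrite card_ffun card_prod card_bool !card_ord.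
have szf (B : 'M[int]_n.+1) : size (char_poly B) = n.+2 by rewrite size_char_poly.
have f_neq0 (B : 'M[int]_n.+1) : char_poly B != 0 by rewrite -size_poly_eq0 szf.
move=> B [detB X_B [mu mu_inj chB] normB]; split.
  rewrite finset.in_setX finset.in_setT /= finset.in_setX finset.in_setT andbT /=.
  exact: entry_code_mem (szf B) (f_neq0 B) normB.
move=> B' [detB' X_B' _ normB'] eq_code.
have eqF : coef_code X B = coef_code X B' := congr1 fst eq_code.
have eqE : entry_code D n.+2 B = entry_code D n.+2 B' :=
  congr1 (fun c => c.2.1) eq_code.
have eqD : divisor_code (char_poly B) (max_divisors M) B =
    divisor_code (char_poly B') (max_divisors M) B' := congr1 (fun c => c.2.2) eq_code.
have eq_f : char_poly B' = char_poly B by apply: coef_code_inj eqF.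
rewrite eq_f in eqD normB'.
have f_le k : `|(char_poly B)`_k| <= H%:Z.
  case: k => [|k].
    by rewrite (char_poly_coef0 detB) normrX normrN1 expr1n.
  have [lt_kn|le_nk] := ltnP k n.
    apply: le_trans (X_B (Ordinal lt_kn)) _; rewrite lez_nat.
    exact: leq_trans (X_le _) (leqnSn _).
  move: le_nk; rewrite leq_eqVlt => /orP[/eqP <-|lt_nk]; first by rewrite char_poly_coefn normr1.
  by rewrite nth_default ?szf // normr0.
have h_le (j : 'I_n.+1) : (0 < j)%N ->
    (`|horner_entry (char_poly B) (trailing B j) j| <= M)%N.
  by move=> j_gt0; rewrite /M -(szf B); apply: horner_entry_le.
have fB' : horner_mx B' (char_poly B) = 0 by rewrite -eq_f; apply: Cayley_Hamilton.
have eq_cols := code_columns (szf B) (f_neq0 B) normB normB'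
  (Cayley_Hamilton B) fB' h_le eqE eqD.
have chB' : char_poly (map_mx intr B' : 'M[R]_n.+1) = \prod_i ('X - (mu i)%:P).
  by rewrite -map_char_poly eq_f map_char_poly.
have [hessB supB _ _] := normB.
exact: hess_determined mu_inj hessB supB eq_cols chB chB'.
Qed.

Local Open Scope classical_set_scope.
Local Open Scope ring_scope.

(** * Jordan projection and characteristic polynomial *)

Lemma uniq_map_inj (T U : eqType) (h : T -> U) (s : seq T) :
  uniq (map h s) -> {in s &, injective h}.
Proof.
move=> uniq_hs x y /[dup] xs /(nthP x)[k k_lt <-] /(nthP x)[l l_lt <-].
rewrite -!(nth_map _ (h x)) // => /eqP.
by rewrite nth_uniq ?size_map // => /eqP ->.
Qed.

Section Jordan.
Variables (R : realType) (n : nat).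
Implicit Types (g : 'M[R]_n) (m : 'I_n -> int).
Local Notation normc := (@ComplexField.Normc.normc R).

Lemma char_poly_eigenvalues g :
  map_poly (real_complex R) (char_poly g) = \prod_(z <- eigenvalues g) ('X - z%:P).
Proof.
rewrite map_char_poly /eigenvalues; case: closed_field_poly_normal => r /= {1}->.
by rewrite (eqP (char_poly_monic _)) scale1r.
Qed.

Lemma perm_sorted_eigenvalues g : perm_eq (sorted_eigenvalues g) (eigenvalues g).
Proof. by rewrite /sorted_eigenvalues perm_sort. Qed.

Lemma size_sorted_eigenvalues g : size (sorted_eigenvalues g) = n.
Proof.
rewrite (perm_size (perm_sorted_eigenvalues g)).
have := congr1 (fun p : {poly _} => size p) (char_poly_eigenvalues g).
by rewrite size_prod_XsubC size_map_poly size_char_poly => -[].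
Qed.

Lemma char_poly_sorted g :
  map_poly (real_complex R) (char_poly g) =
    \prod_(i < n) ('X - ((sorted_eigenvalues g)`_i)%:P).
Proof.
rewrite char_poly_eigenvalues -(perm_big _ (perm_sorted_eigenvalues g)) /=.
by rewrite (big_nth 0) size_sorted_eigenvalues big_mkord.
Qed.

Definition signed_root m (lam : 'rV[R]_n) (i : 'I_n) : R :=
  (m i)%:~R * expR (lam 0 i).

Lemma signed_root_norm m (lam : 'rV[R]_n) i : (forall i, m i = 1 \/ m i = -1) ->
  `|signed_root m lam i| = expR (lam 0 i).
Proof.
move=> m_pm; rewrite normrM (gtr0_norm (expR_gt0 _)).
by case: (m_pm i) => ->; rewrite ?mulrN1z ?mulr1z ?normrN normr1 mul1r.
Qed.

Lemma has_signs_char_poly g m : has_signs g m ->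
  char_poly g = \prod_i ('X - (signed_root m (jordan_proj g) i)%:P).
Proof.
case=> _ sE; apply: (map_poly_inj (real_complex R)).
rewrite char_poly_sorted rmorph_prod; apply: eq_bigr => i _ /=.
by rewrite sE rmorphB /= map_polyX map_polyC.
Qed.

Lemma has_signs_inj g m : has_signs g m ->
  injective (signed_root m (jordan_proj g)).
Proof.
case=> /map_uniq; rewrite -(perm_uniq (perm_sorted_eigenvalues g)) => uniq_s sE i j.
move=> eq_ij; apply: val_inj; apply/eqP.
rewrite -(nth_uniq 0 _ _ uniq_s) ?size_sorted_eigenvalues ?ltn_ord //.
by rewrite !sE -!/(signed_root _ _ _) eq_ij.
Qed.

Lemma normc_real (x : R) : normc (real_complex R x) = `|x|.
Proof. by rewrite /= expr0n /= addr0 sqrtr_sqr. Qed.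

(** Strictly decreasing moduli leave only one way to sort the eigenvalues. *)
Lemma jordan_of_roots g m (lam : 'rV[R]_n) :
  (forall i, m i = 1 \/ m i = -1) ->
  (forall i j : 'I_n, (i < j)%N -> lam 0 j < lam 0 i) ->
  char_poly g = \prod_i ('X - (signed_root m lam i)%:P) ->
  jordan_proj g = lam /\ has_signs g m.
Proof.
move=> m_pm lam_decr chg.
pose s : seq R[i] := [seq real_complex R (signed_root m lam i) | i <- enum 'I_n].
have size_s : size s = n by rewrite size_map size_enum_ord.
have s_nth (i : 'I_n) : s`_i = real_complex R (signed_root m lam i).
  by rewrite (nth_map i) ?size_enum_ord // nth_ord_enum.
have norm_s i : normc (real_complex R (signed_root m lam i)) = expR (lam 0 i).
  by rewrite normc_real signed_root_norm.
have perm_s : perm_eq s (eigenvalues g).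
  apply: prod_XsubC_eq.
  rewrite -char_poly_eigenvalues chg rmorph_prod big_map big_enum /=.
  by apply: eq_bigr => i _; rewrite rmorphB /= map_polyX map_polyC.
pose gt_s := fun z w : R[i] => normc w < normc z.
have sorted_s : sorted gt_s s.
  rewrite sorted_map; apply: (@sub_sorted _ (fun i j : 'I_n => (i < j)%N)).
    by move=> i j lt_ij; rewrite /= /gt_s !norm_s ltr_expR lam_decr.
  by have := iota_ltn_sorted 0 n; rewrite -val_enum_ord sorted_map.
have uniq_norm : uniq [seq normc z | z <- s].
  rewrite -map_comp map_inj_in_uniq ?enum_uniq // => i j _ _.
  rewrite -[LHS]/(normc (real_complex R (signed_root m lam i))).
  rewrite -[RHS]/(normc (real_complex R (signed_root m lam j))).
  rewrite !norm_s => /expR_inj lam_ij.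
  by case: (ltngtP i j) => [/lam_decr|/lam_decr|/val_inj//]; rewrite lam_ij ltxx.
have sorted_E : sorted_eigenvalues g = s.
  have le_s : sorted (fun z w : R[i] => normc w <= normc z) s.
    by apply: sub_sorted sorted_s => z w /ltW.
  rewrite /sorted_eigenvalues -[RHS](sorted_sort _ le_s); last first.
    by move=> y x z yx zy; apply: le_trans zy yx.
  apply/esym/perm_sort_inP => //.
  - by move=> x y _ _; apply: le_total.
  - by move=> y x z _ _ _ xy yz; apply: le_trans yz xy.
  move=> x y xs ys /le_anti eq_norm.
  exact: (uniq_map_inj uniq_norm xs ys (esym eq_norm)).
have jE : jordan_proj g = lam.
  by apply/rowP => i; rewrite mxE sorted_E s_nth norm_s expRK.
split=> //; split; last by move=> i; rewrite jE sorted_E s_nth.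
by rewrite /loxodromic -(perm_uniq (perm_map normc perm_s)).
Qed.

End Jordan.

(** * Real polynomials with roots in prescribed places *)

Lemma finite_positive_lower_bound (R : realDomainType) (I : finType) (P : pred I) (h : I -> R) :
  (forall i, P i -> 0 < h i) -> exists2 g, 0 < g & forall i, P i -> g <= h i.
Proof.
move=> h_gt0; exists (\big[Num.min/1]_(i | P i) h i).
  by elim/big_ind: _ => // x y x0 y0; rewrite lt_min x0.
by move=> i Pi; rewrite (bigD1 i) //= ge_min lexx.
Qed.

Section Concave.
Variables (R : realType) (n : nat) (w : nat -> R).
Hypothesis w_decr : forall i j : nat, (i < j < n)%N -> w j < w i.

Definition partial_sum k : R := \sum_(0 <= j < k) w j.

(** The function k |-> w_0 + ... + w_(k-1) - k w_i is strictly concave and takes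
    its maximum exactly at i and i + 1. *)
Lemma tilted_sum_lt i k : (i < n)%N -> (k <= n)%N -> k != i -> k != i.+1 ->
  partial_sum k - k%:R * w i < partial_sum i - i%:R * w i.
Proof.
move=> lt_in le_kn ki kSi; pose psi k := partial_sum k - k%:R * w i.
have psiS j : psi j.+1 = psi j + (w j - w i).
  by rewrite /psi /partial_sum big_nat_recr //= -natr1; ring.
have up d : (d < i)%N -> psi (i - d.+1)%N < psi i.
  elim: d => [|d IHd] lt_di.
    by rewrite subn1 -{2}(prednK lt_di) psiS ltrDl subr_gt0 w_decr // prednK // leqnn.
  apply: lt_trans (IHd (ltnW lt_di)).
  have e : (i - d.+1 = (i - d.+2).+1)%N by lia.
  by rewrite e psiS ltrDl subr_gt0 w_decr //; lia.
have psi_Si : psi i.+1 = psi i by rewrite psiS subrr addr0.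
have down d : (i.+1 + d.+1 <= n)%N -> psi (i.+1 + d.+1)%N < psi i.
  elim: d => [|d IHd] le_dn.
    by rewrite addn1 psiS psi_Si gtrDl subr_lt0 w_decr //; lia.
  rewrite addnS psiS; apply: lt_trans (IHd _); last by lia.
  by rewrite gtrDl subr_lt0 w_decr //; lia.
have [lt_ki|lt_ik|eq_ki] := ltngtP k i; last by rewrite eq_ki eqxx in ki.
  have -> : k = (i - (i - k).-1.+1)%N by lia.
  by apply: up; lia.
have -> : k = (i.+1 + (k - i.+1).-1.+1)%N by lia.
by apply: down; lia.
Qed.

End Concave.

(** The second index q is singled out because its term is smaller than that of p
    by a bounded factor only, while all other terms are negligible. *)
Lemma dominant_term (R : realType) (I : finType) (eps E : I -> R) (p q : I) (d L : R) :
  (forall k, eps k = 1 \/ eps k = -1) -> q != p -> E q <= E p - d ->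
  (forall k, k != p -> k != q -> E k <= E p - L) ->
  expR (- d) + #|I|%:R * expR (- L) < 1 ->
  0 < eps p * \sum_k eps k * expR (E k).
Proof.
move=> eps1 qp Eq Ek small.
have eps_norm k : `|eps k| = 1 by case: (eps1 k) => ->; rewrite ?normrN normr1.
rewrite (bigD1 p) //= mulrDr mulrA -expr2 -real_normK ?num_real // eps_norm expr1n mul1r.
rewrite -(opprK (eps p * _)) subr_gt0 -mulNr.
apply: le_lt_trans (ler_norm _) _; rewrite normrM normrN eps_norm mul1r.
apply: le_lt_trans (ler_norm_sum _ _ _) _.
rewrite (eq_bigr (fun k => expR (E k))) => [|k _]; last first.
  by rewrite normrM eps_norm mul1r gtr0_norm ?expR_gt0.
rewrite (bigD1 q) //=; apply: (@le_lt_trans _ _ (expR (E p) * (expR (- d) + #|I|%:R * expR (- L)))).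
  rewrite mulrDr; apply: lerD; first by rewrite -expRD ler_expR.
  apply: le_trans (_ : \sum_(k : I) expR (E p) * expR (- L) <= _); last first.
    by rewrite sumr_const mulrCA mulr_natl.
  rewrite [leRHS](bigID (fun k => (k != p) && (k != q))) /=.
  rewrite -[leLHS]addr0; apply: lerD; last first.
    by apply: sumr_ge0 => k _; rewrite mulr_ge0 ?expR_ge0.
  by apply: ler_sum => k /andP[kp kq]; rewrite -expRD ler_expR Ek.
by rewrite gtr_pMr ?expR_gt0.
Qed.

Section RealRoots.
Variables (R : realType) (n : nat) (w : nat -> R) (m : nat -> int).
Hypothesis w_decr : forall i j : nat, (i < j < n)%N -> w j < w i.
Hypothesis m_pm : forall i, m i = 1 \/ m i = -1.

Definition partial_sign k : int := (-1) ^+ k * \prod_(0 <= j < k) m j.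

Lemma partial_signS k : partial_sign k.+1 = - partial_sign k * m k.
Proof. by rewrite /partial_sign big_nat_recr //= exprS; ring. Qed.

Definition signed_poly (t : R) (alpha : nat -> R) : {poly R} :=
  \sum_(k < n.+1)
    ((partial_sign k)%:~R * expR (t * partial_sum w k + alpha k)) *: 'X^(n - k).

(** At modulus e^(t w_i + 3 d) the term of index i dominates, at modulus
    e^(t w_i - 3 d) the term of index i + 1 does; their signs at the points of sign
    m_i are opposite, and the intermediate value theorem applies. *)
Lemma signed_poly_root (d : R) : 0 < d -> exists t0 : R, forall t, t0 <= t ->
  forall alpha, (forall k, (k <= n)%N -> 0 <= alpha k <= d) ->
  forall i, (i < n)%N -> exists2 lam, `|lam - t * w i| <= 3 * d &
    root (signed_poly t alpha) ((m i)%:~R * expR lam).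
Proof.
move=> d_gt0.
have [g g_gt0 g_le] : exists2 g : R, 0 < g & forall (ik : 'I_n * 'I_n.+1),
    (ik.2 != ik.1 :> nat) && (ik.2 != ik.1.+1 :> nat) ->
    g <= (partial_sum w ik.1 - ik.1%:R * w ik.1) - (partial_sum w ik.2 - ik.2%:R * w ik.1).
  apply: finite_positive_lower_bound => -[i k] /= /andP[ki kSi].
  rewrite subr_gt0; apply: (tilted_sum_lt w_decr) => //.
  by rewrite -ltnS.
(* C absorbs the bounded part of the exponents, which is at most d + 3 n d. *)
pose C : R := (3 * n%:R + 4) * d.
pose K : R := (1 - expR (- (2 * d))) / (n.+2%:R * expR C).
have e2d : expR (- (2 * d)) < 1 by rewrite expR_lt1; lra.
have K_gt0 : 0 < K by rewrite divr_gt0 ?subr_gt0 // mulr_gt0 ?expR_gt0 // ltr0n.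
exists (Num.max 0 (- ln K / g)) => t; rewrite ge_max => /andP[t_ge0 t_ge] alpha alpha_d i lt_in.
have small : expR (- (2 * d)) + #|'I_n.+1|%:R * expR (- (t * g - C)) < 1.
  have le_K : expR (- (t * g)) <= K.
    rewrite -[leRHS](lnK K_gt0) ler_expR lerNl.
    by rewrite -ler_pdivrMr.
  rewrite card_ord opprB expRD mulrA addrC -ltrBrDr.
  apply: (@le_lt_trans _ _ (n.+1%:R * expR C * K)).
    by rewrite ler_wpM2l // mulr_ge0 ?expR_ge0.
  rewrite /K mulrA ltr_pdivrMr ?mulr_gt0 ?expR_gt0 ?ltr0n //.
  rewrite mulrC ltr_pM2l ?subr_gt0 // ltr_pM2r ?expR_gt0 //.
  by rewrite ltr_nat.
pose c : R := (m i)%:~R.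
have c2 : c * c = 1 by rewrite /c; case: (m_pm i) => ->; rewrite ?mulrN1z ?mulr1z; ring.
pose eps (k : 'I_n.+1) : R := (partial_sign k)%:~R * c ^+ (n - k).
have pm_mul (x y : R) : x = 1 \/ x = -1 -> y = 1 \/ y = -1 -> x * y = 1 \/ x * y = -1.
  by move=> [] -> [] ->; rewrite ?mulr1 ?mulrN1 ?opprK; auto.
have pm_exp (x : R) k : x = 1 \/ x = -1 -> x ^+ k = 1 \/ x ^+ k = -1.
  by move=> x1; elim: k => [|k IHk]; [left; rewrite expr0 | rewrite exprS; apply: pm_mul].
have m_pmR j : (m j)%:~R = 1 :> R \/ (m j)%:~R = -1 :> R.
  by case: (m_pm j) => ->; [left | right; rewrite mulrN1z].
have sign_pm k : (partial_sign k)%:~R = 1 :> R \/ (partial_sign k)%:~R = -1 :> R.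
  rewrite /partial_sign rmorphM rmorphXn /= mulrN1z; apply: (pm_mul _ _).
    by apply: pm_exp; right.
  rewrite rmorph_prod /=; apply: (big_ind (fun x : R => x = 1 \/ x = -1)).
  - by left.
  - exact: pm_mul.
  - by move=> j _; apply: m_pmR.
have eps_pm (j : 'I_n.+1) : eps j = 1 \/ eps j = -1.
  by apply: pm_mul => //; apply: pm_exp; apply: m_pmR.
have lt_i0 : (i < n.+1)%N by apply: ltnW.
pose p0 : 'I_n.+1 := Ordinal lt_i0; pose p1 : 'I_n.+1 := Ordinal (lt_in : (i.+1 < n.+1)%N).
have eps_p1 : eps p1 = - eps p0.
  rewrite /eps /= partial_signS -[(n - i)%N]subnSK // exprSr rmorphM rmorphN /= -/c.
  ring.
pose E th (k : 'I_n.+1) : R :=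
  t * partial_sum w k + alpha k + (n - k)%:R * (t * w i + 3 * th * d).
have hornerE th : (signed_poly t alpha).[c * expR (t * w i + 3 * th * d)] =
    \sum_k eps k * expR (E th k).
  rewrite horner_sum; apply: eq_bigr => k _; rewrite hornerZ hornerXn exprMn.
  rewrite -expRM_natl /E [in RHS]expRD /eps; ring.
have natB (k : 'I_n.+1) : (n - k)%:R = n%:R - k%:R :> R by rewrite natrB // -ltnS.
have k_le (k : 'I_n.+1) : k%:R <= n%:R :> R by rewrite ler_nat -ltnS.
have gk k : k != p0 -> k != p1 ->
    t * g <= t * ((partial_sum w i - i%:R * w i) - (partial_sum w k - k%:R * w i)).
  by move=> kp0 kp1; rewrite ler_wpM2l //; apply: (g_le (Ordinal lt_in, k)); rewrite kp0.
have kd_ge0 (k : 'I_n.+1) : 0 <= k%:R * d by rewrite mulr_ge0 ?(ltW d_gt0).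
have kd_le (k : 'I_n.+1) : k%:R * d <= n%:R * d by rewrite ler_wpM2r ?(ltW d_gt0).
have alpha_k (k : 'I_n.+1) : 0 <= alpha k <= d by apply: alpha_d; rewrite -ltnS.
have p1S : p1%:R = p0%:R + 1 :> R by rewrite /= natr1.
have sumS : partial_sum w p1 = partial_sum w p0 + w i by rewrite /partial_sum /= big_nat_recr.
have p01 : p1 != p0 by rewrite -val_eqE /= neq_ltn ltnSn orbT.
have pos : 0 < eps p0 * (signed_poly t alpha).[c * expR (t * w i + 3 * 1 * d)].
  rewrite hornerE; apply: (dominant_term eps_pm p01 _ _ small).
    have /andP[a0 a1] := alpha_k p1; have /andP[b0 b1] := alpha_k p0.
    rewrite /E !natB p1S sumS; lra.
  move=> k kp0 kp1; have /andP[a0 a1] := alpha_k k; have /andP[b0 b1] := alpha_k p0.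
  have := gk k kp0 kp1; have := kd_ge0 k; have := kd_le p0.
  rewrite /E !natB /C /=; lra.
have neg : 0 < eps p1 * (signed_poly t alpha).[c * expR (t * w i + 3 * -1 * d)].
  rewrite hornerE; apply: (dominant_term eps_pm (q := p0) _ _ _ small).
  - by rewrite eq_sym.
  - have /andP[a0 a1] := alpha_k p1; have /andP[b0 b1] := alpha_k p0.
    rewrite /E !natB p1S sumS; lra.
  move=> k kp1 kp0; have /andP[a0 a1] := alpha_k k; have /andP[b0 b1] := alpha_k p1.
  have := gk k kp0 kp1; have := kd_le k; have := kd_ge0 p0.
  rewrite /E !natB p1S sumS /C /=; lra.
pose Q := eps p0 *: (signed_poly t alpha \Po (c *: 'X)).
have QE x : Q.[x] = eps p0 * (signed_poly t alpha).[c * x].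
  by rewrite hornerZ horner_comp hornerZ hornerX.
have [||x /andP[x_ge x_le] /rootP Qx] := @poly_ivt R Q (expR (t * w i + 3 * -1 * d))
  (expR (t * w i + 3 * 1 * d)).
- by rewrite ler_expR; lra.
- rewrite !QE (ltW pos) andbT -oppr_ge0 -mulNr -eps_p1; exact: ltW.
have x_gt0 : 0 < x by apply: lt_le_trans x_ge; apply: expR_gt0.
exists (ln x).
  rewrite ler_norml; apply/andP; split.
    by move: x_ge; rewrite -{1}(lnK x_gt0) ler_expR; lra.
  by move: x_le; rewrite -{1}(lnK x_gt0) ler_expR; lra.
rewrite lnK // -/c; apply/rootP; move: Qx; rewrite QE => /eqP.
rewrite mulf_eq0; case: (eps_pm p0) => ->; rewrite ?oppr_eq0 oner_eq0 /=; exact/eqP.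
Qed.

End RealRoots.

(** * Integer matrices with prescribed spectrum *)

Lemma companion_exists n (F : {poly int}) : F \is monic -> size F = n.+1 ->
  exists g : 'M[int]_n, char_poly g = F.
Proof.
move=> F_monic sF; have := companionmxK F_monic.
have -> : n = (size F).-1 by rewrite sF.
by exists (companionmx F).
Qed.

Section Realize.
Variables (R : realType) (n : nat) (v : 'rV[R]_n.+1) (m : 'I_n.+1 -> int).
Hypothesis v_decr : forall i j : 'I_n.+1, (i < j)%N -> v 0 j < v 0 i.
Hypothesis m_pm : forall i, m i = 1 \/ m i = -1.
Hypothesis m_prod : \prod_i m i = 1.

(** Coordinates and signs are extended to natural indices to allow sums over initial segments. *)
Definition nat_coord (j : nat) : R := v 0 (inord j).
Definition nat_sign (j : nat) : int := m (inord j).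

Lemma nat_coord_decr (i j : nat) : (i < j < n.+1)%N -> nat_coord j < nat_coord i.
Proof.
move=> /andP[lt_ij lt_j]; apply: v_decr.
by rewrite !inordK //; apply: ltn_trans lt_j.
Qed.

Lemma partial_sign_last : partial_sign nat_sign n.+1 = (-1) ^+ n.+1.
Proof.
rewrite /partial_sign big_mkord (eq_bigr m) ?m_prod ?mulr1 // => i _.
by rewrite /nat_sign inord_val.
Qed.

(** The polynomial with these coefficients has n real roots of distinct moduli by
    signed_poly_root; its companion matrix has determinant 1 because b_n = 1 and the
    product of the signs is 1. *)
Lemma prescribed_spectrum (d : R) : 0 < d -> exists t0 : R, forall t, t0 <= t ->
  forall b : nat -> nat, b 0%N = 1%N -> b n.+1 = 1%N ->
  (forall k, (k <= n.+1)%N -> expR (t * partial_sum nat_coord k) <= (b k)%:R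
      <= expR (t * partial_sum nat_coord k + d)) ->
  exists g : 'M[int]_n.+1, [/\ SLZ g, has_signs (realmx R g) m,
    forall i, `|jordan_proj (realmx R g) 0 i - t * v 0 i| <= 3 * d &
    forall k, (k <= n.+1)%N -> (char_poly g)`_(n.+1 - k) = partial_sign nat_sign k * (b k)%:Z].
Proof.
move=> d_gt0; have m_pm' j : nat_sign j = 1 \/ nat_sign j = -1 by apply: m_pm.
have [t1 t1P] := signed_poly_root nat_coord_decr m_pm' d_gt0.
have [g g_gt0 g_le] : exists2 g : R, 0 < g & forall ij : 'I_n.+1 * 'I_n.+1,
    (ij.1 < ij.2)%N -> g <= v 0 ij.1 - v 0 ij.2.
  by apply: finite_positive_lower_bound => -[i j] /= ij; rewrite subr_gt0 v_decr.
(* Consecutive exponents t v_i are at least 7 d apart, hence the roots, which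
   move by at most 3 d each, keep their order. *)
exists (Num.max t1 (7 * d / g)) => t; rewrite ge_max => /andP[t_ge1 t_ge2] b b0 bn b_bd.
pose F : {poly int} := \poly_(j < n.+2)
  (partial_sign nat_sign (n.+1 - j) * (b (n.+1 - j)%N)%:Z).
have coefF k : (k <= n.+1)%N -> F`_(n.+1 - k) = partial_sign nat_sign k * (b k)%:Z.
  by move=> le_k; rewrite coef_poly ltnS leq_subr subKn.
have F_last : F`_n.+1 = 1.
  by rewrite -[X in F`_X]subn0 coefF // b0 /partial_sign big_geq // expr0 !mulr1.
have sF : size F = n.+2.
  by apply: size_poly_eq; rewrite /= subnn b0 /partial_sign big_geq.
have F_monic : F \is monic by rewrite monicE lead_coefE sF F_last.
have [gm chg] := companion_exists F_monic sF.
pose alpha k : R := ln (b k)%:R - t * partial_sum nat_coord k.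
have b_gt0 k : (k <= n.+1)%N -> 0 < (b k)%:R :> R.
  by move=> le_k; have /andP[h _] := b_bd k le_k; apply: lt_le_trans h; apply: expR_gt0.
have alpha_bd k : (k <= n.+1)%N -> 0 <= alpha k <= d.
  move=> le_k; have /andP[h1 h2] := b_bd k le_k.
  apply/andP; split.
    by rewrite subr_ge0 -ler_expR lnK ?posrE ?b_gt0.
  by rewrite lerBlDl -ler_expR lnK ?posrE ?b_gt0.
have mapF : map_poly intr F = signed_poly n.+1 nat_coord nat_sign t alpha.
  rewrite /signed_poly (reindex_inj rev_ord_inj) /=.
  have k_le (k : 'I_n.+2) : (k <= n.+1)%N by rewrite -ltnS.
  apply/polyP => j; rewrite coef_map coef_poly /= coef_sum.
  have [lt_j|le_j] := ltnP j n.+2; last first.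
    rewrite big1 // => k _; rewrite coefZ coefXn subSS (subKn (k_le k)).
    have -> : (j == k) = false by apply/negP => /eqP jk; move: le_j; rewrite jk leqNgt ltn_ord.
    by rewrite mulr0.
  rewrite (bigD1 (Ordinal lt_j)) //= big1 ?addr0 => [|k neq_k].
    rewrite coefZ coefXn subSS (subKn (k_le (Ordinal lt_j))) /= eqxx mulr1 rmorphM /=; congr (_ * _).
    by rewrite addrC subrK lnK ?posrE ?b_gt0 ?leq_subr.
  have jk : (j == k) = false by apply: contraNF neq_k => /eqP jk; apply/eqP/val_inj.
  by rewrite coefZ coefXn subSS (subKn (k_le k)) jk mulr0.
have ex_lam (i : 'I_n.+1) : exists lam, `|lam - t * v 0 i| <= 3 * d /\
    root (map_poly intr F) ((m i)%:~R * expR lam).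
  have [lam] := t1P t t_ge1 alpha alpha_bd i (ltn_ord i).
  by rewrite /nat_coord /nat_sign inord_val -mapF => h1 h2; exists lam.
have [lam0 /all_and2[lam_near lam_root]] := choice ex_lam.
pose lam : 'rV[R]_n.+1 := \row_i lam0 i.
have lam_decr (i j : 'I_n.+1) : (i < j)%N -> lam 0 j < lam 0 i.
  move=> lt_ij; have := lam_near i; have := lam_near j; rewrite !ler_norml !mxE.
  move=> /andP[j1 j2] /andP[i1 i2]; have := g_le (i, j) lt_ij => /= gap.
  have : 7 * d <= t * g by rewrite -ler_pdivrMr.
  have : t * g <= t * (v 0 i - v 0 j).
    rewrite ler_wpM2l //; apply: le_trans t_ge2; rewrite divr_ge0 ?(ltW g_gt0) //; lra.
  lra.
have z_norm i : `|signed_root m lam i| = expR (lam 0 i) by apply: signed_root_norm.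
have z_inj : injective (signed_root m lam).
  move=> i j /(congr1 Num.norm); rewrite !z_norm => /expR_inj lam_ij.
  by case: (ltngtP i j) => [/lam_decr|/lam_decr|/val_inj//]; rewrite lam_ij ltxx.
have chR : char_poly (realmx R gm) = \prod_i ('X - (signed_root m lam i)%:P).
  rewrite -map_char_poly chg; pose rs := [seq signed_root m lam i | i <- enum 'I_n.+1].
  have size_mapF : size (map_poly intr F : {poly R}) = n.+2.
    by rewrite size_map_inj_poly // => x y /intr_inj.
  have all_root : all (root (map_poly intr F)) rs.
    by apply/allP => _ /mapP[i _ ->]; rewrite /signed_root mxE; apply: lam_root.
  have uniq_rs : uniq_roots rs by rewrite uniq_rootsE map_inj_uniq ?enum_uniq.
  have size_rs : size (map_poly intr F : {poly R}) = (size rs).+1.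
    by rewrite size_mapF size_map size_enum_ord.
  rewrite {1}(all_roots_prod_XsubC size_rs all_root uniq_rs).
  by rewrite lead_coefE size_mapF coef_map F_last scale1r big_map big_enum.
have [jE signs] := jordan_of_roots m_pm lam_decr chR.
exists gm; split => //.
- have := char_poly_det gm; rewrite chg.
  have -> : F`_0 = (-1) ^+ n.+1.
    by rewrite -[X in F`_X](subnn n.+1) coefF // partial_sign_last bn mulr1.
  move/(congr1 (fun x => (-1) ^+ n.+1 * x)).
  by rewrite mulrA -!expr2 sqrr_sign mul1r => /esym.
- by move=> i; rewrite jE mxE.
- by rewrite chg.
Qed.

End Realize.

(** * Norms and distance to a ray *)

(** An elementary Cauchy estimate, by induction on the number of factors; a
    suitable r recovers the bound by the largest elementary product of the moduli. *)
Lemma coef_prod_XsubC_le (R : realDomainType) (I : Type) (s : seq I) (z : I -> R) (r : R) j :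
  0 <= r -> `|(\prod_(i <- s) ('X - (z i)%:P))`_j| * r ^+ j <= \prod_(i <- s) (r + `|z i|).
Proof.
move=> r0; elim: s j => [|i s IHs] j.
  rewrite !big_nil coef1; case: j => [|j]; first by rewrite normr1 mulr1.
  by rewrite normr0 mul0r.
rewrite !big_cons mulrBl coefB coefXM coefCM.
have z0 := normr_ge0 (z i); have rj := exprn_ge0 j r0.
apply: le_trans (_ : (`|if (j == 0)%N then 0 else (\prod_(i <- s) ('X - (z i)%:P))`_j.-1|
   + `|z i| * `|(\prod_(i <- s) ('X - (z i)%:P))`_j|) * r ^+ j <= _).
  by rewrite ler_wpM2r // -normrM ler_normB.
rewrite mulrDl [leRHS]mulrDl lerD //; last by rewrite -mulrA ler_wpM2l.
case: j {rj} => [|j] /=; last by rewrite exprS mulrCA ler_wpM2l.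
by rewrite normr0 mul0r mulr_ge0 // prodr_ge0 // => k _; rewrite addr_ge0.
Qed.

Section Norms.
Variables (R : realType) (n : nat) (nrm : 'rV[R]_n -> R).
Hypothesis nrmP : is_norm nrm.

Lemma nrm0 : nrm 0 = 0.
Proof. by case: nrmP => _ h _; rewrite -(scale0r (0 : 'rV[R]_n)) h normr0 mul0r. Qed.

Lemma nrmN x : nrm (- x) = nrm x.
Proof. by case: nrmP => _ h _; rewrite -scaleN1r h normrN1 mul1r. Qed.

Lemma nrm_ge0 x : 0 <= nrm x.
Proof.
case: nrmP => tri _ _; have := tri x (- x); rewrite subrr nrm0 nrmN; lra.
Qed.

Lemma nrm_le_coord : exists2 K : R, 0 < K &
  forall (x : 'rV[R]_n) (c : R), 0 <= c -> (forall i, `|x 0 i| <= c) -> nrm x <= K * c.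
Proof.
case: nrmP => tri hom _; exists (1 + \sum_i nrm (delta_mx 0 i)).
  by rewrite ltr_wpDr // sumr_ge0 // => i _; apply: nrm_ge0.
move=> x c c_ge0 xc.
have nrm_sum (F : 'I_n -> 'rV[R]_n) : nrm (\sum_i F i) <= \sum_i nrm (F i).
  apply: (big_ind2 (fun a b => nrm a <= b)) => // [|a b a' b' h h']; first by rewrite nrm0.
  by apply: le_trans (tri _ _) _; apply: lerD.
rewrite {1}[x]row_sum_delta; apply: le_trans (nrm_sum _) _.
rewrite mulrDl mul1r mulr_suml -[leLHS]add0r lerD //; apply: ler_sum => i _.
by rewrite hom mulrC ler_wpM2l // nrm_ge0.
Qed.

(** Equivalence of norms: the given norm attains a positive minimum on the compact
    unit sphere of the sup norm. *)
Lemma coord_le_nrm : exists2 K : R, 0 < K &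
  forall (x : 'rV[R]_n) i, `|x 0 i| <= K * nrm x.
Proof.
have [tri hom nrm_eq0] := nrmP; have [K K_gt0 KP] := nrm_le_coord.
have coord_le (x : 'rV[R]_n) i : `|x 0 i| <= `|x|.
  by rewrite [leRHS]/Num.norm /= mx_normrE; apply/bigmax_geP; right; exists (0, i).
have nrm_le x : nrm x <= K * `|x| by apply: KP => // i; apply: coord_le.
have nrm_sub a b : nrm a - nrm b <= K * `|a - b|.
  by apply: le_trans (nrm_le _); rewrite lerBlDr -{1}(subrK b a); apply: tri.
have nrm_cont : continuous nrm.
  move=> x; apply/(@cvgrPdist_le _ _ _ (nbhs x) (nbhs_filter x)) => e e_gt0; near=> y.
  have xy : K * `|x - y| <= e.
    rewrite mulrC -ler_pdivlMr //; near: y.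
    apply/nbhs_ballP; exists (e / K) => /=; first by rewrite divr_gt0.
    by move=> y; rewrite -ball_normE /= => /ltW.
  rewrite ler_norml; apply/andP; split; last exact: le_trans (nrm_sub _ _) xy.
  by rewrite lerNl opprB; apply: le_trans (nrm_sub _ _) _; rewrite distrC.
pose S : set 'rV[R]_n := [set x | `|x| = 1].
have normalize (x : 'rV[R]_n) : x != 0 -> S (`|x|^-1 *: x).
  move=> x0; rewrite /S /= normrZ normfV normr_id mulVf // normr_eq0 //.
have [S0|S0] := pselect (S !=set0); last first.
  exists 1 => // x i; have [->|x0] := eqVneq x 0.
    by rewrite mxE normr0 mul1r nrm_ge0.
  by case: S0; exists (`|x|^-1 *: x); apply: normalize.
have S_compact : compact S.
  apply: bounded_closed_compact.
    by exists 1; split => // M M_gt1 x /= ->; exact: ltW.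
  rewrite (_ : S = (fun x : 'rV[R]_n => `|x|) @^-1` [set 1]) //.
  apply: closed_comp => [x _|]; first exact: norm_continuous.
  exact: closed_eq.
have [x0 /set_mem x0S x0_min] := EVT_min_rV S0 S_compact (continuous_subspaceT nrm_cont).
have x0_gt0 : 0 < nrm x0.
  rewrite lt_neqAle nrm_ge0 andbT eq_sym; apply/eqP => /nrm_eq0 x00.
  by move: x0S; rewrite /S /= x00 normr0 => /esym/eqP; rewrite oner_eq0.
exists (nrm x0)^-1; first by rewrite invr_gt0.
move=> x i; apply: le_trans (coord_le x i) _.
have [->|xn0] := eqVneq x 0; first by rewrite normr0 mulr_ge0 ?nrm_ge0 // invr_ge0 ltW.
rewrite mulrC ler_pdivlMr // mulrC.
have := x0_min _ (mem_set (normalize x xn0)).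
by rewrite hom normfV normr_id [_^-1 * _]mulrC ler_pdivlMr ?normr_gt0 // mulrC.
Unshelve. all: by end_near.
Qed.

Lemma dist_ray_witness v x e : dist_ray nrm v x <= e ->
  exists2 t, 0 <= t & nrm (x - t *: v) <= e + 1.
Proof.
move=> d_le; have hasinf : has_inf [set nrm (x - t *: v) | t in [set t : R | 0 <= t]].
  split; first by exists (nrm (x - 0 *: v)); exists 0 => //=.
  by exists 0 => _ [t _ <-]; apply: nrm_ge0.
have [_ [t t_ge0 <-] d_lt] := inf_adherent (ltr01 : (0:R) < 1) hasinf.
by exists t => //; apply: ltW; apply: lt_le_trans d_lt _; rewrite lerD2r.
Qed.

Lemma dist_ray_le v x t : 0 <= t -> dist_ray nrm v x <= nrm (x - t *: v).
Proof.
move=> t_ge0; apply: ge_inf; last by exists t.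
by exists 0 => _ [s _ <-]; apply: nrm_ge0.
Qed.

End Norms.

(** * Spectra close to a ray of the chamber *)

Section Chamber.
Variables (R : realType) (n : nat) (v : 'rV[R]_n.+1).
Hypothesis v_chamber : Hplus v.

Lemma chamber_decr (i j : 'I_n.+1) : (i < j)%N -> v 0 j < v 0 i.
Proof. by case: v_chamber => _; apply. Qed.

Lemma chamber_sum0 : \sum_i v 0 i = 0.
Proof. by case: v_chamber. Qed.

Lemma partial_sum_ord k : (k <= n.+1)%N ->
  partial_sum (nat_coord v) k = \sum_(i < n.+1 | (i < k)%N) v 0 i.
Proof.
move=> le_k; rewrite /partial_sum (big_nat_widen _ _ _ _ _ le_k) big_mkord.
by apply: eq_bigr => i _; rewrite /nat_coord inord_val.
Qed.

Lemma partial_sum_last : partial_sum (nat_coord v) n.+1 = 0.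
Proof.
rewrite partial_sum_ord // -[RHS]chamber_sum0.
by apply: eq_bigl => i; rewrite ltn_ord.
Qed.

(** Either all coordinates before k are positive, or all those from k on are
    negative; the total sum is zero. *)
Lemma partial_sum_gt0 k : (0 < k)%N -> (k < n.+1)%N ->
  0 < partial_sum (nat_coord v) k.
Proof.
move=> k_gt0 lt_k; rewrite (partial_sum_ord (ltnW lt_k)).
have lt_k1 : (k.-1 < n.+1)%N by apply: leq_ltn_trans (leq_pred _) _.
pose p := Ordinal lt_k1; pose q := Ordinal lt_k.
have [vp_gt0|vp_le0] := ltP 0 (v 0 p).
  rewrite (bigD1 p) /=; last by rewrite prednK.
  rewrite ltr_wpDr // sumr_ge0 // => i /andP[lt_ik ip].
  apply: le_trans (ltW vp_gt0) (ltW (chamber_decr _)) => /=.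
  by move: ip; rewrite -val_eqE /=; lia.
have -> : \sum_(i < n.+1 | (i < k)%N) v 0 i = - \sum_(i < n.+1 | ~~ (i < k)%N) v 0 i.
  apply/eqP; rewrite -subr_eq0 opprK -(bigID (fun i : 'I_n.+1 => (i < k)%N) xpredT) /=.
  by rewrite chamber_sum0.
have v_neg (i : 'I_n.+1) : ~~ (i < k)%N -> v 0 i < 0.
  move=> le_ki; apply: lt_le_trans vp_le0; apply: chamber_decr => //=; lia.
rewrite oppr_gt0 (bigD1 q) /= ?ltnn // ltr_wnDr ?v_neg /= ?ltnn //.
by apply: sumr_le0 => i /andP[le_ki _]; apply/ltW/v_neg.
Qed.

Lemma partial_sum_ge0 k : (k <= n.+1)%N -> 0 <= partial_sum (nat_coord v) k.
Proof.
rewrite leq_eqVlt => /orP[/eqP ->|lt_k]; first by rewrite partial_sum_last.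
have [->|k_gt0] := posnP k; first by rewrite /partial_sum big_geq.
by rewrite ltW // partial_sum_gt0.
Qed.

Lemma sum_ord_gt (i : 'I_n.+1) (x : R) : \sum_(j < n.+1 | (i < j)%N) x = (n%:R - i%:R) * x.
Proof.
transitivity (\sum_(i.+1 <= j < n.+1) x).
  rewrite (big_nat_widenl _ 0) // big_mkord; apply: eq_bigl => j //.
have le_in : (i <= n)%N by rewrite -ltnS.
by rewrite sumr_const_nat subSS -natrB // mulr_natl.
Qed.

Lemma sum_ord_lt (i : 'I_n.+1) (x : R) : \sum_(j < n.+1 | (j < i)%N) x = i%:R * x.
Proof.
transitivity (\sum_(0 <= j < i) x).
  by rewrite (big_nat_widen _ _ n.+1) ?big_mkord // ltnW.
by rewrite sumr_const_nat subn0 mulr_natl.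
Qed.

Lemma weighted_sum : \sum_(i < n.+1) (n%:R - i%:R) * v 0 i = - \sum_(i < n.+1) i%:R * v 0 i.
Proof.
under eq_bigr do rewrite mulrBl.
by rewrite sumrB -mulr_sumr chamber_sum0 mulr0 sub0r.
Qed.

Lemma rhoE : rho v = - \sum_(i < n.+1) i%:R * v 0 i.
Proof.
rewrite /rho.
have -> : \sum_(i < n.+1) \sum_(j < n.+1 | (i < j)%N) (v 0 i - v 0 j) =
    \sum_(i < n.+1) (n%:R - i%:R) * v 0 i - \sum_(i < n.+1) i%:R * v 0 i.
  under eq_bigr do rewrite sumrB sum_ord_gt.
  rewrite sumrB; congr (_ - _); rewrite (exchange_big_dep xpredT) //=.
  by apply: eq_bigr => j _; rewrite sum_ord_lt.
by rewrite weighted_sum; lra.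
Qed.

Lemma sum_partial_sum : \sum_(k < n.+1) partial_sum (nat_coord v) k = rho v.
Proof.
rewrite rhoE -weighted_sum.
under eq_bigr do rewrite partial_sum_ord 1?ltnW //.
rewrite (exchange_big_dep xpredT) //=.
by apply: eq_bigr => i _; rewrite sum_ord_gt.
Qed.

Lemma sum_leading_coords : \sum_(i < n.+1) \sum_(j < n.+1 | (i < j)%N) v 0 i = rho v.
Proof. by rewrite rhoE -weighted_sum; apply: eq_bigr => i _; rewrite sum_ord_gt. Qed.

Lemma rho_ge0 : 0 <= rho v.
Proof.
rewrite mulr_ge0 ?invr_ge0 // sumr_ge0 // => i _; rewrite sumr_ge0 // => j ij.
by rewrite subr_ge0 ltW // chamber_decr.
Qed.

Variables (m : 'I_n.+1 -> int) (lam : 'rV[R]_n.+1) (t c : R).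
Hypothesis m_pm : forall i, m i = 1 \/ m i = -1.
Hypothesis t_ge0 : 0 <= t.
Hypothesis lam_near : forall i, `|lam 0 i - t * v 0 i| <= c.

Lemma signed_root_le i : `|signed_root m lam i| <= expR c * expR (t * v 0 i).
Proof.
rewrite (signed_root_norm lam i m_pm) -expRD ler_expR.
by have := lam_near i; rewrite ler_norml; lra.
Qed.

(** The estimate of coef_prod_XsubC_le at radius e^(t v_k): factors with index at
    most k have size e^(t v_i), the other ones e^(t v_k). *)
Lemma coef_spectrum_le k : (k <= n.+1)%N ->
  `|(\prod_i ('X - (signed_root m lam i)%:P))`_(n.+1 - k)|
    <= (2 * expR c) ^+ n.+1 * expR (t * partial_sum (nat_coord v) k).
Proof.
move=> le_k; have c_ge0 : 0 <= c by apply: le_trans (lam_near ord0).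
(* For k = 0 this is the largest coordinate, which bounds all the others. *)
pose x := nat_coord v k.-1.
have x_le i : (i < k)%N -> x <= nat_coord v i.
  move=> lt_ik; have [->|ne] := eqVneq i k.-1; first by [].
  by apply/ltW/(nat_coord_decr chamber_decr); lia.
have x_ge i : (k <= i)%N -> (i < n.+1)%N -> nat_coord v i <= x.
  move=> le_ki lt_i; have [->|ne] := eqVneq i k.-1; first by [].
  apply/ltW/(nat_coord_decr chamber_decr); lia.
have := coef_prod_XsubC_le (index_enum 'I_n.+1) (signed_root m lam) (n.+1 - k) (expR_ge0 (t * x)).
rewrite -expRM_natl => h.
rewrite -(ler_pM2r (expR_gt0 ((n.+1 - k)%:R * (t * x)))); apply: le_trans h _.
apply: (@le_trans _ _ (\prod_(i < n.+1) (2 * expR c * expR (t * if (i < k)%N then v 0 i else x)))).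
  apply: ler_prod => i _; rewrite addr_ge0 ?expR_ge0 //=.
  rewrite -mulrA mulr_natl mulr2n; apply: lerD.
    rewrite -[leLHS]mul1r; apply: ler_pM; rewrite ?expR_ge0 ?ler01 //.
      by rewrite -expR0 ler_expR.
    rewrite ler_expR ler_wpM2l //; case: ifP => // lt_ik.
    by rewrite -[v 0 i](_ : nat_coord v i = _) ?x_le // /nat_coord inord_val.
  apply: le_trans (signed_root_le i) _; rewrite ler_wpM2l ?expR_ge0 // ler_expR ler_wpM2l //.
  case: ltnP => // le_ki.
  by rewrite -[v 0 i](_ : nat_coord v i = _) ?x_ge // /nat_coord inord_val.
rewrite big_split /= prodr_const card_ord -[leRHS]mulrA ler_wpM2l ?exprn_ge0 ?mulr_ge0 ?expR_ge0 //.
rewrite -expR_sum -expRD ler_expR -mulr_sumr mulrCA -mulrDr ler_wpM2l //.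
rewrite (bigID (fun i : 'I_n.+1 => (i < k)%N)) /= partial_sum_ord //.
rewrite (eq_bigr (fun i => v 0 i)) => [|i ->] //; rewrite lerD2l.
rewrite (eq_bigr (fun=> x)) => [|i /negPf ->] //.
have -> : \sum_(i < n.+1 | ~~ (i < k)%N) x = (n.+1 - k)%:R * x.
  transitivity (\sum_(k <= i < n.+1) x); last by rewrite sumr_const_nat mulr_natl.
  rewrite (big_nat_widenl _ 0) // big_mkord; apply: eq_bigl => i.
  by rewrite -leqNgt.
by [].
Qed.

(** Each difference of roots has the size of the larger one, and the sum of v_i
    over the pairs i < j is rho(v). *)
Lemma Vandermonde_spectrum_le :
  `|\det (Vandermonde n.+1 (\row_i signed_root m lam i))|
    <= (2 * expR c) ^+ (n.+1 * n.+1) * expR (t * rho v).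
Proof.
have c_ge0 : 0 <= c by apply: le_trans (lam_near ord0).
have b_ge1 : 1 <= 2 * expR c by have : 1 <= expR c; [rewrite -expR0 ler_expR | lra].
rewrite det_Vandermonde -sum_leading_coords normr_prod mulr_sumr expR_sum.
have -> : (2 * expR c) ^+ (n.+1 * n.+1) = \prod_(i < n.+1) (2 * expR c) ^+ n.+1.
  by rewrite prodr_const card_ord exprM.
rewrite -big_split /=.
apply: ler_prod => i _; rewrite normr_ge0 /= normr_prod mulr_sumr expR_sum.
apply: (@le_trans _ _ (\prod_(j < n.+1 | (i < j)%N) (2 * expR c * expR (t * v 0 i)))).
  apply: ler_prod => j lt_ij; rewrite normr_ge0 /= !mxE.
  apply: le_trans (ler_normB _ _) _; rewrite -mulrA mulr_natl mulr2n lerD ?signed_root_le //.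
  apply: le_trans (signed_root_le j) _; rewrite ler_wpM2l ?expR_ge0 // ler_expR.
  by rewrite ler_wpM2l // ltW // chamber_decr.
rewrite big_split /= ler_wpM2r ?prodr_ge0 //.
rewrite prodr_const ler_weXn2l // -[leqRHS]card_ord.
exact: max_card.
Qed.

End Chamber.

(** * Counting measures and exponential growth rates *)

(** Bounds a counting measure by any list that labels the points injectively; the
    labels need only be related to the points, not chosen. *)
Lemma counting_le_seq (R : realType) (T : choiceType) (U : eqType) (A : set T)
    (s : seq U) (rel : T -> U -> Prop) :
  (forall x, A x -> exists2 u, u \in s & rel x u) ->
  (forall x y u, A x -> A y -> rel x u -> rel y u -> x = y) ->
  (counting A <= (size s)%:R%:E :> \bar R)%E.
Proof.
move=> total functional.
have [[x0 Ax0]|A0] := pselect (A !=set0); last first.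
  have -> : A = set0 by apply/seteqP; split => // x Ax; case: A0; exists x.
  by rewrite /counting asboolT // fset_set0 lee_fin.
have /choice[h hP] : forall u, exists x, (exists2 y, A y & rel y u) -> A x /\ rel x u.
  move=> u; have [[y Ay yu]|no] := pselect (exists2 y, A y & rel y u).
    by exists y.
  by exists x0 => ex; case: no.
have A_sub : A `<=` [set` map h s].
  move=> x Ax; have [u us xu] := total x Ax; apply/mapP; exists u => //.
  have [Ah hu] := hP u (ex_intro2 _ _ x Ax xu).
  exact: functional xu hu.
have finA : finite_set A by apply: sub_finite_set A_sub _; exact: finite_seq.
rewrite /counting asboolT // lee_fin ler_nat -(size_map h s).
apply: uniq_leq_size; first exact: finmap.fset_uniq.
by move=> x; rewrite in_fset_set // inE => /A_sub.
Qed.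

Lemma counting_le_card (R : realType) (T : choiceType) (F : finType) (A : set T)
    (S : {set F}) (rel : T -> F -> Prop) :
  (forall x, A x -> exists2 u, u \in S & rel x u) ->
  (forall x y u, A x -> A y -> rel x u -> rel y u -> x = y) ->
  (counting A <= #|S|%:R%:E :> \bar R)%E.
Proof.
move=> total functional; rewrite cardE; apply: counting_le_seq functional => x Ax.
by have [u uS xu] := total x Ax; exists u; rewrite ?mem_enum.
Qed.

Lemma counting_ge_card (R : realType) (T : choiceType) (F : finType) (A : set T)
    (S : {set F}) (h : F -> T) :
  {in S &, injective h} -> (forall u, u \in S -> A (h u)) ->
  (#|S|%:R%:E <= counting A :> \bar R)%E.
Proof.
move=> h_inj hA; rewrite /counting; case: asboolP => [finA|_]; last exact: leey.
rewrite lee_fin ler_nat cardE -(size_map h); apply: uniq_leq_size.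
  rewrite map_inj_in_uniq ?enum_uniq // => u u'; rewrite !mem_enum; exact: h_inj.
move=> _ /mapP[u u_in ->]; rewrite in_fset_set // inE; apply: hA.
by rewrite mem_enum in u_in.
Qed.

Lemma counting_le_rel (R : realType) (T U : choiceType) (A : set T) (B : set U)
    (rel : T -> U -> Prop) :
  (forall x, A x -> exists2 u, B u & rel x u) ->
  (forall x y u, A x -> A y -> rel x u -> rel y u -> x = y) ->
  (counting A <= counting B :> \bar R)%E.
Proof.
move=> total functional; rewrite [X in (_ <= X)%E]/counting.
case: asboolP => [finB|_]; last exact: leey.
apply: counting_le_seq functional => x Ax; have [u Bu xu] := total x Ax.
by exists u => //; rewrite in_fset_set // inE.
Qed.

Lemma counting_subset (R : realType) (T : choiceType) (A B : set T) :
  A `<=` B -> (counting A <= counting B :> \bar R)%E.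
Proof.
move=> AB; apply: (@counting_le_rel _ _ _ _ _ eq) => [x /AB|x y u _ _ -> ->] //.
by exists x.
Qed.

Section Rates.
Variable R : realType.
Local Open Scope ereal_scope.

Lemma le_lne (x y : \bar R) : x <= y -> lne x <= lne y.
Proof.
case: x y => [r| |] [s| |] // rs; rewrite ?leey ?leNye //; try by [].
rewrite lee_fin in rs; rewrite /=; case: ifP => [_|/negbT]; first exact: leNye.
rewrite -ltNge => r_gt0; have s_gt0 := lt_le_trans r_gt0 rs.
by rewrite (lt_geF s_gt0) lee_fin ler_ln.
Qed.

Lemma pinfty_nbhs_ge (T0 : R) : pinfty_nbhs R [set T | (T0 <= T)%R].
Proof. by exists T0; split; [exact: num_real | move=> T /ltW]. Qed.

Lemma limf_esup_mono (f g : R -> \bar R) (T0 : R) :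
  (forall T, (T0 <= T)%R -> f T <= g T) ->
  limf_esup f (pinfty_nbhs R) <= limf_esup g (pinfty_nbhs R).
Proof.
move=> fg; apply: le_ereal_inf_tmp => _ [V FV <-].
have FW : pinfty_nbhs R (V `&` [set T | (T0 <= T)%R]).
  by apply: filterI FV _; exact: pinfty_nbhs_ge.
apply: (@le_trans _ _ (ereal_sup (f @` (V `&` [set T | (T0 <= T)%R])))).
  by apply: ereal_inf_lbound; exists (V `&` [set T | (T0 <= T)%R]).
apply: ge_ereal_sup => _ [T [VT T0T] <-]; apply: le_trans (fg T T0T) _.
by apply: ereal_sup_ubound; exists T.
Qed.

Lemma limf_einf_mono (f g : R -> \bar R) (T0 : R) :
  (forall T, (T0 <= T)%R -> f T <= g T) ->
  limf_einf f (pinfty_nbhs R) <= limf_einf g (pinfty_nbhs R).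
Proof.
move=> fg; rewrite /limf_einf leeN2; apply: (@limf_esup_mono _ _ T0) => T T0T.
by rewrite leeN2 fg.
Qed.

Lemma limf_einf_le_esup (f : R -> \bar R) :
  limf_einf f (pinfty_nbhs R) <= limf_esup f (pinfty_nbhs R).
Proof.
rewrite limf_einfE limf_esupE; apply: ge_ereal_sup => _ [V FV <-].
apply: le_ereal_inf_tmp => _ [W FW <-].
have [x [Vx Wx]] : V `&` W !=set0 
  by apply: (@filter_ex _ (pinfty_nbhs R)); apply: filterI.
apply: (@le_trans _ _ (f x)); first by apply: ereal_inf_lbound; exists x.
by apply: ereal_sup_ubound; exists x.
Qed.

Lemma limf_esup_le (f : R -> \bar R) (a : R) :
  (forall e : R, (0 < e)%R -> exists T0, forall T, (T0 <= T)%R -> f T <= (a + e)%:E) ->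
  limf_esup f (pinfty_nbhs R) <= a%:E.
Proof.
move=> fa; apply/lee_addgt0Pr => e e_gt0; have [T0 T0P] := fa e e_gt0.
apply: (@le_trans _ _ (ereal_sup (f @` [set T | (T0 <= T)%R]))).
  by apply: ereal_inf_lbound; exists [set T | (T0 <= T)%R] => //; exact: pinfty_nbhs_ge.
by apply: ge_ereal_sup => _ [T T0T <-]; rewrite -EFinD; apply: T0P.
Qed.

Lemma limf_einf_ge (f : R -> \bar R) (a : R) :
  (forall e : R, (0 < e)%R -> exists T0, forall T, (T0 <= T)%R -> (a - e)%:E <= f T) ->
  a%:E <= limf_einf f (pinfty_nbhs R).
Proof.
move=> fa; rewrite /limf_einf leeNr; apply: limf_esup_le => e e_gt0.
have [T0 T0P] := fa e e_gt0; exists T0 => T /T0P h.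
by rewrite leeNl -EFinN opprD opprK.
Qed.

Definition log_rate (N : R -> \bar R) (T : R) : \bar R := T^-1%:E * lne (N T).

Lemma log_rate_mono (N N' : R -> \bar R) (T : R) : (0 <= T)%R ->
  N T <= N' T -> log_rate N T <= log_rate N' T.
Proof.
move=> T_ge0 NN'; apply: lee_wpmul2l; first by rewrite lee_fin invr_ge0.
exact: le_lne.
Qed.

Lemma log_rate_exp (C a T : R) : (0 < C)%R -> (0 < T)%R ->
  log_rate (fun T => (C * expR (a * T))%:E) T = (a + ln C / T)%:E.
Proof.
move=> C_gt0 T_gt0; rewrite /log_rate lne_EFin ?mulr_gt0 ?expR_gt0 //.
rewrite lnM ?posrE ?expR_gt0 // expRK -EFinM; congr (_%:E).
by field; rewrite gt_eqF.
Qed.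

Lemma div_small (c e : R) : (0 < e)%R -> exists T0, (0 < T0)%R /\
  forall T, (T0 <= T)%R -> (`|c / T| <= e)%R.
Proof.
move=> e_gt0; exists ((`|c| + 1) / e)%R; split=> [|T T_ge].
  by rewrite divr_gt0 // ltr_wpDl.
have T_gt0 : (0 < T)%R.
  by apply: lt_le_trans T_ge; rewrite divr_gt0 // ltr_wpDl.
rewrite normrM normfV (gtr0_norm T_gt0) ler_pdivrMr // mulrC -ler_pdivrMr //.
by apply: le_trans T_ge; rewrite ler_pM2r ?invr_gt0 // lerDl.
Qed.

(** Constants disappear after division by T. *)
Lemma limsup_log_rate_le (N : R -> \bar R) (a : R) :
  (forall e : R, (0 < e)%R -> exists2 C : R, (0 < C)%R &
     forall T, (1 <= T)%R -> N T <= (C * expR ((a + e) * T))%:E) ->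
  limf_esup (log_rate N) (pinfty_nbhs R) <= a%:E.
Proof.
move=> N_le; apply: limf_esup_le => e e_gt0.
have e2_gt0 : (0 < e / 2)%R by rewrite divr_gt0.
have [C C_gt0 CP] := N_le _ e2_gt0.
have [T0 [T0_gt0 T0P]] := div_small (ln C) e2_gt0.
exists (Num.max 1 T0)%R => T; rewrite ge_max => /andP[T_ge1 T_ge0].
have T_gt0 : (0 < T)%R by apply: lt_le_trans T_ge1.
apply: (@le_trans _ _ (log_rate (fun T => (C * expR ((a + e / 2) * T))%:E) T)).
  by apply: log_rate_mono; [exact: ltW | exact: CP].
rewrite log_rate_exp // lee_fin; have := T0P T T_ge0; rewrite ler_norml; lra.
Qed.

Lemma liminf_log_rate_ge (N : R -> \bar R) (a c T1 : R) : (0 < c)%R ->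
  (forall T, (T1 <= T)%R -> (c * expR (a * T))%:E <= N T) ->
  a%:E <= limf_einf (log_rate N) (pinfty_nbhs R).
Proof.
move=> c_gt0 N_ge; apply: limf_einf_ge => e e_gt0.
have [T0 [T0_gt0 T0P]] := div_small (ln c) e_gt0.
exists (Num.max T1 T0)%R => T; rewrite ge_max => /andP[T_ge1 T_ge0].
have T_gt0 : (0 < T)%R by apply: lt_le_trans T_ge0.
apply: (@le_trans _ _ (log_rate (fun T => (c * expR (a * T))%:E) T)).
  by rewrite log_rate_exp // lee_fin; have := T0P T T_ge0; rewrite ler_norml; lra.
by apply: log_rate_mono; [exact: ltW | exact: N_ge].
Qed.

Section EpsLimit.
Variable N : R -> R -> \bar R.
Hypothesis N_mono : forall e e' T, (0 < e)%R -> (e <= e')%R -> N e T <= N e' T.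

(** Monotonicity in epsilon turns the limit at 0 into an infimum, and in particular
    makes it exist. *)
Lemma upper_rateE : upper_rate N = ereal_inf
  [set limf_esup (log_rate (N e)) (pinfty_nbhs R) | e in [set` `]0%R, 1%R[]].
Proof.
apply/cvg_lim => //; apply: nondecreasing_at_right_cvge; first by rewrite bnd_simp.
move=> e e'; rewrite !in_itv /= => /andP[e_gt0 _] _ ee'.
by apply: (@limf_esup_mono _ _ 0%R) => T T_ge0; apply: log_rate_mono => //; apply: N_mono.
Qed.

Lemma lower_rateE : lower_rate N = ereal_inf
  [set limf_einf (log_rate (N e)) (pinfty_nbhs R) | e in [set` `]0%R, 1%R[]].
Proof.
apply/cvg_lim => //; apply: nondecreasing_at_right_cvge; first by rewrite bnd_simp.
move=> e e'; rewrite !in_itv /= => /andP[e_gt0 _] _ ee'.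
by apply: (@limf_einf_mono _ _ 0%R) => T T_ge0; apply: log_rate_mono => //; apply: N_mono.
Qed.

Lemma lower_rate_le_upper : lower_rate N <= upper_rate N.
Proof.
rewrite lower_rateE upper_rateE; apply: le_ereal_inf_tmp => _ [e e_in <-].
apply: le_trans (limf_einf_le_esup _).
by apply: ereal_inf_lbound; exists e.
Qed.

Lemma upper_rate_le (a : R) : (forall e, (0 < e)%R ->
  limf_esup (log_rate (N e)) (pinfty_nbhs R) <= a%:E) -> upper_rate N <= a%:E.
Proof.
move=> N_le; rewrite upper_rateE; have half_gt0 : (0 < 2^-1 :> R)%R by rewrite invr_gt0.
apply: le_trans (N_le _ half_gt0); apply: ereal_inf_lbound.
by exists 2^-1%R => //=; rewrite in_itv /= half_gt0 invf_lt1 // ltr1n.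
Qed.

Lemma lower_rate_ge (a : R) : (forall e, (0 < e)%R ->
  a%:E <= limf_einf (log_rate (N e)) (pinfty_nbhs R)) -> a%:E <= lower_rate N.
Proof.
move=> N_ge; rewrite lower_rateE; apply: le_ereal_inf_tmp => _ [e /= e_in <-].
by apply: N_ge; move: e_in; rewrite in_itv /= => /andP[].
Qed.

End EpsLimit.
End Rates.

(** * Counting Jordan projections and conjugacy classes *)

Ltac nneg := repeat first [ by [] | exact: expR_ge0 | exact: ler0n
  | apply: exprn_ge0 | apply: mulr_ge0 | by apply: ltW ].

Ltac posit := repeat first [ by [] | exact: expR_gt0 | by rewrite ltr0n
  | apply: exprn_gt0 | apply: mulr_gt0 ].

Lemma max_divisors_gt0 M : (0 < M)%N -> (0 < max_divisors M)%N.
Proof.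
move=> M_gt0; have lt_1 : (1 < M.+1)%N by [].
exact: (@leq_bigmax _ (fun N : 'I_M.+1 => size (divisors N)) (Ordinal lt_1)).
Qed.

(** The logarithmic and divisor factors are smaller than any power: raised to the
    power k they are bounded by a fixed power of the other data, independent of k.
    Working with k-th powers avoids fractional exponents. *)
Lemma class_bound_pow_le n k : (0 < k)%N -> exists K, forall D (X : 'I_n -> nat),
  (0 < D)%N ->
  (class_bound D X ^ k <= K * ((\prod_j (2 * X j).+1) * D) ^ k *
     D ^ (n.+1 * n.+1) * height_bound n D n.+2 (\sum_j X j).+1 ^ n.+1)%N.
Proof.
move=> k_gt0; have [C CP] := max_divisors_bound k.
pose q := (n.+1 * n.+1)%N; pose c := (n.+2 ^ q)%N.
exists ((k ^ k * c) ^ q * c ^ k * (4 ^ k * C) ^ n.+1)%N => D X D_gt0.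
rewrite /class_bound; set M := height_bound _ _ _ _; set P := (\prod_j _)%N.
have YE : tuple_bound n D n.+2 = (c * D)%N by [].
rewrite YE; set Y := (c * D)%N; set L := (trunc_log 2 Y).+1; set mu := max_divisors M.
have M_gt0 : (0 < M)%N.
  by rewrite /M /height_bound muln_gt0 /= muln_gt0 /= expn_gt0 muln_gt0 /= muln_gt0 D_gt0.
have Y_gt0 : (0 < Y)%N by rewrite muln_gt0 expn_gt0.
have L_le : (L ^ k <= k ^ k * Y)%N.
  apply: leq_trans (exp_succ_le_pow2 _ _) _; rewrite leq_mul2l; apply/orP; right.
  by apply: trunc_logP.
have mu_le : ((2 * mu.+1) ^ k <= 4 ^ k * C * M)%N.
  apply: (@leq_trans ((4 * mu) ^ k)).
    rewrite leq_exp2r //; have := max_divisors_gt0 M_gt0; rewrite -/mu; lia.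
  by rewrite expnMn -mulnA leq_mul2l CP ?orbT.
have -> : ((P * (L ^ q * Y * (2 * mu.+1) ^ n.+1)) ^ k =
    P ^ k * ((L ^ k) ^ q * Y ^ k * ((2 * mu.+1) ^ k) ^ n.+1))%N.
  by rewrite !expnMn -!expnM [(q * k)%N]mulnC [(n.+1 * k)%N]mulnC.
have -> : ((k ^ k * c) ^ q * c ^ k * (4 ^ k * C) ^ n.+1 * (P * D) ^ k * D ^ q * M ^ n.+1 =
    P ^ k * ((k ^ k * Y) ^ q * Y ^ k * (4 ^ k * C * M) ^ n.+1))%N.
  rewrite /Y !expnMn; ring.
by rewrite !leq_mul // leq_exp2r.
Qed.


Section Growth.
Variables (R : realType) (n : nat) (nrm : 'rV[R]_n.+1 -> R) (v : 'rV[R]_n.+1).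
Variable m : 'I_n.+1 -> int.
Hypothesis nrmP : is_norm nrm.
Hypothesis v_chamber : Hplus v.
Hypothesis m_pm : forall i, m i = 1 \/ m i = -1.
Hypothesis nrm_v_gt0 : 0 < nrm v.

Local Notation s := (partial_sum (nat_coord v)).
Local Notation adm := (admissible nrm v m).
Let a : R := rho v / nrm v.

Let a_ge0 : 0 <= a.
Proof. by rewrite divr_ge0 ?(rho_ge0 v_chamber) // ltW. Qed.

Lemma partial_sum_le_rho k : (k <= n.+1)%N -> s k <= rho v.
Proof.
rewrite leq_eqVlt => /orP[/eqP ->|lt_k].
  by rewrite (partial_sum_last v_chamber); apply: rho_ge0.
rewrite -(sum_partial_sum v_chamber) (bigD1 (Ordinal lt_k)) //= lerDl.
by apply: sumr_ge0 => i _; apply: partial_sum_ge0 => //; apply: ltnW.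
Qed.

Lemma sum_partial_sum_rev : \sum_(k < n) s (n - k) = rho v.
Proof.
have s0 : s 0 = 0 by rewrite /partial_sum big_geq.
rewrite -(sum_partial_sum v_chamber) big_ord_recl /= s0 add0r.
rewrite (reindex_inj rev_ord_inj); apply: eq_bigr => k _ /=.
by rewrite subKn.
Qed.

Lemma adm_det e T g : adm e T g -> \det g = 1.
Proof. by case. Qed.

Lemma adm_char_poly e T g : adm e T g ->
  char_poly (realmx R g) = \prod_i ('X - (signed_root m (jordan_proj (realmx R g)) i)%:P).
Proof. by case=> _ _ _ signs; apply: has_signs_char_poly. Qed.

(** The distance to the ray and the norm bound give lambda(g) = t v + O(1) with
    t <= T / |v| + O(1); partial sums of v are nonnegative, so the bounds at t are
    dominated by those at T / |v|. *)
Lemma adm_spectrum_bound e : 0 < e -> exists2 C : R, 1 <= C &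
  forall T g, 0 <= T -> adm e T g ->
    (forall k, (k <= n.+1)%N ->
      `|((char_poly g)`_(n.+1 - k))%:~R| <= C * expR (s k / nrm v * T)) /\
    4 ^+ n.+1 * `|\det (Vandermonde n.+1
       (\row_i signed_root m (jordan_proj (realmx R g)) i))| <= C * expR (a * T).
Proof.
move=> e_gt0; have [K K_gt0 KP] := coord_le_nrm nrmP.
pose c := K * (e + 1); pose d := (e + 1) / nrm v.
have c_ge0 : 0 <= c by rewrite mulr_ge0 ?(ltW K_gt0) //; lra.
have d_ge0 : 0 <= d by rewrite divr_ge0 ?(ltW nrm_v_gt0) //; lra.
have ec : 1 <= expR c by rewrite -expR0 ler_expR.
have b_ge1 : 1 <= 8 * expR c by lra.
exists ((8 * expR c) ^+ (n.+1 * n.+1) * expR (d * rho v)).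
  rewrite -[leLHS]mulr1 ler_pM // ?exprn_ege1 // -expR0 ler_expR mulr_ge0 //.
  exact: rho_ge0.
move=> T g T_ge0 adm_g; have [_ dist_g norm_g _] := adm_g.
have chg := adm_char_poly adm_g; set lam := jordan_proj _ in dist_g norm_g chg *.
have [t t_ge0 near_t] := dist_ray_witness nrmP dist_g.
have lam_near i : `|lam 0 i - t * v 0 i| <= c.
  have := KP (lam - t *: v) i; rewrite !mxE => /le_trans; apply.
  by rewrite ler_wpM2l // ltW.
have t_le : t <= T / nrm v + d.
  have [tri hom _] := nrmP.
  rewrite -mulrDl ler_pdivlMr // -[X in X * _]ger0_norm // -hom.
  rewrite (_ : t *: v = lam + - (lam - t *: v)); last by rewrite opprB addrCA subrr addr0.
  apply: le_trans (tri _ _) _; rewrite (nrmN nrmP); lra.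
have exp_le x : 0 <= x -> x <= rho v ->
    expR (t * x) <= expR (d * rho v) * expR (x / nrm v * T).
  move=> x_ge0 x_le; rewrite -expRD ler_expR.
  apply: le_trans (ler_wpM2r x_ge0 t_le) _; rewrite mulrDl addrC lerD ?ler_wpM2l //.
  by rewrite le_eqVlt; apply/orP; left; apply/eqP; ring.
split=> [k le_k|].
  have coefE : ((char_poly g)`_(n.+1 - k))%:~R =
      (\prod_i ('X - (signed_root m lam i)%:P))`_(n.+1 - k).
    by rewrite -chg /realmx -map_char_poly coef_map.
  rewrite coefE; apply: le_trans (coef_spectrum_le v_chamber m_pm t_ge0 lam_near le_k) _.
  rewrite -mulrA; apply: ler_pM; rewrite ?expR_ge0 ?exprn_ge0 ?mulr_ge0 ?expR_ge0 //.
    apply: (@le_trans _ _ ((8 * expR c) ^+ n.+1)).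
      by rewrite lerXn2r ?nnegrE ?mulr_ge0 ?expR_ge0 // ler_wpM2r ?expR_ge0 // ler_nat.
    by rewrite ler_weXn2l // leq_pmulr.
  by apply: exp_le; [exact: partial_sum_ge0 | exact: partial_sum_le_rho].
apply: le_trans (ler_wpM2l _ (Vandermonde_spectrum_le v_chamber m_pm t_ge0 lam_near)) _.
  by rewrite exprn_ge0.
rewrite mulrA -[leRHS]mulrA; apply: ler_pM.
- by rewrite mulr_ge0 ?exprn_ge0 ?mulr_ge0 ?expR_ge0.
- exact: expR_ge0.
- have -> : 8 * expR c = 4 * (2 * expR c) by ring.
  rewrite [leRHS]exprMn ler_wpM2r ?exprn_ge0 ?mulr_ge0 ?expR_ge0 //.
  by rewrite ler_weXn2l ?leq_pmulr // ler1n.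
- by apply: exp_le; first exact: rho_ge0.
Qed.

Definition coef_bound (C T : R) (k : 'I_n) : nat :=
  Num.truncn (C * expR (s (n - k) / nrm v * T)).

Lemma coef_bound_le C T k : 0 <= C ->
  (coef_bound C T k)%:R <= C * expR (s (n - k) / nrm v * T).
Proof. by move=> C_ge0; rewrite truncn_le // mulr_ge0 ?expR_ge0. Qed.

Let s_ge0 (k : 'I_n) : 0 <= s (n - k).
Proof. by apply: partial_sum_ge0 => //; rewrite (leq_trans (leq_subr _ _)). Qed.

Lemma prod_coef_bound_le C T : 1 <= C -> 0 <= T ->
  (\prod_k (2 * coef_bound C T k).+1)%N%:R <= (3 * C) ^+ n * expR (a * T).
Proof.
move=> C_ge1 T_ge0; have C_ge0 : 0 <= C by lra.
have -> : (3 * C) ^+ n * expR (a * T) =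
    \prod_(k < n) (3 * C * expR (s (n - k) / nrm v * T)).
  rewrite big_split /= prodr_const card_ord; congr (_ * _).
  by rewrite -expR_sum -!mulr_suml sum_partial_sum_rev.
rewrite natr_prod; apply: ler_prod => k _; rewrite ler0n /=.
have h := coef_bound_le T k C_ge0.
have e_ge1 : 1 <= expR (s (n - k) / nrm v * T).
  by rewrite -expR0 ler_expR mulr_ge0 // divr_ge0 // ltW.
have y_ge1 : 1 <= C * expR (s (n - k) / nrm v * T) by rewrite -[leLHS]mulr1 ler_pM.
rewrite -natr1 natrM -[leRHS]mulrA.
move: (C * _) h y_ge1 => y; move: (coef_bound C T k)%:R => x; lra.
Qed.

Lemma adm_coef_bound C T (g : 'M[int]_n.+1) : 1 <= C ->
  (forall k, (k <= n.+1)%N ->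
    `|((char_poly g)`_(n.+1 - k))%:~R| <= C * expR (s k / nrm v * T)) ->
  forall k : 'I_n, `|(char_poly g)`_k.+1| <= (coef_bound C T k)%:Z.
Proof.
move=> C_ge1 coef_le k; have := coef_le (n - k)%N.
rewrite (leq_trans (leq_subr _ _)) // => /(_ isT).
have -> : (n.+1 - (n - k) = k.+1)%N by have := ltn_ord k; lia.
rewrite -intr_norm -[`|_`__|]abszE => h; rewrite lez_nat.
by rewrite /coef_bound truncn_ge_nat // mulr_ge0 ?expR_ge0 //; lra.
Qed.

Lemma jordan_of_char_poly (g h : 'M[int]_n.+1) :
  char_poly g = char_poly h -> jordan_proj (realmx R g) = jordan_proj (realmx R h).
Proof.
move=> gh; have eqE : eigenvalues (realmx R g) = eigenvalues (realmx R h).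
  rewrite /eigenvalues -[char_poly (map_mx _ (realmx R g))]map_char_poly.
  rewrite -[char_poly (map_mx _ (realmx R h))]map_char_poly.
  by rewrite -!(map_char_poly (intr : int -> R)) gh.
by rewrite /jordan_proj /sorted_eigenvalues eqE.
Qed.

(** Jordan projections are labelled by characteristic polynomials, that is by their inner coefficients. *)
Lemma count_jordan_le e : 0 < e -> exists2 C : R, 0 < C &
  forall T, 1 <= T -> (count_jordan nrm v m e T <= (C * expR (a * T))%:E)%E.
Proof.
move=> e_gt0.
have [C C_ge1 CP] := adm_spectrum_bound e_gt0.
exists ((3 * C) ^+ n); first by rewrite exprn_gt0 //; lra.
move=> T T_ge1; have T_ge0 : 0 <= T by lra.
apply: le_trans (_ : (\prod_k (2 * coef_bound C T k).+1)%N%:R%:E <= _)%E; last first.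
  by rewrite lee_fin prod_coef_bound_le.
rewrite -card_coef_code -cardsT.
apply: (@counting_le_card R _ _ _ _ (fun lam c => exists g, [/\ adm e T g,
  lam = jordan_proj (realmx R g) & c = coef_code (coef_bound C T) g])).
  by move=> _ [g adm_g <-]; exists (coef_code (coef_bound C T) g); rewrite ?inE //; exists g.
move=> x y _ _ _ [g [adm_g -> ->]] [h [adm_h -> eq_c]].
have [coef_g _] := CP T g T_ge0 adm_g; have [coef_h _] := CP T h T_ge0 adm_h.
apply: jordan_of_char_poly; apply/esym.
by apply: coef_code_inj eq_c; rewrite ?(adm_det adm_g) ?(adm_det adm_h) //;
  apply: adm_coef_bound.
Qed.

Lemma SLZ_unit (p : 'M[int]_n.+1) : SLZ p -> p \in unitmx.
Proof. by rewrite /SLZ /= unitmxE => ->; rewrite unitr1. Qed.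

Lemma conj_class_sub (g B Q : 'M[int]_n.+1) : SLZ Q -> g *m Q = Q *m B ->
  conj_class g `<=` conj_class B.
Proof.
move=> detQ gQ _ [p detp <-]; have detpQ : SLZ (p *m Q).
  by rewrite /SLZ /= det_mulmx detp detQ mulr1.
exists (p *m Q) => //.
have <- : (p *m g *m invmx p) *m (p *m Q) = p *m Q *m B.
  by rewrite -!mulmxA (mulmxA (invmx p)) (mulVmx (SLZ_unit detp)) mul1mx gQ.
by rewrite (mulmxK (SLZ_unit detpQ)).
Qed.

Lemma conj_class_eq (g B Q : 'M[int]_n.+1) : \det Q = 1 -> g *m Q = Q *m B ->
  conj_class g = conj_class B.
Proof.
move=> detQ gQ; apply/seteqP; split; first exact: conj_class_sub gQ.
apply: (@conj_class_sub _ _ (invmx Q)); first by rewrite /SLZ /= det_inv detQ invr1.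
have Q_unit : Q \in unitmx by apply: SLZ_unit.
by rewrite -[B](mulKmx Q_unit) -gQ -!mulmxA mulmxV // mulmx1.
Qed.

Lemma conj_class_char_poly (g h : 'M[int]_n.+1) :
  conj_class g = conj_class h -> char_poly g = char_poly h.
Proof.
move=> eq_gh; have : conj_class g g.
  by exists 1%:M; rewrite /SLZ /= ?det1 // mul1mx invmx1 mulmx1.
rewrite eq_gh => -[p detp hE].
apply: (@char_poly_conj _ h g (invmx p)); first by rewrite det_inv detp invr1.
by rewrite -hE !mulmxA (mulVmx (SLZ_unit detp)) mul1mx.
Qed.

(** The Jordan projection is a class function. *)
Lemma count_jordan_le_classes e T :
  (count_jordan nrm v m e T <= count_classes nrm v m e T)%E.
Proof.
apply: (@counting_le_rel R _ _ _ _ (fun lam X => exists g, [/\ adm e T g,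
  lam = jordan_proj (realmx R g) & X = conj_class g])).
  by move=> _ [g adm_g <-]; exists (conj_class g); [exists g | exists g].
move=> _ _ X _ _ [g [_ -> ->]] [h [_ -> eq_X]].
by apply: jordan_of_char_poly; apply: conj_class_char_poly.
Qed.

Lemma admissible_mono e e' T : e <= e' -> adm e T `<=` adm e' T.
Proof. by move=> ee' g [? d_le ? ?]; split => //; apply: le_trans ee'. Qed.

Definition index_bound (C T : R) : nat := (Num.truncn (C * expR (a * T))).+1.


Let exp_ge1 T : 0 <= T -> 1 <= expR (a * T).
Proof. by move=> T_ge0; rewrite -expR0 ler_expR mulr_ge0. Qed.

Lemma height_bound_le C : 1 <= C -> exists2 K : R, 0 < K & forall T, 0 <= T ->
  (height_bound n (index_bound C T) n.+2
     (\sum_j coef_bound C T j).+1)%:R <= K * expR (a * T) ^+ n.+3.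
Proof.
move=> C_ge1; have C_gt0 : 0 < C by lra.
have C_ge0 := ltW C_gt0.
exists (n.+2%:R * ((n.+1%:R * C) * (n.+1%:R * (n.+2%:R * (2 * C))) ^+ n.+2)).
  by posit.
move=> T T_ge0; have E_ge1 := exp_ge1 T_ge0; set E := expR (a * T) in E_ge1 *.
have CE : 1 <= C * E by rewrite -[leLHS]mulr1 ler_pM.
have D_le : (index_bound C T)%:R <= 2 * C * E.
  have tr : (Num.truncn (C * E))%:R <= C * E by rewrite truncn_le; lra.
  by rewrite /index_bound -[X in X <= _]natr1 -/E; lra.
have H_le : (\sum_j coef_bound C T j).+1%:R <= n.+1%:R * C * E.
  rewrite -natr1 natr_sum -[n.+1%:R]natr1 -mulrA mulrDl mul1r lerD //.
  apply: le_trans (_ : \sum_(j < n) C * E <= _); last first.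
    by rewrite sumr_const card_ord mulr_natl.
  apply: ler_sum => j _; apply: le_trans (coef_bound_le T j C_ge0) _.
  rewrite ler_wpM2l // ler_expR ler_wpM2r // ler_wpM2r ?invr_ge0 ?(ltW nrm_v_gt0) //.
  by apply: partial_sum_le_rho => //; rewrite (leq_trans (leq_subr _ _)).
rewrite /height_bound natrM natrM natrX natrM natrM -[leRHS]mulrA ler_wpM2l //.
have -> : n.+1%:R * C * (n.+1%:R * (n.+2%:R * (2 * C))) ^+ n.+2 * E ^+ n.+3 =
    n.+1%:R * C * E * (n.+1%:R * (n.+2%:R * (2 * C * E))) ^+ n.+2.
  by rewrite [E ^+ n.+3]exprS !exprMn; ring.
apply: ler_pM; [nneg | nneg | exact: H_le | ].
apply: lerXn2r; rewrite ?nnegrE; [nneg | nneg | ].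
by rewrite !ler_wpM2l.
Qed.

(** In terms of E = e^(a T), the k-th power of the bound is O(E^(2 k + p)) with p
    independent of k; take k large enough that p a <= h k. *)
Lemma class_bound_le C h : 1 <= C -> 0 < h -> exists2 K : R, 0 < K & forall T, 0 <= T ->
  (class_bound (index_bound C T) (coef_bound C T))%:R <= K * expR ((2 * a + h) * T).
Proof.
move=> C_ge1 h_gt0; have C_gt0 : 0 < C by lra.
have C_ge0 := ltW C_gt0.
have [KM KM_gt0 KMP] := height_bound_le C_ge1.
pose q := (n.+1 * n.+1)%N; pose p := (q + n.+3 * n.+1)%N.
(* p collects the exponents of E that do not grow with k. *)
pose k := (Num.truncn (p%:R * a / h)).+1.
have k_gt : p%:R * a <= h * k%:R.
  rewrite [leRHS]mulrC -ler_pdivrMr //; apply: ltW; exact: truncnS_gt.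
have [Kn KnP] := class_bound_pow_le n (ltn0Sn _ : (0 < k)%N).
pose A : R := (3 * C) ^+ n * (2 * C).
pose B : R := Kn%:R * (2 * C) ^+ q * KM ^+ n.+1.
have A_gt0 : 0 < A by rewrite /A; posit.
have B_ge0 : 0 <= B by rewrite /B; nneg.
exists (A * (1 + B)) => [|T T_ge0]; first by rewrite mulr_gt0 //; lra.
have E_ge1 := exp_ge1 T_ge0; set E := expR (a * T) in E_ge1.
have E_ge0 : 0 <= E by lra.
have CE : 1 <= C * E by rewrite -[leLHS]mulr1 ler_pM.
have D_le : (index_bound C T)%:R <= 2 * C * E.
  have tr : (Num.truncn (C * E))%:R <= C * E by rewrite truncn_le; lra.
  by rewrite /index_bound -[X in X <= _]natr1 -/E; lra.
have P_le := prod_coef_bound_le C_ge1 T_ge0.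
have M_le := KMP T T_ge0.
rewrite -(@ler_pXn2r _ k) ?nnegrE //; last by apply: mulr_ge0; [nneg; lra | exact: expR_ge0].
rewrite -natrX.
apply: le_trans (_ : (A * E ^+ 2) ^+ k * (B * E ^+ p) <= _).
  have := KnP (index_bound C T) (coef_bound C T) (ltn0Sn _).
  rewrite -(ler_nat R) => /le_trans; apply.
  have -> : (A * E ^+ 2) ^+ k * (B * E ^+ p) =
     Kn%:R * ((3 * C) ^+ n * E * (2 * C * E)) ^+ k * (2 * C * E) ^+ q
       * (KM * E ^+ n.+3) ^+ n.+1.
    rewrite /A /B /p exprD exprM !exprMn; ring.
  rewrite !natrM !natrX natrM; apply: ler_pM; [nneg | nneg | | ].
    apply: ler_pM; [nneg | nneg | | ].
      apply: ler_wpM2l => //; apply: lerXn2r; rewrite ?nnegrE; [nneg | nneg | ].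
      by apply: ler_pM.
    by apply: lerXn2r; rewrite ?nnegrE //; nneg.
  by apply: lerXn2r; rewrite ?nnegrE //; nneg.
have B_le : B <= (1 + B) ^+ k.
  by apply: le_trans (_ : 1 + B <= _); [lra | rewrite ler_eXnr //; lra].
have Ep : E ^+ p <= expR (h * T) ^+ k.
  rewrite /E -!expRM_natl ler_expR (mulrA _ a) (mulrA _ h).
  by apply: (ler_wpM2r T_ge0); rewrite [leRHS]mulrC.
have -> : (A * (1 + B) * expR ((2 * a + h) * T)) ^+ k =
    (A * E ^+ 2) ^+ k * ((1 + B) ^+ k * expR (h * T) ^+ k).
  have -> : expR ((2 * a + h) * T) = E ^+ 2 * expR (h * T).
    by rewrite mulrDl expRD -(mulrA 2) expRM_natl.
  rewrite -!exprMn; congr (_ ^+ _).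
  move: (expR (h * T)) => x; clearbody A B E; ring.
apply: ler_wpM2l; first by nneg.
by apply: ler_pM; nneg.
Qed.

(** Classes are labelled by the codes of their normalized Hessenberg representatives. *)
Lemma count_classes_le e h : 0 < e -> 0 < h -> exists2 C : R, 0 < C &
  forall T, 1 <= T ->
    (count_classes nrm v m e T <= (C * expR ((2 * a + h) * T))%:E)%E.
Proof.
move=> e_gt0 h_gt0.
have [C C_ge1 CP] := adm_spectrum_bound e_gt0.
have [K K_gt0 KP] := class_bound_le C_ge1 h_gt0.
exists K => // T T_ge1; have T_ge0 : 0 <= T by lra.
set D := index_bound C T; set X := coef_bound C T.
have [F [A [code [A_le codeP]]]] := card_normal_hessenberg R X (ltn0Sn _ : (0 < D)%N).
apply: (@le_trans _ _ (#|A|%:R%:E)%E); last first.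
  by rewrite lee_fin; apply: le_trans (KP T T_ge0); rewrite ler_nat.
pose good (B : 'M[int]_n.+1) := [/\ \det B = 1, forall k : 'I_n, `|(char_poly B)`_k.+1| <= (X k)%:Z,
  simple_spectrum R B & normal_hessenberg (char_poly B) D B].
have repr g : adm e T g -> exists B, good B /\ conj_class g = conj_class B.
  move=> adm_g; have [coef_g vdm_g] := CP T g T_ge0 adm_g.
  have chg := adm_char_poly adm_g.
  have mu_inj : injective (signed_root m (jordan_proj (realmx R g))).
    by case: adm_g => _ _ _; apply: has_signs_inj.
  have D_ge : 4 ^+ n.+1 * `|\det (Vandermonde n.+1
       (\row_i signed_root m (jordan_proj (realmx R g)) i))| <= D%:R.
    by apply: le_trans vdm_g _; apply/ltW/truncnS_gt.
  have [Q [B [detQ gQ chB normB]]] := conjugate_to_normal mu_inj chg D_ge.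
  exists B; split; last exact: conj_class_eq gQ.
  split; rewrite ?chB //.
  - have := congr1 determinant gQ; rewrite !det_mulmx detQ (adm_det adm_g) !mul1r.
    exact: esym.
  - exact: (adm_coef_bound C_ge1 coef_g).
  - exists (signed_root m (jordan_proj (realmx R g))) => //.
    rewrite -map_char_poly chB map_char_poly; exact: chg.
apply: (@counting_le_card R _ _ _ _ (fun Y c => exists B, [/\ good B,
  Y = conj_class B & c = code B])).
  move=> _ [g adm_g <-]; have [B [goodB ->]] := repr g adm_g.
  by exists (code B); [have [] := codeP B goodB | exists B].
move=> _ _ _ _ _ [B [goodB -> ->]] [B' [goodB' -> eq_c]].
by have [_ /(_ B' goodB' eq_c) ->] := codeP B goodB.
Qed.

Hypothesis m_prod : \prod_i m i = 1.

(** The b_k range over the integers of [E_k + 1, E_k e^d], where E_k = e^(t s_k);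
    the chosen t keeps the norm of lambda(g) below T. *)
Lemma count_jordan_ge e : 0 < e -> exists c T0 : R, 0 < c /\ forall T, T0 <= T ->
  ((c * expR (a * T))%:E <= count_jordan nrm v m e T)%E.
Proof.
move=> e_gt0; have [K K_gt0 KP] := nrm_le_coord nrmP.
(* With this d, moving each coordinate by 3 d changes the norm by at most e. *)
pose d := e / (3 * K); have d_gt0 : 0 < d by rewrite divr_gt0 // mulr_gt0.
have [t0 t0P] := prescribed_spectrum (chamber_decr v_chamber) m_pm m_prod d_gt0.
have [g g_gt0 g_le] : exists2 g : R, 0 < g & forall k : 'I_n, xpredT k -> g <= s k.+1.
  by apply: finite_positive_lower_bound => k _; apply: (partial_sum_gt0 v_chamber); rewrite ?ltnS ?ltn_ord.
pose x := expR d - 1; have x_gt0 : 0 < x by rewrite subr_gt0 expR_gt1.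
pose t1 := Num.max 0 (Num.max t0 (- ln x / g)).
exists ((x / 2) ^+ n * expR (- (a * e))), (nrm v * t1 + e).
split; first by rewrite mulr_gt0 ?expR_gt0 ?exprn_gt0 ?divr_gt0.
move=> T T_ge; pose t := (T - e) / nrm v.
have t_ge : t1 <= t by rewrite ler_pdivlMr // mulrC lerBrDr.
move: (t_ge); rewrite !ge_max => /and3P[t_ge0 t_ge0' t_ge1].
pose E (k : nat) : R := expR (t * s k).
pose W (k : 'I_n) : nat := Num.truncn (x * E k.+1).
have E_ge1 k : (k <= n.+1)%N -> 1 <= E k.
  by move=> le_k; rewrite -expR0 ler_expR mulr_ge0 // partial_sum_ge0.
have xE_ge1 (k : 'I_n) : 1 <= x * E k.+1.
  rewrite -[x]lnK ?posrE // -expRD -expR0 ler_expR addrC -lerBlDr sub0r.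
  apply: le_trans (_ : t * g <= _); first by rewrite -ler_pdivrMr.
  by rewrite ler_wpM2l // g_le.
have W_le k : (W k)%:R <= x * E k.+1 by rewrite truncn_le (le_trans _ (xE_ge1 k)).
have W_ge (k : 'I_n) : x / 2 * E k.+1 <= (W k)%:R.
  have := truncnS_gt (x * E k.+1); rewrite -natr1 -/(W k) => W_gt.
  have : 1 <= (W k)%:R :> R by rewrite ler1n truncn_gt0.
  lra.
pose code := {dffun forall k : 'I_n, 'I_(W k)}.
pose b (u : code) (j : nat) : nat :=
  if j is j'.+1 then
    if insub j' is Some k then ((Num.truncn (E j)).+1 + u k)%N else 1%N
  else 1%N.
have bE u (k : 'I_n) : b u k.+1 = ((Num.truncn (E k.+1)).+1 + u k)%N.
  by rewrite /b insubT //= => lt_k; congr (_ + _)%N; congr (u _ : nat); apply: val_inj.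
have b_last u : b u n.+1 = 1%N by rewrite /b insubF // ltnn.
have s0 : s 0 = 0 by rewrite /partial_sum big_geq.
have b_bd u k : (k <= n.+1)%N -> expR (t * s k) <= (b u k)%:R <= expR (t * s k + d).
  case: k => [|k] le_k.
    by rewrite s0 mulr0 expR0 lexx add0r -expR0 ler_expR ltW.
  move: le_k; rewrite ltnS leq_eqVlt => /orP[/eqP ->|lt_k].
    by rewrite b_last (partial_sum_last v_chamber) mulr0 expR0 lexx add0r -expR0 ler_expR ltW.
  rewrite (bE u (Ordinal lt_k)) natrD /=; set uk := (u _ : nat).
  have uk_lt : (uk%:R + 1 : R) <= (W (Ordinal lt_k))%:R by rewrite natr1 ler_nat; apply: ltn_ord.
  have trS := truncnS_gt (E k.+1).
  have tr : (Num.truncn (E k.+1))%:R <= E k.+1 by rewrite truncn_le expR_ge0.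
  have := W_le (Ordinal lt_k); rewrite /= expRD -/(E k.+1) /x => W_le_k.
  rewrite -natr1 in trS *; apply/andP; split.
    by apply: le_trans (ltW trS) _; rewrite lerDl.
  move: W_le_k; rewrite mulrBl mul1r mulrC; lra.
have exg u : exists g : 'M[int]_n.+1, [/\ SLZ g, has_signs (realmx R g) m,
    forall i, `|jordan_proj (realmx R g) 0 i - t * v 0 i| <= 3 * d &
    forall k, (k <= n.+1)%N ->
      (char_poly g)`_(n.+1 - k) = partial_sign (nat_sign m) k * (b u k)%:Z].
  exact: (t0P t t_ge0' (b u) erefl (b_last u) (b_bd u)).
have [G GP] := choice exg.
have adm_G u : adm e T (G u).
  have [detG signsG near coefG] := GP u.
  have nrm_near : nrm (jordan_proj (realmx R (G u)) - t *: v) <= e.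
    have -> : e = K * (3 * d) by rewrite /d; field; rewrite gt_eqF.
    apply: KP => [|i]; first by rewrite mulr_ge0 // ltW.
    by move: (jordan_proj _) near => lam near; rewrite !mxE; apply: near.
  split => //; first by apply: le_trans (dist_ray_le nrmP _ _ t_ge0) nrm_near.
  have [tri hom _] := nrmP.
  rewrite -(subrK (t *: v) (jordan_proj _)); apply: le_trans (tri _ _) _.
  rewrite hom ger0_norm // /t mulrVK ?unitfE ?gt_eqF //; lra.
apply: (@le_trans _ _ (#|finset.setTfor code|%:R%:E)%E); last first.
  apply: (@counting_ge_card R _ code _ _ (fun u => jordan_proj (realmx R (G u)))); last first.
    by move=> u _; exists (G u).
  move=> u u' _ _ eq_lam.
  have eq_ch : char_poly (G u) = char_poly (G u').
    have eqR : char_poly (realmx R (G u)) = char_poly (realmx R (G u')).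
      by rewrite (adm_char_poly (adm_G u)) (adm_char_poly (adm_G u')) eq_lam.
    rewrite /realmx -!map_char_poly in eqR; apply/polyP => k.
    have := congr1 (fun p : {poly R} => p`_k) eqR.
    by rewrite [LHS]coef_map [RHS]coef_map => /intr_inj.
  apply/ffunP => k; apply: val_inj.
  have [_ _ _ cu] := GP u; have [_ _ _ cu'] := GP u'.
  have le_k : (k.+1 <= n.+1)%N by apply: leqW.
  have sign_neq0 : partial_sign (nat_sign m) k.+1 != 0.
    rewrite /partial_sign; apply: mulf_neq0; first by rewrite signr_eq0.
    rewrite prodf_seq_neq0; apply/allP => j _.
    by rewrite /nat_sign /=; case: (m_pm (inord j)) => ->.
  have := cu k.+1 le_k; rewrite eq_ch (cu' k.+1 le_k) !bE => /(mulfI sign_neq0).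
  by move=> [] /eqP; rewrite eqn_add2l => /eqP.
rewrite lee_fin cardsT card_dep_ffun foldrE big_map big_enum /=.
under eq_bigr do rewrite card_ord.
rewrite natr_prod.
have -> : (x / 2) ^+ n * expR (- (a * e)) * expR (a * T) =
    \prod_(k < n) (x / 2 * E k.+1).
  rewrite big_split /= prodr_const card_ord -mulrA; congr (_ * _).
  rewrite -expR_sum -mulr_sumr -expRD; congr expR.
  have -> : \sum_(k < n) s k.+1 = rho v.
    by rewrite -(sum_partial_sum v_chamber) big_ord_recl /= s0 add0r.
  by rewrite /t /a; field; rewrite gt_eqF.
apply: ler_prod => k _; rewrite W_ge andbT mulr_ge0 ?expR_ge0 //.
by rewrite divr_ge0 // ltW.
Qed.

End Growth.

(** * The growth indicators *)

Theorem theorem1p8 (R : realType) (n : nat) (hn : (2 <= n)%N)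
  (nrm : 'rV[R]_n -> R) (hnrm : is_norm nrm)
  (v : 'rV[R]_n) (hv : Hplus v)
  (m : 'I_n -> int) (hm : forall i, m i = 1 \/ m i = -1)
  (hprod : \prod_(i < n) m i = 1) :
  (upperE nrm v m = lowerE nrm v m /\ upperE nrm v m = (rho v)%:E) /\
  [/\ ((rho v)%:E <= lowerE_star nrm v m)%E,
      (lowerE_star nrm v m <= upperE_star nrm v m)%E
    & (upperE_star nrm v m <= (2 * rho v)%:E)%E].
Proof.
case: n hn nrm hnrm v hv m hm hprod => [//|n] hn nrm hnrm v hv m hm hprod.
have v_gt0 : 0 < nrm v.
  rewrite lt_neqAle (nrm_ge0 hnrm) andbT eq_sym; apply/eqP => nrm_v0.
  have [_ _ /(_ v nrm_v0) v0] := hnrm.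
  have lt01 : ((@ord0 n) < (@ord_max n))%N by rewrite /=.
  by have := chamber_decr hv lt01; rewrite v0 !mxE ltxx.
pose a := rho v / nrm v.
have nrm_a : nrm v * a = rho v by rewrite mulrC divfK // gt_eqF.
have J_mono e e' T : 0 < e -> e <= e' ->
    (count_jordan nrm v m e T <= count_jordan nrm v m e' T)%E.
  by move=> _ ee'; apply/counting_subset/image_subset/admissible_mono.
have M_mono e e' T : 0 < e -> e <= e' ->
    (count_classes nrm v m e T <= count_classes nrm v m e' T)%E.
  by move=> _ ee'; apply/counting_subset/image_subset/admissible_mono.
have J_low : (a%:E <= lower_rate (count_jordan nrm v m))%E.
  apply: lower_rate_ge => // e e_gt0.
  have [c [T0 [c_gt0 cP]]] := count_jordan_ge hnrm hv hm v_gt0 hprod e_gt0.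
  exact: liminf_log_rate_ge c_gt0 cP.
have M_low : (a%:E <= lower_rate (count_classes nrm v m))%E.
  apply: lower_rate_ge => // e e_gt0.
  have [c [T0 [c_gt0 cP]]] := count_jordan_ge hnrm hv hm v_gt0 hprod e_gt0.
  apply: (liminf_log_rate_ge (T1 := T0) c_gt0) => T T_ge.
  exact: le_trans (cP T T_ge) (count_jordan_le_classes _ _ _ _ _).
have J_up : (upper_rate (count_jordan nrm v m) <= a%:E)%E.
  apply: upper_rate_le => // e e_gt0; apply: limsup_log_rate_le => h h_gt0.
  have [C C_gt0 CP] := count_jordan_le hnrm hv hm v_gt0 e_gt0.
  exists C => // T T_ge1; apply: le_trans (CP T T_ge1) _.
  rewrite lee_fin ler_pM2l // ler_expR -/a mulrDl lerDl mulr_ge0 ?(ltW h_gt0) //; lra.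
have M_up : (upper_rate (count_classes nrm v m) <= (2 * a)%:E)%E.
  apply: upper_rate_le => // e e_gt0; apply: limsup_log_rate_le => h h_gt0.
  exact: (count_classes_le hnrm hv hm v_gt0 e_gt0 h_gt0).
have J_lu := lower_rate_le_upper J_mono.
have M_lu := lower_rate_le_upper M_mono.
have J_upE : upper_rate (count_jordan nrm v m) = a%:E.
  by apply/eqP; rewrite eq_le J_up (le_trans J_low).
have J_lowE : lower_rate (count_jordan nrm v m) = a%:E.
  by apply/eqP; rewrite eq_le J_low (le_trans J_lu).
have nrm_ge0E : (0 <= (nrm v)%:E)%E by rewrite lee_fin ltW.
rewrite /upperE /lowerE /lowerE_star /upperE_star J_upE J_lowE -EFinM nrm_a.
split=> //; split.
- by rewrite -nrm_a EFinM lee_wpmul2l.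
- by rewrite lee_wpmul2l.
- by rewrite -nrm_a mulrCA EFinM lee_wpmul2l.
Qed.
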